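(* For every $\alpha\in(0,1)$, $$\log H_{1,\infty}(\alpha)=-(1-\alpha)\log\big(4(1-\alpha)\sin(\pi\alpha)\big)+\frac1\pi\,\mathrm{Im}\,\mathrm{Li}_2\big(e^{2\pi i\alpha}\big),$$ and $$H_{\infty,2}(\alpha)=\frac{1}{\big(4\alpha\sin(\pi\alpha)\big)^{\alpha/2}}\exp\Big(\frac1{2\pi}\mathrm{CI}_2\big(2\pi(1-\alpha)\big)\Big).$$
   Context: $\mathrm{Li}_2(z)=-\int_0^z\frac{\log(1-u)}{u}\,du$ for $z\in\mathbb{C}\setminus[1,\infty)$ is the dilogarithm, and $\mathrm{CI}_2(\theta)=-\int_0^{\theta}\log(2|\sin(u/2)|)\,du$ is the Clausen function. $S=\{x+iy\in\mathbb{C}:0<y<1\}$. For a function $h$ on $S$ and $0<y<1$, $h_y$ denotes the function $x\mapsto h(x+iy)$ on $\mathbb{R}$. For $1\le p,q\le\infty$, $\mathbb{H}^{p,q}(S)$ is the space of holomorphic $h:S\to\mathbb{C}$ with $$\|h\|_{\mathbb{H}^{p,q}}=\sup_{0<y<1}\ \inf_{f+g=h_y}\big\{(1-y)^{-1}\|f\|_{L^p(\mathbb{R})}+y^{-1}\|g\|_{L^q(\mathbb{R})}\big\}<\infty.$$ For $h\in\mathbb{H}^{p,q}(S)$, the boundary values $h_0\in L^p(\mathbb{R})$ and $h_1\in L^q(\mathbb{R})$ are the limits of $h_y$, in the sense of tempered distributions, as $y\downarrow0$ and $y\uparrow1$ respectively (these exist). For $0<\alpha<1$, $$H_{p,q}(\alpha)=\sup_{h\in\mathbb{H}^{p,q}(S)}\frac{\|h_\alpha\|_{L^\infty(\mathbb{R})}}{\|h_0\|_{L^p(\mathbb{R})}^{1-\alpha}\|h_1\|_{L^q(\mathbb{R})}^{\alpha}},$$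 the supremum being over $h$ not identically zero. *)

(* Defs.v *)
From HB Require Import structures.
From mathcomp Require Import all_boot all_order all_algebra.
From mathcomp Require Import all_classical all_reals all_analysis.
From mathcomp.real_closed Require Import complex.

Set Implicit Arguments.
Unset Strict Implicit.
Unset Printing Implicit Defensive.

Import Order.TTheory GRing.Theory Num.Theory.
Import numFieldNormedType.Exports Normc.

Local Open Scope classical_set_scope.
Local Open Scope ring_scope.
Local Open Scope complex_scope.

Section ComplexFunctions.
Context {R : realType}.
Local Notation mu := (@lebesgue_measure R).

Definition cmeasurable (f : R -> R[i]) : Prop :=
  measurable_fun [set: R] (fun x => complex.Re (f x)) /\
  measurable_fun [set: R] (fun x => complex.Im (f x)).

Definition cLnorm (p : \bar R) (f : R -> R[i]) : \bar R :=
  Lnorm mu p (fun x => (normc (f x))%:E).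

(* L^p functions through Borel measurable representatives *)
Definition cLp (p : \bar R) (f : R -> R[i]) : Prop :=
  cmeasurable f /\ (cLnorm p f < +oo)%E.

Definition cintegral (D : set R) (f : R -> R[i]) : R[i] :=
  (\int[mu]_(x in D) complex.Re (f x)) +i* (\int[mu]_(x in D) complex.Im (f x)).

(* The second term vanishes when a <= b, the first one when b <= a. *)
Definition oriented_integral (a b : R) (f : R -> R) : R :=
  (\int[mu]_(x in `[a, b]) f x) - (\int[mu]_(x in `[b, a]) f x).

Definition expi (t : R) : R[i] := cos t +i* sin t.

(* principal argument, in ]-pi, pi]; only meaningful for z != 0 *)
Definition Arg (z : R[i]) : R :=
  let t := acos (complex.Re z / normc z) in
  if 0 <= complex.Im z then t else - t.

Definition Log (z : R[i]) : R[i] := ln (normc z) +i* Arg z.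

(* integral of f along the segment u = t z, 0 <= t <= 1 *)
Definition segment_integral (f : R[i] -> R[i]) (z : R[i]) : R[i] :=
  cintegral `[0, 1] (fun t => f (t%:C * z) * z).

(* For z in C \ [1, +oo[ the segment [0, z] stays in that domain, where
   the integrand is holomorphic (its singularity at 0 is removable). *)
Definition Li2 (z : R[i]) : R[i] :=
  - segment_integral (fun u => Log (1 - u) / u) z.

Definition CI2 (theta : R) : R :=
  - oriented_integral 0 theta (fun u => ln (2 * `|sin (u / 2)|)).

Definition schwartz_real (phi : R -> R) : Prop :=
  (forall (n : nat) (x : R), derivable (derive1n n phi) x 1) /\
  (forall m n : nat, exists M : R, forall x : R, `|x ^+ m * derive1n n phi x| <= M).

Definition schwartz (phi : R -> R[i]) : Prop :=
  schwartz_real (fun x => complex.Re (phi x)) /\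
  schwartz_real (fun x => complex.Im (phi x)).

(* the tempered distribution defined by f, applied to phi *)
Definition pairing (f phi : R -> R[i]) : R[i] :=
  cintegral [set: R] (fun x => f x * phi x).

Definition tempered_cvg (F : set_system R) (u : R -> R -> R[i])
    (f : R -> R[i]) : Prop :=
  forall phi : R -> R[i], schwartz phi ->
    (fun y => pairing (u y) phi : R[i]^o) @ F --> (pairing f phi : R[i]^o).

End ComplexFunctions.

Section Strip.
Context {R : realType}.

Definition strip : set R[i] := [set z | 0 < complex.Im z < 1].

(* A function on the strip is a total function on R[i] whose values outside
   the strip are never used. *)
Definition hline (h : R[i] -> R[i]) (y : R) : R -> R[i] := fun x => h (x +i* y).

(* Complex differentiability: R[i]^o is R[i] as a normed space over R[i]. *)
Definition holomorphic_on (A : set R[i]) (h : R[i] -> R[i]) : Prop :=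
  forall z : R[i], A z -> derivable (h : R[i]^o -> R[i]^o) z 1.

(* the norm of h_y in L^p + L^q with the weights (1 - y)^-1 and y^-1 *)
Definition sumnorm (p q : \bar R) (y : R) (k : R -> R[i]) : \bar R :=
  ereal_inf [set r : \bar R | exists f g : R -> R[i],
    [/\ cmeasurable f, cmeasurable g, (forall x, f x + g x = k x) &
        r = (((1 - y)^-1)%:E * cLnorm p f + (y^-1)%:E * cLnorm q g)%E]].

Definition Hnorm (p q : \bar R) (h : R[i] -> R[i]) : \bar R :=
  ereal_sup [set sumnorm p q y (hline h y) | y in `]0, 1[].

Definition Hspace (p q : \bar R) (h : R[i] -> R[i]) : Prop :=
  holomorphic_on strip h /\ (Hnorm p q h < +oo)%E.

(* h0 and h1 are (representatives of) the boundary values of h; they are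
   determined by h up to equality almost everywhere, and every h in Hspace p q
   has such boundary values (1 <= p, q). *)
Definition boundary_values (p q : \bar R) (h : R[i] -> R[i])
    (h0 h1 : R -> R[i]) : Prop :=
  [/\ cLp p h0, cLp q h1,
      tempered_cvg (0^'+) (hline h) h0 & tempered_cvg (1^'-) (hline h) h1].

Definition Hconst (p q : \bar R) (alpha : R) : \bar R :=
  ereal_sup [set r : \bar R | exists (h : R[i] -> R[i]) (h0 h1 : R -> R[i]),
    [/\ Hspace p q h, (exists2 z, strip z & h z != 0),
        boundary_values p q h h0 h1 &
        r = (cLnorm +oo (hline h alpha) /
             (cLnorm p h0 `^ (1 - alpha) * cLnorm q h1 `^ alpha))%E]].

End Strip.

(* Main.v *)
(** For a point [z0] of height [alpha] in the strip put [w0 = exp (pi z0)]. The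
    map [exp (pi z)] sends the strip onto the upper half plane, and
    [zeta = (w - w0) / (w - w0^* )] sends it further onto the unit disc. The
    harmonic measure at [z0] has densities [P0] and [P1] on the two boundary
    lines, of masses [1 - alpha] and [alpha].

    Upper bound. For a polynomial [p], the products [P_j exp (- p zeta)]
    restricted to the boundary lines are Schwartz functions, so they can be
    tested against the boundary values of [h]. Cauchy's theorem on rectangles,
    moved to the boundary lines, then gives
      [|h z0| exp (- Re p 0) <= \int P0 |h0| exp (- Re p) + \int P1 |h1| exp (- Re p)].
    Real parts of polynomials approximate continuous functions on the circle
    (Bernstein), and [Re p 0] is the average of [Re p] against the harmonic
    measure. Let [Re p] approach from above the optimal profile, which is
    [log P_j + const] on the line of the [L^1] norm, [log P_j / 2 + const] on
    that of the [L^2] norm, and constant on that of the [L^infty] norm.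

    Lower bound. With the same [p], the functions [exp (- e z^2) exp (p zeta)]
    are almost extremal.

    The sharp constants are thus entropies [\int P_j log P_j]. Substituting the
    angle at which a boundary point is seen from [w0] expresses them by the
    Clausen function, and the substitution [u = sin phi / sin (phi + b)]
    relates it to the imaginary part of the dilogarithm. *)

(* The boundary values of [h] are only limits in the sense of tempered distributions, so every
   passage to the boundary has to go through a test function that does not move with the height. The
   functions [phi] serve this purpose: their building blocks form an algebra closed under
   differentiation. In the interior, [h] is controlled by [weighted_bound], a bound on weighted
   means along horizontal lines; it gives no decay at infinity, so the vertical sides of the
   rectangles are selected by averaging.

   The polynomials approach the profile from above so that each of them inherits the bound by 1 on
   the boundary integrals; only the value at the centre passes to the limit. The profile is optimal
   because it ties the integrand to the norm: for $L^1$ the density cancels, for $L^2$ it is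
   separated by $2xy\le x^2+y^2$. Its constants are fixed by asking that the two boundary integrals
   be at most the two harmonic masses, whose sum is 1. *)
From HB Require Import structures.
Require Import Defs.
From mathcomp Require Import all_boot all_order all_algebra.
From mathcomp Require Import all_classical all_reals all_analysis measurable_realfun.
From mathcomp.real_closed Require Import complex.
From mathcomp Require Import ring lra.

Set Implicit Arguments.
Unset Strict Implicit.
Unset Printing Implicit Defensive.

Import Order.TTheory GRing.Theory Num.Theory.
Import numFieldNormedType.Exports Normc.

Local Open Scope classical_set_scope.
Local Open Scope ring_scope.
Local Open Scope complex_scope.

(** * Complex differentiation and the exponential *)

Section ComplexNorm.
Context {R : realType}.
Implicit Types (x y z u v : R[i]) (r t : R).

Lemma normcE2 z : normc z = Num.sqrt (complex.Re z ^+ 2 + complex.Im z ^+ 2).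
Proof. by case: z. Qed.

Lemma sqr_normc z : normc z ^+ 2 = complex.Re z ^+ 2 + complex.Im z ^+ 2.
Proof. by rewrite normcE2 sqr_sqrtr // addr_ge0 // sqr_ge0. Qed.

Lemma normc_ge0 z : 0 <= normc z.
Proof. by rewrite normcE2 sqrtr_ge0. Qed.

Lemma normr_normc z : `|z| = (normc z)%:C.
Proof. by case: z. Qed.

Lemma ler_normcD x y : normc (x + y) <= normc x + normc y.
Proof. exact: (@le_normcD R x y). Qed.

Lemma normcN z : normc (- z) = normc z.
Proof. by case: z => a b; rewrite !normcE2 /= !sqrrN. Qed.

Lemma normcBC x y : normc (x - y) = normc (y - x).
Proof. by rewrite -normcN opprB. Qed.

Lemma ler_normcB x y : normc (x - y) <= normc x + normc y.
Proof. by apply: le_trans (ler_normcD _ _) _; rewrite normcN. Qed.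

Lemma lerB_normc x y : normc x - normc y <= normc (x - y).
Proof. by rewrite lerBlDr -{1}[x](subrK y); exact: ler_normcD. Qed.

Lemma lerB_normcD x y : normc x - normc y <= normc (x + y).
Proof. by rewrite -(normcN y) -[in leRHS](opprK y); exact: lerB_normc. Qed.

Lemma ler_Re_normc z : `|complex.Re z| <= normc z.
Proof.
by rewrite normcE2 -sqrtr_sqr ler_sqrt ?addr_ge0 ?sqr_ge0 // lerDl sqr_ge0.
Qed.

Lemma ler_Im_normc z : `|complex.Im z| <= normc z.
Proof.
by rewrite normcE2 -sqrtr_sqr ler_sqrt ?addr_ge0 ?sqr_ge0 // lerDr sqr_ge0.
Qed.

Lemma ler_normc_ReIm z : normc z <= `|complex.Re z| + `|complex.Im z|.
Proof.
rewrite -(@ler_pXn2r _ 2) ?nnegrE ?normc_ge0 ?addr_ge0 //.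
rewrite sqr_normc sqrrD !real_normK ?num_real //.
rewrite -addrA lerD2l lerDr mulrn_wge0 ?mulr_ge0 //.
Qed.

Lemma normc_real r : normc r%:C = `|r|.
Proof. by rewrite normcE2 /= expr0n addr0 sqrtr_sqr. Qed.

Lemma normc_eq0 z : (normc z == 0) = (z == 0).
Proof.
apply/eqP/eqP => [/eq0_normc //|->]; exact: normc0.
Qed.

Lemma normc_gt0 z : (0 < normc z) = (z != 0).
Proof. by rewrite lt_def normc_eq0 normc_ge0 andbT. Qed.

Lemma normcX z n : normc (z ^+ n) = normc z ^+ n.
Proof.
elim: n => [|n IH]; first exact: normc1.
by rewrite !exprS normcM IH.
Qed.

Lemma normc_conj z : normc (z^*)%C = normc z.
Proof. by case: z => a b; rewrite !normcE2 /= sqrrN. Qed.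

Lemma ReD x y : complex.Re (x + y) = complex.Re x + complex.Re y.
Proof. by case: x; case: y. Qed.
Lemma ImD x y : complex.Im (x + y) = complex.Im x + complex.Im y.
Proof. by case: x; case: y. Qed.
Lemma ReN x : complex.Re (- x) = - complex.Re x.
Proof. by case: x. Qed.
Lemma ImN x : complex.Im (- x) = - complex.Im x.
Proof. by case: x. Qed.
Lemma ReB x y : complex.Re (x - y) = complex.Re x - complex.Re y.
Proof. by rewrite ReD ReN. Qed.
Lemma ImB x y : complex.Im (x - y) = complex.Im x - complex.Im y.
Proof. by rewrite ImD ImN. Qed.
Lemma ReM x y : complex.Re (x * y) =
  complex.Re x * complex.Re y - complex.Im x * complex.Im y.
Proof. by case: x; case: y. Qed.
Lemma ImM x y : complex.Im (x * y) =
  complex.Re x * complex.Im y + complex.Im x * complex.Re y.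
Proof. by case: x; case: y => a b c d /=; rewrite [d * a]mulrC. Qed.

Lemma eq_ReIm x y : complex.Re x = complex.Re y -> complex.Im x = complex.Im y ->
  x = y.
Proof. by case: x; case: y => a b c d /= -> ->. Qed.

End ComplexNorm.

Section ComplexDerivative.
Context {R : realType}.
Implicit Types (h g : R[i] -> R[i]) (z l u : R[i]).

(** The remainder form contains no quotient, so the increment 0 is no exception and the product and
    chain rules reduce to estimates of real numbers. [derivable_cdiffP] identifies it with
    derivability over [R[i]]. *)
Definition cderiv h z l : Prop := forall e : R, 0 < e -> exists2 d : R, 0 < d &
  forall u, normc u < d -> normc (h (z + u) - h z - l * u) <= e * normc u.

Definition cdiff h z := exists l, cderiv h z l.

Lemma derivable_cdiffP h z :
  derivable (h : R[i]^o -> R[i]^o) z 1 <-> cdiff h z.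
Proof.
split.
- move=> /cvg_ex[l hl]; exists l => e e0.
  move/cvgrPdist_le : hl => /(_ e%:C); rewrite ltcR => /(_ e0).
  move=> /nbhs_ballP[d /= d0 Hd].
  (* In the order of [R[i]] a positive element has zero imaginary part, so the radius is real. *)
  have dE : d = (complex.Re d)%:C.
    by case: d d0 {Hd} => a b; rewrite ltcE /= => /andP[/eqP -> _].
  exists (complex.Re d); first by rewrite -ltcR -dE.
  move=> u ud.
  have [->|u0] := eqVneq u 0.
    by rewrite mulr0 subr0 addr0 subrr normc0 mulr0.
  have := Hd u; rewrite /ball /= /ball_ /= sub0r normrN normr_normc dE ltcR.
  move=> /(_ ud u0) /=; rewrite [_ *: 1]mulr1.
  rewrite normr_normc lecR => H.
  rewrite -ler_pdivrMr ?normc_gt0 // -normcV -normcM.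
  apply: le_trans H.
  rewrite -normcN le_eqVlt; apply/orP; left; apply/eqP; congr (normc _).
  rewrite /GRing.scale /= (addrC u z); field. exact: u0.
- move=> [l hl]; apply/cvg_ex; exists l; apply/cvgrPdist_le => e e0.
  have eE : e = (complex.Re e)%:C.
    by case: e e0 => a b; rewrite ltcE /= => /andP[/eqP -> _].
  have e0' : 0 < complex.Re e by rewrite -ltcR -eE.
  have [d d0 Hd] := hl _ e0'.
  apply/nbhs_ballP; exists d%:C => /=; first by rewrite ltcR.
  move=> u; rewrite /ball /= /ball_ /= sub0r normrN normr_normc ltcR => ud u0.
  have := Hd u ud; rewrite -ler_pdivrMr ?normc_gt0 // -normcV -normcM.
  rewrite eE normr_normc lecR; apply: le_trans.
  rewrite [_ *: 1]mulr1.
  rewrite -normcN le_eqVlt; apply/orP; left; apply/eqP; congr (normc _).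
  rewrite /GRing.scale /= (addrC u z); field. exact: u0.
Qed.

Lemma cderiv_continuous h z l : cderiv h z l -> forall e : R, 0 < e ->
  exists2 d : R, 0 < d & forall u, normc u < d -> normc (h (z + u) - h z) < e.
Proof.
move=> H e e0; have [d d0 Hd] := H 1 ltr01.
have k0 : 0 < 2 + normc l by rewrite ltr_wpDr ?normc_ge0.
exists (Num.min d (e / (2 + normc l))); first by rewrite lt_min d0 divr_gt0.
move=> u; rewrite lt_min ltr_pdivlMr // => /andP[/Hd H1 H2].
rewrite -(subrK (l * u) (h (z + u) - h z)).
apply: le_lt_trans (ler_normcD _ _) _; rewrite normcM.
have := normc_ge0 u; have := normc_ge0 l; nra.
Qed.

Lemma cderiv_cst c z : cderiv (fun=> c) z 0.
Proof.
move=> e e0; exists 1 => // u _.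
by rewrite subrr sub0r mul0r oppr0 normc0 mulr_ge0 ?normc_ge0 ?ltW.
Qed.

Lemma cderiv_id z : cderiv id z 1.
Proof.
move=> e e0; exists 1 => // u _.
by rewrite mul1r [z + u]addrC addrK subrr normc0 mulr_ge0 ?normc_ge0 ?ltW.
Qed.

Lemma cderivD h g z l m : cderiv h z l -> cderiv g z m ->
  cderiv (fun z => h z + g z) z (l + m).
Proof.
move=> Hh Hg e e0; have e2 : 0 < e / 2 by rewrite divr_gt0.
have [d d0 Hd] := Hh _ e2; have [d' d'0 Hd'] := Hg _ e2.
exists (Num.min d d'); first by rewrite lt_min d0.
move=> u; rewrite lt_min => /andP[/Hd H1 /Hd' H2].
have -> : h (z + u) + g (z + u) - (h z + g z) - (l + m) * u =
  (h (z + u) - h z - l * u) + (g (z + u) - g z - m * u) by ring.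
by apply: le_trans (ler_normcD _ _) _; lra.
Qed.

Lemma cderivM h g z l m : cderiv h z l -> cderiv g z m ->
  cderiv (fun z => h z * g z) z (l * g z + h z * m).
Proof.
move=> Hh Hg e e0.
pose K := 1 + normc (g z) + normc (h z) + normc l.
have K1 : 1 <= K.
  by rewrite /K -!addrA lerDl !addr_ge0 ?normc_ge0.
have K0 : 0 < K by apply: lt_le_trans K1.
have e3 : 0 < e / (3 * K) by rewrite divr_gt0 // mulr_gt0.
have e3K : e / (3 * K) * K * 3 = e by field; rewrite gt_eqF.
have [d d0 Hd] := Hh _ e3; have [d' d'0 Hd'] := Hg _ e3.
have [d2 d20 Hd2] := cderiv_continuous Hg (divr_gt0 e0 (mulr_gt0 (ltr0n _ 3) K0)).
have [d3 d30 Hd3] := cderiv_continuous Hg ltr01.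
exists (Num.min (Num.min d d') (Num.min d2 d3)); first by rewrite !lt_min d0 d'0 d20.
move=> u; rewrite !lt_min => /andP[/andP[/Hd H1 /Hd' H2] /andP[/Hd2 H3 /Hd3 H4]].
have -> : h (z + u) * g (z + u) - (h z * g z) - (l * g z + h z * m) * u =
  (h (z + u) - h z - l * u) * g (z + u) + h z * (g (z + u) - g z - m * u) +
  l * u * (g (z + u) - g z) by ring.
have G : normc (g (z + u)) <= K.
  have := lerB_normc (g (z + u)) (g z); rewrite /K.
  by have := normc_ge0 (h z); have := normc_ge0 l; lra.
have HK : normc (h z) <= K.
  by rewrite /K; have := normc_ge0 (g z); have := normc_ge0 l; lra.
have LK : normc l <= K.
  by rewrite /K; have := normc_ge0 (g z); have := normc_ge0 (h z); lra.
have u0 := normc_ge0 u.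
apply: le_trans (ler_normcD _ _) _.
apply: (@le_trans _ _ (e / (3 * K) * normc u * K + K * (e / (3 * K) * normc u)
  + K * normc u * (e / (3 * K)))).
  apply: lerD; first apply: le_trans (ler_normcD _ _) _; first apply: lerD.
  - by rewrite normcM ler_pM ?normc_ge0.
  - by rewrite normcM ler_pM ?normc_ge0.
  - by rewrite !normcM ler_pM ?normc_ge0 ?mulr_ge0 ?normc_ge0 ?ler_pM ?normc_ge0 // ltW.
rewrite le_eqVlt; apply/orP; left; apply/eqP.
by rewrite -[in RHS]e3K; ring.
Qed.

Lemma cderiv_comp h g z l m : cderiv g z m -> cderiv h (g z) l ->
  cderiv (fun z => h (g z)) z (l * m).
Proof.
move=> Hg Hh e e0.
pose K := 1 + normc l + normc m.
have K0 : 0 < K by rewrite /K -addrA ltr_wpDr ?addr_ge0 ?normc_ge0.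
have e2 : 0 < e / (2 * K) by rewrite divr_gt0 // mulr_gt0.
have e2K : e / (2 * K) * K * 2 = e by field; rewrite gt_eqF.
have [d d0 Hd] := Hh _ e2; have [d' d'0 Hd'] := Hg _ e2.
have [d1 d10 Hd1] := Hg _ ltr01.
have [d2 d20 Hd2] := cderiv_continuous Hg d0.
exists (Num.min (Num.min d' d1) d2); first by rewrite !lt_min d'0 d10 d20.
move=> u; rewrite !lt_min => /andP[/andP[/Hd' H1 /Hd1 H2] /Hd2 /Hd].
rewrite (_ : g z + (g (z + u) - g z) = g (z + u)); last by ring.
move=> H3.
have -> : h (g (z + u)) - h (g z) - l * m * u =
  (h (g (z + u)) - h (g z) - l * (g (z + u) - g z)) +
    l * (g (z + u) - g z - m * u) by ring.
have H4 : normc (g (z + u) - g z) <= K * normc u.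
  rewrite -(subrK (m * u) (g (z + u) - g z)).
  apply: le_trans (ler_normcD _ _) _; rewrite normcM /K.
  by have := mulr_ge0 (normc_ge0 l) (normc_ge0 u); lra.
apply: le_trans (ler_normcD _ _) _; rewrite normcM.
have LK : normc l <= K by rewrite /K; have := normc_ge0 m; lra.
apply: (@le_trans _ _ (e / (2 * K) * (K * normc u) + K * (e / (2 * K) * normc u))).
  apply: lerD; last by rewrite ler_pM ?normc_ge0.
  by apply: le_trans H3 _; rewrite ler_pM2l.
rewrite le_eqVlt; apply/orP; left; apply/eqP.
by rewrite -[in RHS]e2K; ring.
Qed.

Lemma cderivV z : z != 0 -> cderiv (fun z => z^-1) z (- z^-2).
Proof.
move=> z0 e e0; have nz : 0 < normc z by rewrite normc_gt0.
exists (Num.min (normc z / 2) (e * normc z ^+ 3 / 2)).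
  by rewrite lt_min !divr_gt0 // mulr_gt0 // exprn_gt0.
move=> u; rewrite lt_min => /andP[H1 H2].
have nzu : normc z / 2 <= normc (z + u).
  by have := lerB_normcD z u; lra.
have zu0 : z + u != 0 by rewrite -normc_gt0; apply: lt_le_trans nzu; rewrite divr_gt0.
have -> : (z + u)^-1 - z^-1 - - z^-2 * u = u ^+ 2 * (z^-2 * (z + u)^-1).
  by field; rewrite z0 zu0.
rewrite !normcM !normcV !normcX exprS expr1 -mulrA [e * _]mulrC.
rewrite ler_wpM2l ?normc_ge0 //.
rewrite mulrA ler_pdivrMr ?normc_gt0 // ler_pdivrMr ?mulr_gt0 //.
apply: (@le_trans _ _ (e * normc z ^+ 3 / 2)); first exact: ltW.
rewrite [leLHS](_ : _ = e * (normc z / 2) * (normc z * normc z)); last by field.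
by rewrite ler_wpM2r ?mulr_ge0 ?normc_ge0 // ler_pM2l.
Qed.

Lemma cdiff_cst c z : cdiff (fun=> c) z.
Proof. by exists 0; exact: cderiv_cst. Qed.
Lemma cdiff_id z : cdiff id z.
Proof. by exists 1; exact: cderiv_id. Qed.
Lemma cdiffD h g z : cdiff h z -> cdiff g z -> cdiff (fun z => h z + g z) z.
Proof. by move=> [l Hl] [m Hm]; exists (l + m); exact: cderivD. Qed.
Lemma cdiffM h g z : cdiff h z -> cdiff g z -> cdiff (fun z => h z * g z) z.
Proof. by move=> [l Hl] [m Hm]; eexists; exact: cderivM Hl Hm. Qed.
Lemma cdiff_comp h g z : cdiff g z -> cdiff h (g z) -> cdiff (fun z => h (g z)) z.
Proof. by move=> [m Hm] [l Hl]; eexists; exact: (cderiv_comp Hm Hl). Qed.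
Lemma cdiffN h z : cdiff h z -> cdiff (fun z => - h z) z.
Proof.
move=> /(cdiffM (cdiff_cst (-1) z)).
by congr cdiff; apply/funext => u; rewrite mulN1r.
Qed.
Lemma cdiffB h g z : cdiff h z -> cdiff g z -> cdiff (fun z => h z - g z) z.
Proof. by move=> Hh /cdiffN; exact: cdiffD. Qed.
Lemma cdiffV h z : cdiff h z -> h z != 0 -> cdiff (fun z => (h z)^-1) z.
Proof.
move=> Hh h0; apply: (cdiff_comp Hh).
by exists (- (h z)^-2); exact: cderivV.
Qed.

Lemma cdiff_horner (p : {poly R[i]}) z : cdiff (fun z => p.[z]) z.
Proof.
elim/poly_ind : p => [|p c IH].
  under eq_fun do rewrite horner0; exact: cdiff_cst.
under eq_fun do rewrite hornerMXaddC.
by apply: cdiffD; [apply: cdiffM => //; exact: cdiff_id|exact: cdiff_cst].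
Qed.

Lemma cdiff_continuous h z : cdiff h z -> forall e : R, 0 < e ->
  exists2 d : R, 0 < d & forall u, normc u < d -> normc (h (z + u) - h z) < e.
Proof. by move=> [l]; exact: cderiv_continuous. Qed.

End ComplexDerivative.

Section ComplexExponential.
Context {R : realType}.
Implicit Types (x y t : R) (z u v : R[i]).

(** From $e^{-t}\ge1-t$ one gets $e^t(1-t)\le1$, hence $(e^t-1-t)(1-t)\le t^2$, and $1-t\ge1/2$
    accounts for the factor 2. *)
Lemma expR_sub1_le t : t <= 2^-1 -> expR t - 1 - t <= 2 * t ^+ 2.
Proof.
move=> t2; have H := expR_ge1Dx (- t); have E := expRxMexpNx_1 t.
have := expR_gt0 t => e0.
have H2 : expR t * (1 - t) <= 1 by nra.
have H3 : 0 <= t ^+ 2 by rewrite sqr_ge0.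
have H4 : (expR t - 1 - t) * (1 - t) <= t ^+ 2 by nra.
have H5 := expR_ge1Dx t.
nra.
Qed.

Lemma ler_norm_sin t : `|sin t| <= `|t|.
Proof.
wlog t0 : t / 0 <= t => [H|].
  case: (leP 0 t) => [/H //|/ltW t0].
  by rewrite -(normrN (sin t)) -sinN -(normrN t); apply: H; lra.
have [c _] : exists2 c, c \in `[0, t]%R & sin t - sin 0 = cos c * (t - 0).
  apply: MVT_segment => //; apply: continuous_subspaceT.
  by move=> x; exact: continuous_sin.
rewrite sin0 !subr0 => ->; rewrite normrM ler_piMl //; exact: cos_max.
Qed.

Lemma cos_sub1_le t : `|cos t - 1| <= t ^+ 2 / 2.
Proof.
have -> : cos t = 1 - 2 * sin (t / 2) ^+ 2.
  have {1}-> : t = (t / 2) *+ 2 by rewrite -mulr_natr; field.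
  rewrite cos_mulr2n cos2sin2; ring.
rewrite addrAC subrr add0r normrN ger0_norm; last by rewrite mulr_ge0 ?sqr_ge0.
have := ler_norm_sin (t / 2) => /(lerXn2r 2).
rewrite !nnegrE !normr_ge0 => /(_ isT isT).
rewrite !real_normK ?num_real // => H; lra.
Qed.

(** The mean value theorem gives $\sin t-t=(\cos c-1)t$ with $0\le c\le t$, and $1-\cos c\le c$: the
    quadratic bound shows this for $c\le1$, a second mean value argument for larger $c$. *)
Lemma sin_sub_le t : `|sin t - t| <= t ^+ 2.
Proof.
wlog t0 : t / 0 <= t => [H|].
  case: (leP 0 t) => [/H //|/ltW t0].
  have -> : sin t - t = - (sin (- t) - (- t)) by rewrite sinN; ring.
  rewrite normrN -sqrrN; apply: H; lra.
have [c] : exists2 c, c \in `[0, t]%R & sin t - sin 0 = cos c * (t - 0).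
  apply: MVT_segment => //; apply: continuous_subspaceT.
  by move=> x; exact: continuous_sin.
rewrite sin0 !subr0 in_itv /= => /andP[c0 ct] ->.
have -> : cos c * t - t = (cos c - 1) * t by ring.
rewrite normrM (ger0_norm t0) expr2 ler_wpM2r //.
have := cos_le1 c; have := cos_geN1 c => c1 c2.
have := cos_sub1_le c => H; have [c3|c3] := lerP c 1; first by nra.
have [d] : exists2 d, d \in `[0, c]%R & cos c - cos 0 = - sin d * (c - 0).
  apply: MVT_segment => //; apply: continuous_subspaceT.
  by move=> x; exact: continuous_cos.
rewrite cos0 subr0 => _ ->; rewrite normrM normrN (ger0_norm c0).
by have := sin_max d; nra.
Qed.

Lemma sin_lipschitz x y : `|sin x - sin y| <= `|x - y|.
Proof.
wlog t0 : x y / y <= x => [H|].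
  case: (leP y x) => [/H //|/ltW t0]; rewrite (distrC x) (distrC (sin x)); exact: H.
have [c _ ->] : exists2 c, c \in `[y, x]%R & sin x - sin y = cos c * (x - y).
  apply: MVT_segment => //; apply: continuous_subspaceT.
  by move=> z; exact: continuous_sin.
rewrite normrM ler_piMl //; exact: cos_max.
Qed.

Lemma cos_lipschitz x y : `|cos x - cos y| <= `|x - y|.
Proof.
have E (z : R) : cos z = sin (z + pi / 2) by rewrite sinDpihalf.
rewrite !E; apply: le_trans (sin_lipschitz _ _) _.
by rewrite le_eqVlt; apply/orP; left; apply/eqP; congr (`|_|); ring.
Qed.

Lemma expR_lipschitz (M : R) x y : x <= M -> y <= M ->
  `|expR x - expR y| <= expR M * `|x - y|.
Proof.
wlog t0 : x y / y <= x => [H|].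
  case: (leP y x) => [/H //|/ltW t0]; rewrite (distrC x) (distrC (expR x)) => *.
  exact: H.
move=> xM yM; rewrite !ger0_norm ?subr_ge0 ?ler_expR //.
have H := expR_ge1Dx (y - x); have E : expR y = expR x * expR (y - x).
  by rewrite -expRD; congr expR; ring.
have := expR_gt0 x; have : expR x <= expR M by rewrite ler_expR.
by rewrite E; nra.
Qed.

Definition cexp z : R[i] :=
  (expR (complex.Re z) * cos (complex.Im z)) +i*
  (expR (complex.Re z) * sin (complex.Im z)).

Lemma cexpD u v : cexp (u + v) = cexp u * cexp v.
Proof.
by apply: eq_ReIm; rewrite /cexp ?ReM ?ImM /= ReD ImD expRD ?cosD ?sinD; ring.
Qed.

Lemma cexp0 : cexp 0 = 1.
Proof. by apply: eq_ReIm; rewrite /= expR0 ?cos0 ?sin0 mul1r. Qed.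

Lemma normc_cexp z : normc (cexp z) = expR (complex.Re z).
Proof.
apply/eqP; rewrite -(@eqrXn2 _ 2) ?normc_ge0 ?expR_ge0 //; apply/eqP.
by rewrite sqr_normc /= !exprMn -mulrDr cos2Dsin2 mulr1.
Qed.

Lemma cexp_neq0 z : cexp z != 0.
Proof. by rewrite -normc_gt0 normc_cexp expR_gt0. Qed.

Lemma cexp_sub1_le u : normc u <= 2^-1 -> normc (cexp u - 1 - u) <= 3 * normc u ^+ 2.
Proof.
move=> u2; rewrite sqr_normc; apply: le_trans (ler_normc_ReIm _) _.
case: u u2 => x y u2 /=; rewrite oppr0 addr0.
have x2 : `|x| <= 2^-1 by apply: le_trans (ler_Re_normc (x +i* y)) u2.
have [x3 x4] : - 2^-1 <= x /\ x <= 2^-1 by move: x2; rewrite ler_norml => /andP[].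
have e1 := expR_sub1_le x4; have e2 := expR_ge1Dx x.
have c1 := cos_sub1_le y; have s1 := sin_sub_le y; have s2 := ler_norm_sin y.
have ex : expR x <= 2.
  by have H := expR_ge1Dx (- x); have E := expRxMexpNx_1 x; have := expR_gt0 x; nra.
have -> : expR x * cos y - 1 - x = (expR x - 1 - x) + expR x * (cos y - 1) by ring.
have -> : expR x * sin y - y = (expR x - 1) * sin y + (sin y - y) by ring.
have A1 : `|(expR x - 1 - x) + expR x * (cos y - 1)| <= 2 * x ^+ 2 + y ^+ 2.
  apply: le_trans (ler_normD _ _) _; apply: lerD; first by rewrite ger0_norm //; lra.
  rewrite normrM (ger0_norm (expR_ge0 _)); have := expR_ge0 x.
  by have := normr_ge0 (cos y - 1); nra.
have x1 : `|expR x - 1| <= 2 * `|x|.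
  rewrite -[X in _ - X]expR0; apply: le_trans (@expR_lipschitz (`|x|) _ _ _ _) _.
  - exact: ler_norm.
  - by [].
  rewrite subr0 ler_wpM2r //=.
  have H := expR_ge1Dx (- `|x|); have E := expRxMexpNx_1 `|x|.
  by have := expR_gt0 `|x|; nra.
have A2 : `|(expR x - 1) * sin y + (sin y - y)| <= x ^+ 2 + 2 * y ^+ 2.
  apply: le_trans (ler_normD _ _) _.
  have -> : x ^+ 2 + 2 * y ^+ 2 = x ^+ 2 + y ^+ 2 + y ^+ 2 by ring.
  apply: lerD => //; rewrite normrM -(real_normK (num_real x)) -(real_normK (num_real y)).
  have := normr_ge0 (expR x - 1); have := normr_ge0 (sin y).
  have := sqr_ge0 (`|x| - `|y|); have := normr_ge0 x; have := normr_ge0 y.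
  move=> *; apply: (@le_trans _ _ ((2 * `|x|) * `|y|)); first by rewrite ler_pM.
  nra.
lra.
Qed.

Lemma cderiv_cexp z : cderiv cexp z (cexp z).
Proof.
move=> e e0; pose K := 3 * normc (cexp z).
have K0 : 0 < K by rewrite mulr_gt0 // normc_gt0 cexp_neq0.
exists (Num.min (2^-1) (e / K)); first by rewrite lt_min invr_gt0 divr_gt0 ?ltr0n.
move=> u; rewrite lt_min => /andP[/ltW /cexp_sub1_le H1 H2].
rewrite cexpD.
have -> : cexp z * cexp u - cexp z - cexp z * u = cexp z * (cexp u - 1 - u) by ring.
rewrite normcM; move: H2; rewrite ltr_pdivlMr // => H2.
apply: (@le_trans _ _ (normc (cexp z) * (3 * normc u ^+ 2))).
  by rewrite ler_wpM2l ?normc_ge0.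
have -> : normc (cexp z) * (3 * normc u ^+ 2) = (normc u * K) * normc u.
  by rewrite /K; ring.
by rewrite ler_wpM2r ?normc_ge0 // ltW.
Qed.

Lemma cdiff_cexp z : cdiff cexp z.
Proof. by exists (cexp z); exact: cderiv_cexp. Qed.

Lemma cexp_lipschitz (M : R) u v : complex.Re u <= M -> complex.Re v <= M ->
  normc (cexp u - cexp v) <= 4 * expR M * normc (u - v).
Proof.
case: u => x y; case: v => a b xM aM.
have Hx := ler_Re_normc (x +i* y - a +i* b).
have Hy := ler_Im_normc (x +i* y - a +i* b).
have HE := expR_lipschitz xM aM; have HC := cos_lipschitz y b.
have HS := sin_lipschitz y b.
move: (normc (x +i* y - a +i* b)) Hx Hy => N Hx Hy.
rewrite /= in Hx Hy xM aM.
have eM : expR a <= expR M by rewrite ler_expR.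
have e0 := expR_gt0 a; have M0 := expR_gt0 M.
have key (f g : R) : `|f| <= 1 -> `|f - g| <= `|y - b| ->
    `|expR x * f - expR a * g| <= 2 * expR M * N.
  move=> f1 fg.
  have -> : expR x * f - expR a * g = (expR x - expR a) * f + expR a * (f - g) by ring.
  apply: le_trans (ler_normD _ _) _; rewrite !normrM (ger0_norm (expR_ge0 a)).
  have -> : 2 * expR M * N = expR M * N * 1 + expR M * N by ring.
  apply: lerD; first by rewrite ler_pM //; apply: le_trans HE _; rewrite ler_wpM2l // ltW.
  by rewrite ler_pM // ?expR_ge0 //; apply: le_trans fg Hy.
apply: le_trans (ler_normc_ReIm _) _; rewrite /=.
have := key _ _ (cos_max y) HC; have := key _ _ (sin_max y) HS; lra.
Qed.

Lemma horner_bounded (p : {poly R[i]}) : exists2 K : R, 0 <= K &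
  forall z, normc z <= 1 -> normc p.[z] <= K.
Proof.
elim/poly_ind : p => [|p c [K K0 HK]].
  by exists 0 => // z _; rewrite horner0 normc0.
exists (K + normc c); first by rewrite addr_ge0 ?normc_ge0.
move=> z z1; rewrite hornerMXaddC; apply: le_trans (ler_normcD _ _) _.
rewrite lerD2r normcM; have := HK z z1; have := normc_ge0 p.[z].
by have := normc_ge0 z; nra.
Qed.

Lemma horner_lipschitz (p : {poly R[i]}) : exists2 L : R, 0 <= L &
  forall z u, normc z <= 1 -> normc u <= 1 ->
    normc (p.[z] - p.[u]) <= L * normc (z - u).
Proof.
elim/poly_ind : p => [|p c [L L0 HL]].
  by exists 0 => // z u _ _; rewrite !horner0 subr0 normc0 mul0r.
have [K K0 HK] := horner_bounded p.
exists (L + K); first by rewrite addr_ge0.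
move=> z u z1 u1; rewrite !hornerMXaddC.
have -> : p.[z] * z + c - (p.[u] * u + c) =
  (p.[z] - p.[u]) * z + p.[u] * (z - u) by ring.
apply: le_trans (ler_normcD _ _) _; rewrite !normcM mulrDl.
apply: lerD; last by rewrite ler_wpM2r ?normc_ge0 ?HK.
have := HL z u z1 u1; have := normc_ge0 (p.[z] - p.[u]).
by have := normc_ge0 z; nra.
Qed.

End ComplexExponential.

(** * Integrals of complex-valued functions of a real variable *)

Section ComplexIntegral.
Context {R : realType}.
Local Notation mu := (@lebesgue_measure R).
Local Notation RT := (measurableTypeR R).
Implicit Types (D : set RT) (f g : R -> R[i]) (u v : R -> R).

Definition rint D u : Prop := mu.-integrable D (EFin \o u).

Lemma rint_measurable D u : rint D u -> measurable_fun D u.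
Proof. by move=> /integrableP[/measurable_EFinP]. Qed.

Lemma rint_le D u v : measurable D -> measurable_fun D u ->
  (forall x, D x -> `|u x| <= v x) -> rint D v -> rint D u.
Proof.
move=> mD mu_ uv iv; apply: (le_integrable mD _ _ iv).
  exact/measurable_EFinP.
by move=> x Dx /=; rewrite lee_fin; apply: le_trans (uv x Dx) (ler_norm _).
Qed.

Lemma rint_eq D u v : (forall x, D x -> u x = v x) -> measurable D ->
  rint D u -> rint D v.
Proof.
move=> uv mD; apply: eq_integrable => // x; rewrite inE => Dx.
by rewrite /= uv.
Qed.

Lemma rintD D u v : measurable D -> rint D u -> rint D v ->
  rint D (fun x => u x + v x).
Proof. by move=> mD iu iv; exact: (integrableD mD iu iv). Qed.

Lemma rintB D u v : measurable D -> rint D u -> rint D v ->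
  rint D (fun x => u x - v x).
Proof. by move=> mD iu iv; exact: (integrableB mD iu iv). Qed.

Lemma rintZ D c u : measurable D -> rint D u -> rint D (fun x => c * u x).
Proof. by move=> mD iu; exact: (integrableZl mD c iu). Qed.

Lemma rint_norm D u : rint D u -> rint D (fun x => `|u x|).
Proof. by move=> iu; exact: (integrable_norm iu). Qed.

Lemma rint_sub D D' u : measurable D -> measurable D' -> D' `<=` D ->
  rint D u -> rint D' u.
Proof. by move=> mD mD' DD'; exact: (integrableS mD mD' DD'). Qed.

Lemma ler_Rint D u v : measurable D -> rint D u -> rint D v ->
  (forall x, D x -> u x <= v x) ->
  \int[mu]_(x in D) u x <= \int[mu]_(x in D) v x.
Proof. by move=> mD iu iv uv; exact: le_Rintegral. Qed.

Lemma eq_Rint D u v : (forall x, D x -> u x = v x) ->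
  \int[mu]_(x in D) u x = \int[mu]_(x in D) v x.
Proof. by move=> uv; apply: eq_Rintegral => x; rewrite inE; exact: uv. Qed.

Definition cintegrable D f : Prop :=
  rint D (fun x => complex.Re (f x)) /\ rint D (fun x => complex.Im (f x)).

Definition cmeas D f : Prop :=
  measurable_fun D (fun x => complex.Re (f x)) /\
  measurable_fun D (fun x => complex.Im (f x)).

Lemma cintegrable_meas D f : cintegrable D f -> cmeas D f.
Proof. by move=> [/rint_measurable ? /rint_measurable ?]. Qed.

Lemma eq_cintegral D f g : (forall x, D x -> f x = g x) ->
  cintegral D f = cintegral D g.
Proof.
by move=> fg; apply: eq_ReIm => /=; apply: eq_Rint => x Dx; rewrite fg.
Qed.

Lemma eq_cintegrable D f g : measurable D -> (forall x, D x -> f x = g x) ->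
  cintegrable D f -> cintegrable D g.
Proof.
by move=> mD fg [f1 f2]; split; [apply: rint_eq f1|apply: rint_eq f2] => // x Dx;
  rewrite fg.
Qed.

Lemma cintegrableD D f g : measurable D -> cintegrable D f -> cintegrable D g ->
  cintegrable D (fun x => f x + g x).
Proof.
move=> mD [f1 f2] [g1 g2]; split.
  by apply: rint_eq (rintD mD f1 g1) => // x _; rewrite ReD.
by apply: rint_eq (rintD mD f2 g2) => // x _; rewrite ImD.
Qed.

Lemma cintegrableZ D c f : measurable D -> cintegrable D f ->
  cintegrable D (fun x => c * f x).
Proof.
move=> mD [f1 f2]; split.
  apply: rint_eq (rintB mD (rintZ (complex.Re c) mD f1)
    (rintZ (complex.Im c) mD f2)) => // x _; rewrite ReM //.
apply: rint_eq (rintD mD (rintZ (complex.Re c) mD f2)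
  (rintZ (complex.Im c) mD f1)) => // x _; rewrite ImM //.
Qed.

Lemma cintegrableB D f g : measurable D -> cintegrable D f -> cintegrable D g ->
  cintegrable D (fun x => f x - g x).
Proof.
move=> mD hf /(cintegrableZ (-1) mD) hg.
by apply: eq_cintegrable (cintegrableD mD hf hg) => // x _; rewrite mulN1r.
Qed.

Lemma cintegralD D f g : measurable D -> cintegrable D f -> cintegrable D g ->
  cintegral D (fun x => f x + g x) = cintegral D f + cintegral D g.
Proof.
move=> mD [f1 f2] [g1 g2]; apply: eq_ReIm; rewrite /= -RintegralD //;
  by apply: eq_Rint => x _; rewrite ?ReD ?ImD.
Qed.

Lemma cintegralZ D c f : measurable D -> cintegrable D f ->
  cintegral D (fun x => c * f x) = c * cintegral D f.
Proof.
move=> mD [f1 f2]; apply: eq_ReIm; rewrite ?ReM ?ImM /=.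
  rewrite -!RintegralZl // -RintegralB //; first by apply: eq_Rint => x _; rewrite ReM.
    exact: rintZ.
  exact: rintZ.
rewrite -!RintegralZl // -RintegralD //; first by apply: eq_Rint => x _; rewrite ImM.
  exact: rintZ.
exact: rintZ.
Qed.

Lemma cintegralB D f g : measurable D -> cintegrable D f -> cintegrable D g ->
  cintegral D (fun x => f x - g x) = cintegral D f - cintegral D g.
Proof.
move=> mD hf hg; rewrite -[- cintegral D g]mulN1r -cintegralZ // -cintegralD //.
  by apply: eq_cintegral => x _; rewrite mulN1r.
exact: cintegrableZ.
Qed.

Lemma cmeas_normc D f : cmeas D f -> measurable_fun D (fun x => normc (f x)).
Proof.
move=> [f1 f2]; rewrite (_ : (fun x => _) = fun x =>
  Num.sqrt (complex.Re (f x) ^+ 2 + complex.Im (f x) ^+ 2)); last first.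
  by apply/funext => x; rewrite normcE2.
apply: (@measurableT_comp _ _ _ _ _ _ (@Num.sqrt R)).
  by apply: continuous_measurable_fun; exact: sqrt_continuous.
by apply: measurable_funD; exact: measurable_funX.
Qed.

Lemma cintegrable_normc D f : measurable D -> cintegrable D f ->
  rint D (fun x => normc (f x)).
Proof.
move=> mD hf; have [f1 f2] := hf.
apply: rint_le (rintD mD (rint_norm f1) (rint_norm f2)) => //.
  by apply: cmeas_normc; exact: cintegrable_meas.
by move=> x _; rewrite ger0_norm ?normc_ge0 // ler_normc_ReIm.
Qed.

Lemma cintegrable_le D f u : measurable D -> cmeas D f ->
  (forall x, D x -> normc (f x) <= u x) -> rint D u -> cintegrable D f.
Proof.
move=> mD [m1 m2] fu iu; split; apply: rint_le iu => // x Dx.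
  exact: le_trans (ler_Re_normc _) (fu x Dx).
exact: le_trans (ler_Im_normc _) (fu x Dx).
Qed.

(* Multiplying by a unit constant makes the integral a nonnegative real. *)
Lemma normc_cintegral D f : measurable D -> cintegrable D f ->
  normc (cintegral D f) <= \int[mu]_(x in D) normc (f x).
Proof.
move=> mD hf; set I := cintegral D f.
have [I0|I0] := eqVneq I 0.
  by rewrite I0 normc0; apply: Rintegral_ge0 => x _; exact: normc_ge0.
pose c := (I^* / (normc I)%:C)%C.
have nI : normc I != 0 by rewrite normc_eq0.
have cI : c * I = (normc I)%:C.
  rewrite /c mulrAC [I^*%C * I]mulrC.
  have -> : (I * I^*%C)%C = (normc I ^+ 2)%:C.
    rewrite sqr_normc; case: (I) => a b; apply: eq_ReIm => /=; ring.
  by rewrite expr2 rmorphM mulfK // fmorph_eq0.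
have nc : normc c = 1.
  by rewrite /c normcM normcV normc_conj normc_real ger0_norm ?normc_ge0 // divff.
have -> : normc I = complex.Re (cintegral D (fun x => c * f x)).
  by rewrite cintegralZ // cI.
have [h1 h2] := cintegrableZ c mD hf.
rewrite /cintegral /=; apply: ler_Rint => //; first exact: cintegrable_normc.
move=> x _; apply: le_trans (ler_norm _) _.
by apply: le_trans (ler_Re_normc _) _; rewrite normcM nc mul1r.
Qed.

Lemma normc_cintegral_le D f u : measurable D -> cmeas D f ->
  (forall x, D x -> normc (f x) <= u x) -> rint D u ->
  normc (cintegral D f) <= \int[mu]_(x in D) u x.
Proof.
move=> mD mf fu iu; have hf := cintegrable_le mD mf fu iu.
apply: le_trans (normc_cintegral mD hf) _; apply: ler_Rint => //.
exact: cintegrable_normc.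
Qed.

Definition ccont f x : Prop := forall e : R, 0 < e -> exists2 d : R, 0 < d &
  forall t, `|t - x| < d -> normc (f t - f x) < e.

Lemma ccont_Re f x : ccont f x -> {for x, continuous (fun t => complex.Re (f t))}.
Proof.
move=> H; apply/cvgrPdist_lt => e e0; have [d d0 Hd] := H e e0.
apply/nbhs_ballP; exists d => //= t; rewrite /ball /= => xt.
rewrite -ReB; apply: le_lt_trans (ler_Re_normc _) _.
by rewrite normcBC; apply: Hd; rewrite distrC.
Qed.

Lemma ccont_Im f x : ccont f x -> {for x, continuous (fun t => complex.Im (f t))}.
Proof.
move=> H; apply/cvgrPdist_lt => e e0; have [d d0 Hd] := H e e0.
apply/nbhs_ballP; exists d => //= t; rewrite /ball /= => xt.
rewrite -ImB; apply: le_lt_trans (ler_Im_normc _) _.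
by rewrite normcBC; apply: Hd; rewrite distrC.
Qed.

Lemma ccont_cmeas f : (forall x, ccont f x) -> cmeas (setT : set RT) f.
Proof.
move=> H; split; apply: continuous_measurable_fun => x.
  exact: ccont_Re.
exact: ccont_Im.
Qed.

Lemma continuous_rint a b u : (forall x, a <= x <= b -> {for x, continuous u}) ->
  rint `[a, b] u.
Proof.
move=> H; apply: continuous_compact_integrable; first exact: segment_compact.
apply: continuous_in_subspaceT => x; rewrite inE /= in_itv /=; exact: H.
Qed.

Lemma ccont_cintegrable a b f : (forall x, a <= x <= b -> ccont f x) ->
  cintegrable `[a, b] f.
Proof.
move=> H; split; apply: continuous_rint => x /H; first exact: ccont_Re.
exact: ccont_Im.
Qed.

Lemma Rintegral_itv_split a b c u : a <= b -> b <= c -> rint `[a, c] u ->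
  \int[mu]_(x in `[a, c]) u x =
  \int[mu]_(x in `[a, b]) u x + \int[mu]_(x in `[b, c]) u x.
Proof.
move=> ab bc iu.
have H := @Rintegral_itvB R u (BLeft a) (BRight c) b iu.
have := H _ _; rewrite !bnd_simp => /(_ ab bc).
rewrite Rintegral_itv_obnd_cbnd; last first.
  apply: (rint_sub _ _ _ iu) => //.
  by apply: subset_itv; rewrite bnd_simp.
by move=> /eqP; rewrite subr_eq addrC => /eqP.
Qed.

Lemma cintegral_split a b c f : a <= b -> b <= c -> cintegrable `[a, c] f ->
  cintegral `[a, c] f = cintegral `[a, b] f + cintegral `[b, c] f.
Proof.
move=> ab bc [h1 h2]; apply: eq_ReIm => /=; exact: Rintegral_itv_split.
Qed.

Lemma cintegral_cst (a b : R) (c : R[i]) : a <= b -> cintegral `[a, b] (fun=> c) = (b - a)%:C * c :> R[i].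
Proof.
move=> ab; have mab : fine (mu `[a, b]) = b - a.
  rewrite lebesgue_measure_itv /= lte_fin; case: ltP => // ba.
  by rewrite /=; lra.
by apply: eq_ReIm; rewrite ?ReM ?ImM /= Rintegral_cst // mab ?mul0r ?subr0 ?addr0 mulrC.
Qed.

Lemma rint_cst (a b c : R) : rint `[a, b] (fun=> c).
Proof. by apply: continuous_rint => x _; exact: cst_continuous. Qed.

Lemma normc_cintegral_cst a b f (K : R) : a <= b -> cmeas `[a, b] f ->
  (forall x, a <= x <= b -> normc (f x) <= K) ->
  normc (cintegral `[a, b] f) <= (b - a) * K.
Proof.
move=> ab mf fK.
apply: (@le_trans _ _ (\int[mu]_(x in `[a, b]) K)).
  apply: (@normc_cintegral_le _ _ (fun=> K)) => //.
  exact: rint_cst.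
have := cintegral_cst K%:C ab => /(congr1 (@complex.Re R)) /=.
by rewrite mul0r subr0 => ->.
Qed.

End ComplexIntegral.

(** * Cauchy's theorem on rectangles *)

Section Goursat.
Context {R : realType}.
Local Notation RT := (measurableTypeR R).
Implicit Types (F : R[i] -> R[i]) (a b c d x y m : R).

Lemma cdiff_ccont_h F x y : cdiff F (x +i* y) -> ccont (fun t => F (t +i* y)) x.
Proof.
move=> /cdiff_continuous H e /H[d d0 Hd]; exists d => // t tx.
have -> : t +i* y = x +i* y + (t - x)%:C by apply: eq_ReIm => /=; ring.
by apply: Hd; rewrite normc_real.
Qed.

Lemma cdiff_ccont_v F x y : cdiff F (x +i* y) -> ccont (fun t => F (x +i* t)) y.
Proof.
move=> /cdiff_continuous H e /H[d d0 Hd]; exists d => // t ty.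
have -> : x +i* t = x +i* y + 0 +i* (t - y) by apply: eq_ReIm => /=; ring.
by apply: Hd; rewrite normcE2 /= expr0n add0r sqrtr_sqr.
Qed.

Lemma cint_h F a b y : (forall x, a <= x <= b -> cdiff F (x +i* y)) ->
  cintegrable (`[a, b] : set RT) (fun x => F (x +i* y)).
Proof.
by move=> H; apply: ccont_cintegrable => x /H; exact: cdiff_ccont_h.
Qed.

Lemma cint_v F c d x : (forall y, c <= y <= d -> cdiff F (x +i* y)) ->
  cintegrable (`[c, d] : set RT) (fun y => F (x +i* y)).
Proof.
by move=> H; apply: ccont_cintegrable => y /H; exact: cdiff_ccont_v.
Qed.

(* The boundary is traversed counterclockwise. *)
Definition rectint F a b c d : R[i] :=
  cintegral `[a, b] (fun x => F (x +i* c) - F (x +i* d)) +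
  'i%C * cintegral `[c, d] (fun y => F (b +i* y) - F (a +i* y)).

Lemma rectint_splitx F a m b c d : a <= m -> m <= b ->
  (forall x, a <= x <= b -> cdiff F (x +i* c) /\ cdiff F (x +i* d)) ->
  (forall y, c <= y <= d -> [/\ cdiff F (a +i* y), cdiff F (m +i* y) &
    cdiff F (b +i* y)]) ->
  rectint F a b c d = rectint F a m c d + rectint F m b c d.
Proof.
move=> am mb H1 H2; rewrite /rectint (@cintegral_split _ a m b) //; last first.
  by apply: cintegrableB => //; apply: cint_h => x /H1[].
have -> : cintegral `[c, d] (fun y => F (b +i* y) - F (a +i* y)) =
   cintegral `[c, d] (fun y => F (m +i* y) - F (a +i* y)) +
   cintegral `[c, d] (fun y => F (b +i* y) - F (m +i* y)).
  rewrite -cintegralD //; first by apply: eq_cintegral => y _; ring.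
    by apply: cintegrableB => //; apply: cint_v => y /H2[].
  by apply: cintegrableB => //; apply: cint_v => y /H2[].
ring.
Qed.

Lemma rectint_splity F a b c m d : c <= m -> m <= d ->
  (forall x, a <= x <= b -> [/\ cdiff F (x +i* c), cdiff F (x +i* m) &
    cdiff F (x +i* d)]) ->
  (forall y, c <= y <= d -> cdiff F (a +i* y) /\ cdiff F (b +i* y)) ->
  rectint F a b c d = rectint F a b c m + rectint F a b m d.
Proof.
move=> cm md H1 H2; rewrite /rectint (@cintegral_split _ c m d) //; last first.
  by apply: cintegrableB => //; apply: cint_v => y /H2[].
have -> : cintegral `[a, b] (fun x => F (x +i* c) - F (x +i* d)) =
   cintegral `[a, b] (fun x => F (x +i* c) - F (x +i* m)) +
   cintegral `[a, b] (fun x => F (x +i* m) - F (x +i* d)).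
  rewrite -cintegralD //; first by apply: eq_cintegral => x _; ring.
    by apply: cintegrableB => //; apply: cint_h => x /H1[].
  by apply: cintegrableB => //; apply: cint_h => x /H1[].
ring.
Qed.

Lemma normc_i : normc ('i%C : R[i]) = 1.
Proof. by rewrite normcE2 /= expr0n expr1n add0r sqrtr1. Qed.

Lemma rectint_bound F a b c d (K : R) : a <= b -> c <= d ->
  (forall x, a <= x <= b -> cdiff F (x +i* c) /\ cdiff F (x +i* d)) ->
  (forall y, c <= y <= d -> cdiff F (a +i* y) /\ cdiff F (b +i* y)) ->
  (forall x, a <= x <= b -> normc (F (x +i* c)) <= K /\ normc (F (x +i* d)) <= K) ->
  (forall y, c <= y <= d -> normc (F (a +i* y)) <= K /\ normc (F (b +i* y)) <= K) ->
  normc (rectint F a b c d) <= 2 * K * ((b - a) + (d - c)).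
Proof.
move=> ab cd D1 D2 H1 H2; apply: le_trans (ler_normcD _ _) _.
rewrite normcM normc_i mul1r mulrDr; apply: lerD.
  rewrite mulrC; apply: normc_cintegral_cst => //.
    apply: cintegrable_meas; apply: cintegrableB => //; apply: cint_h => x /D1[] //.
  move=> x /H1[h1 h2]; apply: le_trans (ler_normcB _ _) _; lra.
rewrite mulrC; apply: normc_cintegral_cst => //.
  apply: cintegrable_meas; apply: cintegrableB => //; apply: cint_v => x /D2[] //.
move=> x /H2[h1 h2]; apply: le_trans (ler_normcB _ _) _; lra.
Qed.

(** On opposite sides the affine part differs by a constant, so only integrals of constants occur.
    The horizontal sides contribute $(b-a)\,l\,i(c-d)$, the vertical ones $i(d-c)\,l\,(b-a)$, and
    these cancel. *)
Lemma rectint_affine F a b c d (z0 v l : R[i]) : a <= b -> c <= d ->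
  (forall x, a <= x <= b -> cdiff F (x +i* c) /\ cdiff F (x +i* d)) ->
  (forall y, c <= y <= d -> cdiff F (a +i* y) /\ cdiff F (b +i* y)) ->
  rectint (fun z => F z - v - l * (z - z0)) a b c d = rectint F a b c d.
Proof.
move=> ab cd D1 D2; rewrite /rectint.
have i1 : cintegrable (`[a, b] : set RT) (fun x => F (x +i* c) - F (x +i* d)).
  by apply: cintegrableB => //; apply: cint_h => x /D1[].
have i2 : cintegrable (`[c, d] : set RT) (fun y => F (b +i* y) - F (a +i* y)).
  by apply: cintegrableB => //; apply: cint_v => x /D2[].
have icst (p q : R) (k : R[i]) : cintegrable (`[p, q] : set RT) (fun=> k).
  by split; exact: rint_cst.
have -> : cintegral `[a, b] (fun x => F (x +i* c) - v - l * (x +i* c - z0) -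
    (F (x +i* d) - v - l * (x +i* d - z0))) =
    cintegral `[a, b] (fun x => F (x +i* c) - F (x +i* d)) -
      (b - a)%:C * (l * (0 +i* (c - d))).
  rewrite -cintegral_cst // -cintegralB //.
  apply: eq_cintegral => x _.
  have -> : 0 +i* (c - d) = (x +i* c) - (x +i* d).
    by apply: eq_ReIm => /=; ring.
  ring.
have -> : cintegral `[c, d] (fun y => F (b +i* y) - v - l * (b +i* y - z0) -
    (F (a +i* y) - v - l * (a +i* y - z0))) =
    cintegral `[c, d] (fun y => F (b +i* y) - F (a +i* y)) -
      (d - c)%:C * (l * (b - a)%:C).
  rewrite -cintegral_cst // -cintegralB //.
  apply: eq_cintegral => y _.
  have -> : (b - a)%:C = (b +i* y) - (a +i* y).
    by apply: eq_ReIm => /=; ring.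
  ring.
set I1 := cintegral _ _; set I2 := cintegral _ _.
have E : (b - a)%:C * (l * (0 +i* (c - d))) + 'i%C * ((d - c)%:C * (l * (b - a)%:C)) = 0.
  by case: l {I1 I2} => p q; apply: eq_ReIm => /=; ring.
rewrite -[RHS]subr0 -E; ring.
Qed.

(** After subtraction of the tangent map, the integrand is at most [e] times the size of the
    rectangle. The bound is quadratic in this size, which is exactly what the factor 4 of each
    bisection step consumes. *)
Lemma rectint_near F a b c d (X Y r e : R) (l : R[i]) :
  a <= X <= b -> c <= Y <= d ->
  (forall x y, a <= x <= b -> c <= y <= d -> cdiff F (x +i* y)) ->
  (forall k, normc k < r ->
    normc (F (X +i* Y + k) - F (X +i* Y) - l * k) <= e * normc k) ->
  0 <= e -> (b - a) + (d - c) < r ->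
  normc (rectint F a b c d) <= 2 * (e * ((b - a) + (d - c))) * ((b - a) + (d - c)).
Proof.
move=> /andP[x1 x2] /andP[y1 y2] DF Hr e0 small.
have ab := le_trans x1 x2; have cd := le_trans y1 y2.
rewrite -(@rectint_affine F _ _ _ _ (X +i* Y) (F (X +i* Y)) l) //; first last.
- by move=> y hy; split; apply: DF; rewrite ?lexx ?ab ?cd.
- by move=> x hx; split; apply: DF; rewrite ?lexx ?ab ?cd.
have DR (x y : R) : a <= x <= b -> c <= y <= d ->
    cdiff (fun z => F z - F (X +i* Y) - l * (z - X +i* Y)) (x +i* y).
  move=> hx hy; apply: cdiffB; first by apply: cdiffB; [exact: DF|exact: cdiff_cst].
  apply: cdiffM; first exact: cdiff_cst.
  by apply: cdiffB; [exact: cdiff_id|exact: cdiff_cst].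
have BR (x y : R) : a <= x <= b -> c <= y <= d ->
    normc (F (x +i* y) - F (X +i* Y) - l * (x +i* y - X +i* Y)) <=
    e * ((b - a) + (d - c)).
  move=> /andP[hx1 hx2] /andP[hy1 hy2].
  have E : x +i* y = X +i* Y + (x +i* y - X +i* Y) by ring.
  have B : normc (x +i* y - X +i* Y) <= (b - a) + (d - c).
    apply: le_trans (ler_normc_ReIm _) _; rewrite /=; apply: lerD.
      by rewrite ler_norml opprB !lerB.
    by rewrite ler_norml opprB !lerB.
  by rewrite {1}E (le_trans (Hr _ (le_lt_trans B small))) // ler_wpM2l.
apply: rectint_bound => // [x hx|y hy|x hx|y hy].
- by split; apply: DR; rewrite ?lexx ?ab ?cd.
- by split; apply: DR; rewrite ?lexx ?ab ?cd.
- by split; apply: BR; rewrite ?lexx ?ab ?cd.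
- by split; apply: BR; rewrite ?lexx ?ab ?cd.
Qed.

Lemma ler_sum4_max (u u1 u2 u3 u4 : R) : u <= u1 + u2 + (u3 + u4) ->
  (u <= 4 * u1) \/ (u <= 4 * u2) \/ (u <= 4 * u3) \/ (u <= 4 * u4).
Proof.
move=> T.
have [t1|t1] := leP u (4 * u1); first by left.
have [t2|t2] := leP u (4 * u2); first by right; left.
have [t3|t3] := leP u (4 * u3); first by right; right; left.
by right; right; right; lra.
Qed.

Definition halving (t : R) (n : nat) : R := t * 2^-1 ^+ n.

Lemma halvingS t n : halving t n = halving t n.+1 + halving t n.+1.
Proof. by rewrite /halving exprS; field. Qed.

Lemma halving_ge0 t n : 0 <= t -> 0 <= halving t n.
Proof. by move=> t0; rewrite mulr_ge0 // exprn_ge0. Qed.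

(** At stage [n] the side lengths are determined, so a rectangle is recorded by its lower left
    corner [p] alone. *)
Definition subrect (w h : R) (n : nat) F (p : R * R) : R[i] :=
  rectint F p.1 (p.1 + halving w n) p.2 (p.2 + halving h n).

Section Bisection.
Variables (F : R[i] -> R[i]) (a b c d : R).
Hypotheses (ab : a <= b) (cd : c <= d).
Hypothesis DF : forall x y, a <= x <= b -> c <= y <= d -> cdiff F (x +i* y).

Local Notation s n := (2^-1 ^+ n : R).
Local Notation w := (halving (b - a)).
Local Notation h := (halving (d - c)).
Local Notation I n p := (subrect (b - a) (d - c) n F p).

Definition in_rect n (p : R * R) : Prop :=
  [/\ a <= p.1, p.1 + w n <= b, c <= p.2 & p.2 + h n <= d].
Local Notation inside := in_rect.

Let w_ge0 n : 0 <= w n. Proof. by rewrite halving_ge0 ?subr_ge0. Qed.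
Let h_ge0 n : 0 <= h n. Proof. by rewrite halving_ge0 ?subr_ge0. Qed.
Let wS n : w n = w n.+1 + w n.+1. Proof. exact: halvingS. Qed.
Let hS n : h n = h n.+1 + h n.+1. Proof. exact: halvingS. Qed.

(** The integrals over the four quarters add up to the whole, so one quarter carries at least a
    quarter of the modulus ([ler_sum4_max]). *)
Lemma subrect_step n p : inside n p -> exists q, [/\ inside n.+1 q,
  p.1 <= q.1 <= p.1 + w n.+1, p.2 <= q.2 <= p.2 + h n.+1 &
  normc (I n p) <= 4 * normc (I n.+1 q)].
Proof.
case: p => x y [ax xb cy yd]; rewrite /= in ax xb cy yd; have w0 := w_ge0 n.+1; have h0 := h_ge0 n.+1.
rewrite wS in xb; rewrite hS in yd.
have E : I n (x, y) = I n.+1 (x, y) + I n.+1 (x, y + h n.+1) +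
    (I n.+1 (x + w n.+1, y) + I n.+1 (x + w n.+1, y + h n.+1)).
  rewrite /subrect /= wS hS !addrA; clear wS hS w_ge0 h_ge0.
  move: w0 h0 xb yd; set W := w n.+1; set H := h n.+1 => w0 h0 xb yd.
  clearbody W H.
  rewrite (@rectint_splitx _ x (x + W) (x + W + W)); last 4 first.
  - lra.
  - lra.
  - by move=> t /andP[? ?]; split; apply: DF; lra.
  - by move=> t /andP[? ?]; split; apply: DF; lra.
  have sy (x1 x2 : R) : a <= x1 -> x1 <= x2 -> x2 <= b ->
    rectint F x1 x2 y (y + H + H) = rectint F x1 x2 y (y + H) +
      rectint F x1 x2 (y + H) (y + H + H).
    move=> ? ? ?; apply: rectint_splity; try lra.
    - by move=> t /andP[? ?]; split; apply: DF; lra.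
    - by move=> t /andP[? ?]; split; apply: DF; lra.
  by rewrite !sy ?addrA //; lra.
have T : normc (I n (x, y)) <= normc (I n.+1 (x, y)) + normc (I n.+1 (x, y + h n.+1)) +
    (normc (I n.+1 (x + w n.+1, y)) + normc (I n.+1 (x + w n.+1, y + h n.+1))).
  rewrite E; apply: le_trans (ler_normcD _ _) _; apply: lerD; exact: ler_normcD.
clear E DF; have {T} /ler_sum4_max := T; rewrite /in_rect.
move: (w n.+1) (h n.+1) w0 h0 xb yd => W H w0 h0 xb yd.
rewrite addrA in xb; rewrite addrA in yd.
have xW : x <= x + W by rewrite lerDl.
have yH : y <= y + H by rewrite lerDl.
have xWW : x + W <= x + W + W by rewrite lerDl.
have yHH : y + H <= y + H + H by rewrite lerDl.
have xWb := le_trans xWW xb; have yHd := le_trans yHH yd.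
case=> [|[|[|]]] T.
- by exists (x, y); split; [split|rewrite /= lexx|rewrite /= lexx|exact: T].
- exists (x, y + H); split; [split=> //|rewrite /= lexx|rewrite /= yH lexx|exact: T] => //.
  exact: le_trans yH.
- exists (x + W, y); split; [split=> //|rewrite /= xW lexx|rewrite /= lexx|exact: T] => //.
  exact: le_trans xW.
- exists (x + W, y + H); split; [split=> //|rewrite /= xW lexx|rewrite /= yH lexx|exact: T] => //.
    exact: le_trans xW.
  exact: le_trans yH.
Qed.

(** Goursat's bisection: the nested rectangles shrink to a point where [F] is differentiable. There
    [rectint_near] bounds the stage [n] integral by $2e(L2^{-n})^2$, and the factor $4^n$ lost on
    the way leaves $2eL^2$ for every [e]. *)
Lemma goursat : rectint F a b c d = 0.
Proof.
(* Dependent choice, obtained by choosing a successor for every pair of a stage and a corner,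
   arbitrary if the corner is not admissible. *)
have /choice[f Hf] : forall np : nat * (R * R), exists q, inside np.1 np.2 ->
    [/\ inside np.1.+1 q, np.2.1 <= q.1 <= np.2.1 + w np.1.+1,
      np.2.2 <= q.2 <= np.2.2 + h np.1.+1 &
      normc (I np.1 np.2) <= 4 * normc (I np.1.+1 q)].
  move=> [n p]; have [/subrect_step[q Hq]|np] := pselect (inside n p); first by exists q.
  by exists p => /np.
pose P := fix P n := if n is m.+1 then f (m, P m) else (a, c).
have Pin n : inside n (P n).
  elim: n => [|n IH] /=; last by have [] := Hf (n, P n) IH.
  by split => //=; rewrite /halving expr0 mulr1; lra.
have Pst n := Hf (n, P n) (Pin n).
have PI n : normc (I 0 (a, c)) <= 4 ^+ n * normc (I n (P n)).
  elim: n => [|n IH]; first by rewrite mul1r.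
  apply: le_trans IH _; rewrite exprSr -mulrA ler_pM2l ?exprn_gt0 //.
  by have [] := Pst n.
have nest1 n k : (P n).1 <= (P (n + k)%N).1 /\
    (P (n + k)%N).1 + w (n + k) <= (P n).1 + w n.
  elim: k => [|k [IH1 IH2]]; first by rewrite addn0.
  rewrite addnS; have [_ /andP[h1 h2] _ _] := Pst (n + k)%N.
  have := wS (n + k); rewrite /= in h1 h2 *; lra.
have nest2 n k : (P n).2 <= (P (n + k)%N).2 /\
    (P (n + k)%N).2 + h (n + k) <= (P n).2 + h n.
  elim: k => [|k [IH1 IH2]]; first by rewrite addn0.
  rewrite addnS; have [_ _ /andP[h1 h2] _] := Pst (n + k)%N.
  have := hS (n + k); rewrite /= in h1 h2 *; lra.
have u1 (m n : nat) : (P m).1 <= (P n).1 + w n.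
  have [mn|nm] := leqP m n.
    have [+ _] := nest1 m (n - m)%N; rewrite subnKC // => h1; have := w_ge0 n; lra.
  have [_] := nest1 n (m - n)%N; rewrite subnKC ?(ltnW nm) // => h1; have := w_ge0 m; lra.
have u2 (m n : nat) : (P m).2 <= (P n).2 + h n.
  have [mn|nm] := leqP m n.
    have [+ _] := nest2 m (n - m)%N; rewrite subnKC // => h1; have := h_ge0 n; lra.
  have [_] := nest2 n (m - n)%N; rewrite subnKC ?(ltnW nm) // => h1; have := h_ge0 m; lra.
(* The corners increase in both coordinates, so their suprema give a point common to all the
   rectangles. *)
pose X := sup (range (fun n => (P n).1)); pose Y := sup (range (fun n => (P n).2)).
have X1 n : (P n).1 <= X.
  apply: sup_upper_bound; last by exists n.
  by split; [exists (P 0%N).1; exists 0%N|exists ((P 0%N).1 + w 0) => _ [m _ <-]].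
have X2 n : X <= (P n).1 + w n.
  by apply: ge_sup => [|_ [m _ <-] //]; exists (P 0%N).1; exists 0%N.
have Y1 n : (P n).2 <= Y.
  apply: sup_upper_bound; last by exists n.
  by split; [exists (P 0%N).2; exists 0%N|exists ((P 0%N).2 + h 0) => _ [m _ <-]].
have Y2 n : Y <= (P n).2 + h n.
  by apply: ge_sup => [|_ [m _ <-] //]; exists (P 0%N).2; exists 0%N.
have [l Hl] : cdiff F (X +i* Y).
  have [a0 b0 c0 d0] := Pin 0%N.
  have := X1 0%N; have := X2 0%N; have := Y1 0%N; have := Y2 0%N.
  by move=> *; apply: DF; lra.
pose L := (b - a) + (d - c).
have L0 : 0 <= L by rewrite addr_ge0 ?subr_ge0.
have main (e : R) : 0 < e -> normc (I 0 (a, c)) <= 2 * e * L ^+ 2.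
  move=> e0; have [r r0 Hr] := Hl e e0.
  have [n Hn] : exists n, L * s n < r.
    have : (fun n => s n) @ \oo --> (0 : R).
      by apply: cvg_expr; rewrite ger0_norm // invf_lt1 // ltr1n.
    move=> /cvgrPdist_lt /(_ (r / (L + 1))).
    have L1 : 0 < L + 1 by lra.
    rewrite divr_gt0 // => /(_ isT)[N _ /(_ N (leqnn N))] /=.
    rewrite sub0r normrN ger0_norm ?ltW // ltr_pdivlMr // => HN.
    by exists N; apply: le_lt_trans HN; rewrite mulrC ler_wpM2l ?exprn_ge0 ?lerDl.
  apply: le_trans (PI n) _.
  have [a0 b0 c0 d0] := Pin n.
  have LE : L * s n = w n + h n by rewrite /L /halving; ring.
  have IR : normc (I n (P n)) <= 2 * (e * (L * s n)) * (L * s n).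
    have := @rectint_near F (P n).1 ((P n).1 + w n) (P n).2 ((P n).2 + h n) X Y r e l.
    rewrite !(addrC (P n).1) !(addrC (P n).2) !addrK -LE.
    rewrite -!(addrC (P n).1) -!(addrC (P n).2); apply => //.
    - by rewrite X1 X2.
    - by rewrite Y1 Y2.
    - move=> x y /andP[hx1 hx2] /andP[hy1 hy2]; apply: DF.
        by rewrite (le_trans a0 hx1) (le_trans hx2 b0).
      by rewrite (le_trans c0 hy1) (le_trans hy2 d0).
    - exact: ltW.
  have -> : 2 * e * L ^+ 2 = 4 ^+ n * (2 * (e * (L * s n)) * (L * s n)).
    have -> : 4 ^+ n = (s n)^-1 ^+ 2.
      by rewrite -exprVn invrK -exprM mulnC exprM; congr (_ ^+ n); ring.
    by field; rewrite gt_eqF.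
  by rewrite ler_pM2l // exprn_gt0.
have -> : rectint F a b c d = I 0 (a, c).
  rewrite /subrect /halving /= expr0 !mulr1.
  by rewrite !(addrC _ (_ - _)) !subrK.
apply/eqP; rewrite -normc_eq0 eq_le normc_ge0 andbT.
apply/ler_addgt0Pr => e e0; rewrite add0r.
(* The added 1 covers the degenerate rectangle, for which [L] is 0. *)
have K0 : 0 < 2 * L ^+ 2 + 1 by have := sqr_ge0 L; lra.
apply: le_trans (main (e / (2 * L ^+ 2 + 1)) (divr_gt0 e0 K0)) _.
have -> : 2 * (e / (2 * L ^+ 2 + 1)) * L ^+ 2 = e * ((2 * L ^+ 2) / (2 * L ^+ 2 + 1)).
  by field; rewrite gt_eqF.
by rewrite ler_piMr ?(ltW e0) // ler_pdivrMr // mul1r lerDl.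
Qed.

End Bisection.

(** The frame is cut into two outer columns of full height and the two pieces below and above the
    inner rectangle; [goursat] annihilates each of the four. The two hypotheses of differentiability
    concern the columns and the horizontal bands. *)
Lemma rectint_frame F a a' b' b c c' d' d :
  a <= a' -> a' <= b' -> b' <= b -> c <= c' -> c' <= d' -> d' <= d ->
  (forall x y, a <= x <= b -> c <= y <= d -> (x <= a') || (b' <= x) ->
    cdiff F (x +i* y)) ->
  (forall x y, a <= x <= b -> c <= y <= d -> (y <= c') || (d' <= y) ->
    cdiff F (x +i* y)) ->
  rectint F a b c d = rectint F a' b' c' d'.
Proof.
move=> aa ab bb cc cd dd Dx Dy.
rewrite (@rectint_splitx _ a a' b); last 4 first.
- lra.
- lra.
- by move=> x hx; split; apply: Dy; lra.
- by move=> y hy; split; apply: Dx; lra.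
rewrite (@rectint_splitx _ a' b' b); last 4 first.
- lra.
- lra.
- by move=> x hx; split; apply: Dy; lra.
- by move=> y hy; split; apply: Dx; lra.
rewrite (@rectint_splity _ a' b' c c' d); last 4 first.
- lra.
- lra.
- by move=> x hx; split; apply: Dy; lra.
- by move=> y hy; split; apply: Dx; lra.
rewrite (@rectint_splity _ a' b' c' d' d); last 4 first.
- lra.
- lra.
- by move=> x hx; split; apply: Dy; lra.
- by move=> y hy; split; apply: Dx; lra.
rewrite (@goursat F a a' c d) ?(@goursat F b' b c d); last 6 first.
- lra.
- lra.
- by move=> x y hx hy; apply: Dx; lra.
- lra.
- lra.
- by move=> x y hx hy; apply: Dx; lra.
rewrite (@goursat F a' b' c c') ?(@goursat F a' b' d' d); last 6 first.
- lra.
- lra.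
- by move=> x y hx hy; apply: Dy; lra.
- lra.
- lra.
- by move=> x y hx hy; apply: Dy; lra.
by rewrite !add0r !addr0.
Qed.

(** By [rectint_frame] the integral equals the one over a square of half side [e] around the
    exceptional point. Its perimeter is $8e$, so the bound is $8Ke$, and [e] is arbitrarily
    small. *)
Lemma goursat_removable F a b c d (x0 y0 r K : R) : a < x0 < b -> c < y0 < d ->
  (forall x y, a <= x <= b -> c <= y <= d -> (x != x0) || (y != y0) ->
    cdiff F (x +i* y)) ->
  0 < r -> 0 <= K ->
  (forall x y, `|x - x0| <= r -> `|y - y0| <= r -> (x != x0) || (y != y0) ->
    normc (F (x +i* y)) <= K) ->
  rectint F a b c d = 0.
Proof.
move=> /andP[ax xb] /andP[cy yd] DF r0 K0 BF.
pose M := Num.min r (Num.min (Num.min (x0 - a) (b - x0)) (Num.min (y0 - c) (d - y0))).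
have M0 : 0 < M by rewrite /M !lt_min !subr_gt0 r0 ax xb cy yd.
have Mr : M <= r /\ (M <= x0 - a /\ M <= b - x0) /\ (M <= y0 - c /\ M <= d - y0).
  by rewrite /M !ge_min !lexx !orbT.
clearbody M; have main (e : R) : 0 < e < M -> normc (rectint F a b c d) <= 8 * K * e.
  move=> /andP[e0 eM]; have [? [[? ?] [? ?]]] := Mr.
  have nx (x y : R) : (x <= x0 - e) || (x0 + e <= x) -> (x != x0) || (y != y0).
    by move=> H; apply/orP; left; apply/eqP => E; move: H; rewrite E => /orP[]; lra.
  have ny (x y : R) : (y <= y0 - e) || (y0 + e <= y) -> (x != x0) || (y != y0).
    by move=> H; apply/orP; right; apply/eqP => E; move: H; rewrite E => /orP[]; lra.
  have Dx (x y : R) : a <= x <= b -> c <= y <= d ->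
    (x <= x0 - e) || (x0 + e <= x) -> cdiff F (x +i* y).
    by move=> ? ? H; apply: DF => //; exact: nx.
  have Dy (x y : R) : a <= x <= b -> c <= y <= d ->
    (y <= y0 - e) || (y0 + e <= y) -> cdiff F (x +i* y).
    by move=> ? ? H; apply: DF => //; exact: ny.
  clear DF Mr; rewrite (@rectint_frame F a (x0 - e) (x0 + e) b c (y0 - e) (y0 + e) d) //;
    try lra.
  apply: le_trans (@rectint_bound _ _ _ _ _ K _ _ _ _ _ _) _; try lra.
  - by move=> x hx; clear BF ny; split; apply: Dy; lra.
  - by move=> y hy; clear BF ny; split; apply: Dx; lra.
  - by move=> x hx; clear Dx Dy; split; apply: BF; rewrite ?ler_norml; try lra; apply: ny; lra.
  - by move=> y hy; clear Dx Dy; split; apply: BF; rewrite ?ler_norml; try lra; apply: nx; lra.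
apply/eqP; rewrite -normc_eq0 eq_le normc_ge0 andbT.
apply/ler_addgt0Pr => e e0; rewrite add0r.
have K1 : 0 < 8 * K + 1 by lra.
pose e' := Num.min (M / 2) (e / (8 * K + 1)).
have e'0 : 0 < e' by rewrite /e' lt_min !divr_gt0.
have e'M : e' <= M / 2 /\ e' <= e / (8 * K + 1) by rewrite /e' !ge_min !lexx orbT.
clearbody e'; clear BF DF.
have [m1] := e'M; rewrite ler_pdivlMr // => m2.
by apply: le_trans (main e' _) _; nra.
Qed.

End Goursat.

(** * Limits of integrals on the line *)

Section ConvergenceOfIntegrals.
Context {R : realType}.
Local Notation mu := (@lebesgue_measure R).
Local Notation RT := (measurableTypeR R).
Implicit Types (D : set RT) (f g : R -> R[i]) (u v : R -> R).

Lemma rdct D (u_ : nat -> R -> R) u (v : R -> R) : measurable D ->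
  (forall n, measurable_fun D (u_ n)) -> measurable_fun D u ->
  (forall x, D x -> u_ ^~ x @ \oo --> u x) ->
  (forall n x, D x -> `|u_ n x| <= v x) -> rint D v ->
  rint D u /\ (\int[mu]_(x in D) u_ n x) @[n --> \oo] --> \int[mu]_(x in D) u x.
Proof.
move=> mD m_ mu_ ux ug ig.
have [iu _ H] : [/\ mu.-integrable D (EFin \o u),
    (fun n => \int[mu]_(x in D) `|(EFin \o u_ n) x - (EFin \o u) x|)%E @ \oo --> 0%E
  & (fun n => \int[mu]_(x in D) (EFin \o u_ n) x)%E @ \oo -->
    (\int[mu]_(x in D) (EFin \o u) x)%E].
  apply: (@dominated_convergence _ _ _ _ _ mD (fun n => EFin \o u_ n) (EFin \o u) (EFin \o v)).
  - by move=> n; exact/measurable_EFinP.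
  - exact/measurable_EFinP.
  - apply: aeW => x Dx; apply: cvg_EFin; last exact: ux.
    by near=> n.
  - exact: ig.
  - by apply: aeW => x n Dx /=; rewrite lee_fin ug.
split => //; rewrite /Rintegral.
have fin : (\int[mu]_(x in D) (u x)%:E)%E \is a fin_num by exact: integrable_fin_num.
apply: fine_cvg; rewrite fineK //.
Unshelve. all: by end_near. Qed.

Lemma integrable_limit_itv u : rint (setT : set RT) u ->
  (\int[mu]_(x in `[- n%:R, n%:R]) u x) @[n --> \oo] --> \int[mu]_x u x.
Proof.
move=> iu; have mu_ := rint_measurable iu.
under eq_fun do rewrite Rintegral_mkcond.
have [] := @rdct setT (fun n => u \_ `[- n%:R, n%:R]) u (fun x => `|u x|) _ _ _ _ _ _.
- by [].
- move=> n; apply/(measurable_restrictT u) => //; exact: measurable_funTS.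
- exact: mu_.
- move=> x _; apply: cvg_near_cst; near=> n; rewrite patchT // inE /= in_itv /=.
  rewrite -ler_norml; near: n; exact: nbhs_infty_ger.
- by move=> n x _; rewrite /patch; case: ifP => //; rewrite normr0.
- exact: rint_norm.
- by [].
Unshelve. all: by end_near. Qed.

Lemma ge0_limit_itv u (l : R) : measurable_fun (setT : set RT) u ->
  (forall x, 0 <= u x) -> (forall n, rint (`[- n%:R, n%:R] : set RT) u) ->
  (\int[mu]_(x in `[- n%:R, n%:R]) u x) @[n --> \oo] --> l ->
  rint (setT : set RT) u /\ \int[mu]_x u x = l.
Proof.
move=> mu_ u0 iu ul.
have cup : \bigcup_n [set` `[- n%:R : R, n%:R]] = [set: R].
  rewrite -subTset => x _; exists (Num.bound `|x|) => //=.
  rewrite in_itv /= -ler_norml; apply: ltW.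
  exact: archi_boundP (normr_ge0 x).
have H : (\int[mu]_(x in `[(- n%:R)%R, n%:R%R]) (u x)%:E)%E @[n --> \oo] -->
    (\int[mu]_x (u x)%:E)%E.
  rewrite -cup; apply: ge0_nondecreasing_set_cvg_integral.
  - move=> m n mn; apply/subsetPset; apply: subset_itv; rewrite bnd_simp.
      by rewrite lerN2 ler_nat.
    by rewrite ler_nat.
  - by move=> n; exact: measurable_itv.
  - by move=> n; apply/measurable_EFinP; exact: measurable_funTS.
  - by move=> n x _; rewrite lee_fin.
have H2 : (\int[mu]_(x in `[(- n%:R)%R, n%:R%R]) (u x)%:E)%E @[n --> \oo] --> l%:E.
  have -> : (fun n : nat => \int[mu]_(x in `[(- n%:R)%R, n%:R%R]) (u x)%:E)%E =
      EFin \o (fun n : nat => \int[mu]_(x in `[- n%:R, n%:R]) u x).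
    apply/funext => n /=; rewrite fineK //.
    by apply: integrable_fin_num => //; exact: iu.
  by apply: cvg_EFin; [near=> n|exact: ul].
have E : (\int[mu]_x (u x)%:E)%E = l%:E by apply: cvg_unique H H2.
have iu' : rint (setT : set RT) u.
  apply/integrableP; split; first exact/measurable_EFinP.
  under eq_integral do rewrite /= ger0_norm //.
  by rewrite E ltry.
by split => //; rewrite /Rintegral E.
Unshelve. all: by end_near. Qed.

(** Since [u] is nonnegative, finite limits of the primitive already force integrability, by
    monotone convergence over the intervals from $-n$ to $n$. *)
Lemma FTC_line u (F : R -> R) (l1 l2 : R) : continuous u -> (forall x, 0 <= u x) ->
  (forall x : R, is_derive x (1 : R) F (u x)) ->
  F x @[x --> -oo] --> l1 -> F x @[x --> +oo] --> l2 ->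
  rint (setT : set RT) u /\ \int[mu]_x u x = l2 - l1.
Proof.
move=> cu u0 dF F1 F2.
have dF' x : derivable F x 1 by exact: ex_derive.
have cF : continuous F by move=> x; exact/differentiable_continuous/derivable1_diffP.
have I n : \int[mu]_(x in `[- n%:R, n%:R]) u x = F n%:R - F (- n%:R).
  case: n => [|n].
    by rewrite oppr0 set_itv1 Rintegral_set1 subrr.
  have n0 : (- n.+1%:R : R) < n.+1%:R by rewrite gtrN.
  rewrite /Rintegral (continuous_FTC2 (F := F) n0) //=.
  - exact: continuous_subspaceT.
  - split => //; [exact: cvg_at_right_filter (cF _)|exact: cvg_at_left_filter (cF _)].
  - by move=> x _; rewrite derive1E derive_val.
apply: ge0_limit_itv => //.
- exact: continuous_measurable_fun.
- by move=> n; apply: continuous_rint => x _; exact: cu.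
under eq_fun do rewrite I.
apply: cvgB.
  exact: (cvg_comp _ _ (@cvgr_idn R)) F2.
have : - (n%:R : R) @[n --> \oo] --> -oo.
  exact: (@cvgNrNy _ _ _ _ (fun n : nat => n%:R : R)).2 cvgr_idn.
by move=> H; exact: (cvg_comp _ _ H F1).
Qed.

Lemma cvg_cintegral D (f_ : nat -> R -> R[i]) f v : measurable D ->
  (forall n, cmeas D (f_ n)) -> cmeas D f ->
  (forall x, D x -> forall e : R, 0 < e -> \forall n \near \oo, normc (f_ n x - f x) <= e) ->
  (forall n x, D x -> normc (f_ n x) <= v x) -> rint D v ->
  cintegrable D f /\
  forall e : R, 0 < e ->
    \forall n \near \oo, normc (cintegral D (f_ n) - cintegral D f) <= e.
Proof.
move=> mD m_ [mf1 mf2] cv fg ig.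
have [i1 H1] : rint D (fun x => complex.Re (f x)) /\
   (\int[mu]_(x in D) complex.Re (f_ n x)) @[n --> \oo] --> \int[mu]_(x in D) complex.Re (f x).
  apply: (@rdct _ _ _ v) => //.
  - by move=> n; have [] := m_ n.
  - move=> x Dx; apply/cvgrPdist_le => e e0; near=> n; rewrite -ReB.
    apply: le_trans (ler_Re_normc _) _; rewrite normcBC.
    by near: n; exact: cv.
  - by move=> n x Dx; apply: le_trans (ler_Re_normc _) (fg n x Dx).
have [i2 H2] : rint D (fun x => complex.Im (f x)) /\
   (\int[mu]_(x in D) complex.Im (f_ n x)) @[n --> \oo] --> \int[mu]_(x in D) complex.Im (f x).
  apply: (@rdct _ _ _ v) => //.
  - by move=> n; have [] := m_ n.
  - move=> x Dx; apply/cvgrPdist_le => e e0; near=> n; rewrite -ImB.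
    apply: le_trans (ler_Im_normc _) _; rewrite normcBC.
    by near: n; exact: cv.
  - by move=> n x Dx; apply: le_trans (ler_Im_normc _) (fg n x Dx).
split; first by split.
move=> e e0; have e2 : 0 < e / 2 by rewrite divr_gt0.
near=> n; apply: le_trans (ler_normc_ReIm _) _; rewrite [e]splitr /=.
apply: lerD; rewrite distrC; near: n.
  by move/cvgrPdist_le : H1 => /(_ _ e2).
by move/cvgrPdist_le : H2 => /(_ _ e2).
Unshelve. all: by end_near. Qed.

End ConvergenceOfIntegrals.

(** * The Cauchy kernel of the strip *)

Section StripKernel.
Context {R : realType}.
Implicit Types (x y a b c e : R) (z w u : R[i]) (p : {poly R[i]}).

Definition wexp z : R[i] := cexp (pi%:C * z).
Definition sx x : R := expR (pi * x).
(** This is $1/(2\cosh\pi x)$, the Poisson kernel at the height one half ([weight_pker]). Up to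
    constants it dominates all the kernels below. *)
Definition weight x : R := sx x / (1 + sx x ^+ 2).
(** The Poisson kernel of the half plane at $a+ib$, pulled back by $t=e^{\pi x}$; the factor $\pi$
    in $dt=\pi e^{\pi x}dx$ cancels the usual $1/\pi$. On the line at height 1, where [wexp] is
    negative, the same formula occurs with $-a$. *)
Definition pker a b x : R := b * sx x / ((sx x - a) ^+ 2 + b ^+ 2).

(* On the boundary lines, [ker w0] is the density of the harmonic measure of the
   strip at the point [z0] such that [wexp z0 = w0], with a minus sign on the
   line [Im z = 1]; [zeta w0] maps the strip to the unit disc and [z0] to 0. *)
Definition ker w0 z : R[i] :=
  (complex.Im w0)%:C * wexp z / ((wexp z - w0) * (wexp z - w0^*%C)).
Definition zeta w0 z : R[i] := (wexp z - w0) / (wexp z - w0^*%C).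
Definition phi w0 p z : R[i] := ker w0 z * cexp (- p.[zeta w0 z]).

Lemma sx_gt0 x : 0 < sx x. Proof. exact: expR_gt0. Qed.

Lemma wexpE x y : wexp (x +i* y) =
  (sx x * cos (pi * y)) +i* (sx x * sin (pi * y)).
Proof.
rewrite /wexp /cexp ReM ImM /= /sx.
by rewrite !mul0r subr0 addr0.
Qed.

Lemma zetaE w0 z : zeta w0 z = (wexp z - w0) / (wexp z - w0^*%C).
Proof. by []. Qed.

Lemma kerE w0 z : ker w0 z = (complex.Im w0)%:C * wexp z / ((wexp z - w0) * (wexp z - w0^*%C)).
Proof. by []. Qed.

Lemma phiE w0 p z : phi w0 p z = ker w0 z * cexp (- p.[zeta w0 z]).
Proof. by []. Qed.

Lemma wexp_cexp z : wexp z = cexp (pi%:C * z).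
Proof. by []. Qed.

Lemma Re_cexp z : complex.Re (cexp z) = expR (complex.Re z) * cos (complex.Im z).
Proof. by []. Qed.

Lemma Im_cexp z : complex.Im (cexp z) = expR (complex.Re z) * sin (complex.Im z).
Proof. by []. Qed.

#[global] Opaque cexp wexp ker zeta phi.

Lemma wexp_line0 x : wexp (x +i* 0) = (sx x)%:C.
Proof. by rewrite wexpE mulr0 cos0 sin0 mulr1 mulr0. Qed.

Lemma wexp_line1 x : wexp (x +i* 1) = (- sx x)%:C.
Proof. by rewrite wexpE mulr1 cospi sinpi mulrN1 mulr0. Qed.

Lemma Im_wexp_ge0 x y : 0 <= y <= 1 -> 0 <= complex.Im (wexp (x +i* y)).
Proof.
move=> /andP[y0 y1]; rewrite wexpE /= mulr_ge0 ?(ltW (sx_gt0 _)) // sin_ge0_pi //.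
by have := @pi_ge0 R; nra.
Qed.

Lemma Im_wexp_gt0 z : 0 < complex.Im z < 1 -> 0 < complex.Im (wexp z).
Proof.
case: z => x y /= /andP[y0 y1]; rewrite wexpE /= mulr_gt0 ?sx_gt0 // sin_gt0_pi //.
by have := @pi_gt0 R; nra.
Qed.

Lemma Re_wexp z0 : complex.Re (wexp z0) = sx (complex.Re z0) * cos (pi * complex.Im z0).
Proof. by case: z0 => x y; rewrite wexpE. Qed.

Lemma Im_wexp z0 : complex.Im (wexp z0) = sx (complex.Re z0) * sin (pi * complex.Im z0).
Proof. by case: z0 => x y; rewrite wexpE. Qed.

Lemma cdiff_wexp z : cdiff wexp z.
Proof.
have -> : wexp = (fun z => cexp (pi%:C * z)) by apply/funext => u; exact: wexp_cexp.
apply: cdiff_comp; last exact: cdiff_cexp.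
by apply: cdiffM; [exact: cdiff_cst|exact: cdiff_id].
Qed.

Lemma normc_wexp_subJ w0 u : 0 <= complex.Im w0 -> 0 <= complex.Im u ->
  normc (u - w0) <= normc (u - w0^*%C).
Proof.
move=> w00 u0; rewrite -(@ler_pXn2r _ 2) ?nnegrE ?normc_ge0 // !sqr_normc.
case: w0 w00 u0 => a b; case: u => p q /= ? ?; nra.
Qed.

Lemma wexp_subJ_neq0 w0 z : 0 < complex.Im w0 -> 0 <= complex.Im z <= 1 ->
  wexp z - w0^*%C != 0.
Proof.
case: z => x y w00 /= y01; apply/eqP => /(congr1 (@complex.Im R)).
have := Im_wexp_ge0 x y01; case: w0 w00 => a b /= b0.
by rewrite ImB /=; lra.
Qed.

Lemma normc_zeta_le1 w0 z : 0 < complex.Im w0 -> 0 <= complex.Im z <= 1 ->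
  normc (zeta w0 z) <= 1.
Proof.
move=> w00 z01; rewrite zetaE normcM normcV ler_pdivrMr ?mul1r.
  by apply: normc_wexp_subJ; [exact: ltW|case: z z01 => x y /(Im_wexp_ge0 x)].
by rewrite normc_gt0 wexp_subJ_neq0.
Qed.

Lemma cdiff_zeta w0 z : 0 < complex.Im w0 -> 0 <= complex.Im z <= 1 ->
  cdiff (zeta w0) z.
Proof.
move=> w00 z01; have -> : zeta w0 = (fun z => (wexp z - w0) / (wexp z - w0^*%C)).
  by apply/funext => u; exact: zetaE.
apply: cdiffM.
  by apply: cdiffB; [exact: cdiff_wexp|exact: cdiff_cst].
apply: cdiffV; last exact: wexp_subJ_neq0.
by apply: cdiffB; [exact: cdiff_wexp|exact: cdiff_cst].
Qed.

Lemma cdiff_ker w0 z : 0 < complex.Im w0 -> 0 <= complex.Im z <= 1 ->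
  wexp z != w0 -> cdiff (ker w0) z.
Proof.
move=> w00 z01 zw0; have -> : ker w0 = (fun z => (complex.Im w0)%:C * wexp z /
    ((wexp z - w0) * (wexp z - w0^*%C))).
  by apply/funext => u; exact: kerE.
apply: cdiffM.
  by apply: cdiffM; [exact: cdiff_cst|exact: cdiff_wexp].
apply: cdiffV; last by rewrite mulf_neq0 ?subr_eq0 // -subr_eq0 wexp_subJ_neq0.
by apply: cdiffM; apply: cdiffB; (exact: cdiff_wexp || exact: cdiff_cst).
Qed.

Lemma cdiff_cexp_horner p w0 z : 0 < complex.Im w0 -> 0 <= complex.Im z <= 1 ->
  cdiff (fun z => cexp (- p.[zeta w0 z])) z.
Proof.
move=> w00 z01; apply: cdiff_comp; last exact: cdiff_cexp.
apply: cdiffN; apply: (cdiff_comp (cdiff_zeta w00 z01)); exact: cdiff_horner.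
Qed.

Lemma wexp_inj_strip z z0 : 0 <= complex.Im z <= 1 -> 0 <= complex.Im z0 <= 1 ->
  wexp z = wexp z0 -> z = z0.
Proof.
case: z => x y; case: z0 => x0 y0 /= y01 y001 E.
have xx0 : x = x0.
  move: (congr1 (@normc R) E); rewrite !wexp_cexp !normc_cexp !ReM /= !mul0r !subr0.
  by move=> /expR_inj /(mulfI (lt0r_neq0 (@pi_gt0 R))).
move: E; rewrite xx0 !wexpE => -[+ _] => /(mulfI (lt0r_neq0 (sx_gt0 x0))).
have p0 := @pi_gt0 R.
move=> /cos_inj; rewrite !in_itv /= => H; congr (_ +i* _).
by apply: (mulfI (lt0r_neq0 p0)); apply: H; apply/andP; split; nra.
Qed.

(** With $v=\pi u$ one has $|e^v-1|\ge|v|-3|v|^2\ge|v|/4$ as soon as $|v|\le1/4$. Consequently the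
    pole of [ker] at [z0] is at most simple. *)
Lemma wexp_near z0 u : normc u <= (4 * pi)^-1 ->
  normc (wexp z0) * pi / 4 * normc u <= normc (wexp (z0 + u) - wexp z0).
Proof.
move=> u4; have p0 := @pi_gt0 R.
have N : normc (pi%:C * u) = pi * normc u.
  by rewrite normcM normc_real gtr0_norm.
have pu : pi * normc u <= 4^-1.
  have H : pi * (4 * pi)^-1 = 4^-1 :> R.
    by rewrite invfM mulrCA mulfV ?mulr1 // lt0r_neq0.
  by rewrite -H ler_pM2l.
rewrite !wexp_cexp (mulrDr (pi%:C)) cexpD.
have -> : cexp (pi%:C * z0) * cexp (pi%:C * u) - cexp (pi%:C * z0) =
  cexp (pi%:C * z0) * (cexp (pi%:C * u) - 1) by ring.
rewrite normcM -!mulrA ler_wpM2l ?normc_ge0 //.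
have := @cexp_sub1_le R (pi%:C * u); rewrite N => H.
have {}H := H (le_trans pu _); have {}H := H ltac:(lra).
have := lerB_normc (pi%:C * u) (cexp (pi%:C * u) - 1); rewrite N.
rewrite -(normcBC (cexp _ - 1)) => H2.
have t0 : 0 <= pi * normc u by rewrite mulr_ge0 ?normc_ge0 // ltW.
rewrite mulrCA; move: (pi * normc u) (normc (_ - 1)) (normc (_ - _)) t0 pu H H2.
move=> t X Y *; nra.
Qed.

(** If $s$ and $t$ are the moduli of the two values, their squared distance is
    $s^2+t^2-2st\cos(\pi(y-y_0))$. A gap between the heights keeps the cosine below $1-k$, and the
    distance is then at least a multiple of $\sqrt{s^2+t^2}$, uniformly in [x]. *)
Lemma wexp_gap z0 e : 0 < complex.Im z0 < 1 -> 0 < e ->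
  exists2 c, 0 < c & forall x y, 0 <= y <= 1 -> e <= `|y - complex.Im z0| ->
    c * (1 + sx x) <= normc (wexp (x +i* y) - wexp z0).
Proof.
case: z0 => x0 y0 /= y001 e0; have p0 := @pi_gt0 R.
(* Capping at 1 keeps $\pi e'$ in $[0,\pi]$, where the cosine decreases. *)
pose e' := Num.min e 1.
have e'0 : 0 < e' by rewrite lt_min e0 ltr01.
have e'1 : e' <= 1 by rewrite ge_min lexx orbT.
have e'e : e' <= e by rewrite ge_min lexx.
pose k := 1 - cos (pi * e').
have pe' : 0 < pi * e' <= pi by apply/andP; split; nra.
have k0 : 0 < k.
  by rewrite /k subr_gt0 -[ltRHS]cos0 ltr_cos ?in_itv /= ?lexx; lra.
have k2 : k <= 2 by rewrite /k; have := cos_geN1 (pi * e'); lra.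
have s0 := sx_gt0 x0.
pose m := Num.min 1 (sx x0 ^+ 2).
have m0 : 0 < m by rewrite lt_min ltr01 exprn_gt0.
have m1 : m <= 1 by rewrite ge_min lexx.
have m2 : m <= sx x0 ^+ 2 by rewrite ge_min lexx orbT.
exists (k * m / 4); first by rewrite divr_gt0 // mulr_gt0.
move=> x y y01 ey.
have s1 := sx_gt0 x.
have C : cos (pi * (y - y0)) <= 1 - k.
  rewrite /k opprB addrCA subrr addr0 -cos_norm normrM (gtr0_norm p0).
  have h1 : `|y - y0| <= 1 by rewrite ler_norml; lra.
  have h2 : pi * e' \in `[0, pi] by rewrite in_itv /=; lra.
  have h3 : pi * `|y - y0| \in `[0, pi].
    by rewrite in_itv /= mulr_ge0 ?(ltW p0) //= -[leRHS]mulr1 ler_pM2l.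
  by rewrite leNgt ltr_cos // -leNgt ler_pM2l //; exact: le_trans e'e ey.
rewrite -(@ler_pXn2r _ 2) ?nnegrE ?normc_ge0 //; last first.
  by rewrite mulr_ge0 ?addr_ge0 ?(ltW s1) // divr_ge0 // mulr_ge0 // ltW.
rewrite !wexpE sqr_normc ReB ImB /=.
have -> : (sx x * cos (pi * y) - sx x0 * cos (pi * y0)) ^+ 2 +
    (sx x * sin (pi * y) - sx x0 * sin (pi * y0)) ^+ 2 =
    sx x ^+ 2 + sx x0 ^+ 2 - 2 * sx x * sx x0 * cos (pi * (y - y0)).
  rewrite mulrBr cosB.
  have := cos2Dsin2 (pi * y); have := cos2Dsin2 (pi * y0).
  move: (cos _) (cos _) (sin _) (sin _) => c1 c2 t1 t2 E1 E2.
  have -> : sx x ^+ 2 = sx x ^+ 2 * (c1 ^+ 2 + t1 ^+ 2) by rewrite E2 mulr1.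
  have -> : sx x0 ^+ 2 = sx x0 ^+ 2 * (c2 ^+ 2 + t2 ^+ 2) by rewrite E1 mulr1.
  ring.
move: (sx x) (sx x0) s1 s0 m2 (cos _) C => s t s1 s0 m2 C Ck.
clear pe' e'0 e'1 e'e e0 ey y001 y01 p0.
(* At $C=1-k$ the difference of the two sides is $(1-\frac k2)(s-t)^2+kst$. *)
have H1 : k / 2 * (s ^+ 2 + t ^+ 2) <= s ^+ 2 + t ^+ 2 - 2 * s * t * C.
  have st : 0 < s * t by rewrite mulr_gt0.
  have : s * t * C <= s * t * (1 - k) by rewrite ler_pM2l.
  have : 0 <= (1 - k / 2) * (s - t) ^+ 2 by rewrite mulr_ge0 ?sqr_ge0 //; lra.
  have : 0 <= k * (s * t) by rewrite mulr_ge0 // ltW.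
  lra.
apply: le_trans H1.
have H2 : m * (s ^+ 2 + 1) <= s ^+ 2 + t ^+ 2.
  by have := sqr_ge0 s; nra.
have H3 : (k * m / 4 * (1 + s)) ^+ 2 <= k * m / 4 * (1 + s) ^+ 2.
  rewrite exprMn ler_wpM2r ?sqr_ge0 // expr2 ler_piMr //.
    by rewrite divr_ge0 // mulr_ge0 // ltW.
  by nra.
apply: le_trans H3 _.
apply: (@le_trans _ _ (k / 2 * (m * (s ^+ 2 + 1)))); last by rewrite ler_pM2l // divr_gt0.
have : 0 <= k * m * (s - 1) ^+ 2 by rewrite mulr_ge0 ?sqr_ge0 // mulr_ge0 // ltW.
lra.
Qed.

End StripKernel.

(** * Weighted estimates and masses of the kernel *)

Section KernelEstimates.
Context {R : realType}.
Local Notation mu := (@lebesgue_measure R).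
Local Notation RT := (measurableTypeR R).
Implicit Types (x y a b c e t : R) (z w u : R[i]) (p : {poly R[i]}).

Lemma weight_gt0 x : 0 < weight x.
Proof.
by rewrite divr_gt0 ?sx_gt0 // ltr_pwDl // exprn_ge0 // ltW ?sx_gt0.
Qed.

Lemma weight_ge0 x : 0 <= weight x. Proof. exact/ltW/weight_gt0. Qed.

Lemma ler_weight_sqr s t : 0 < s -> 0 < t -> s / (t * (1 + s)) ^+ 2 <= t ^- 2 * (s / (1 + s ^+ 2)).
Proof.
move=> s0 t0; have h1 : 0 < 1 + s ^+ 2 by rewrite ltr_pwDl // exprn_ge0 // ltW.
rewrite exprMn invfM mulrCA ler_pM2l ?invr_gt0 ?exprn_gt0 //.
by rewrite ler_pM2l // lef_pV2 ?posrE ?exprn_gt0 ?addr_gt0 //; nra.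
Qed.

Lemma wexp_lip x y t : normc (wexp (x +i* y) - wexp (x +i* t)) <=
  2 * pi * sx x * `|y - t|.
Proof.
have p0 := @pi_gt0 R; have s0 := sx_gt0 x.
rewrite !wexpE; apply: le_trans (ler_normc_ReIm _) _; rewrite /= -!mulrBr !normrM.
rewrite (gtr0_norm s0).
have E : `|pi * y - pi * t| = pi * `|y - t| :> R by rewrite -mulrBr normrM (gtr0_norm p0).
have := cos_lipschitz (pi * y) (pi * t); have := sin_lipschitz (pi * y) (pi * t).
by rewrite E => *; nra.
Qed.

Lemma ker_bound w c x y : 0 < complex.Im w -> 0 <= y <= 1 -> 0 < c ->
  c * (1 + sx x) <= normc (wexp (x +i* y) - w) ->
  normc (ker w (x +i* y)) <= complex.Im w * c ^- 2 * weight x.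
Proof.
move=> w0 y01 c0 H; rewrite kerE; have s0 := sx_gt0 x.
have H2 : normc (wexp (x +i* y) - w) <= normc (wexp (x +i* y) - w^*%C).
  by apply: normc_wexp_subJ; [exact: ltW|exact: Im_wexp_ge0].
have Nw : normc (wexp (x +i* y)) = sx x.
  by rewrite wexp_cexp normc_cexp ReM /= mul0r subr0.
rewrite !normcM normcV normcM normc_real (gtr0_norm w0) Nw -!mulrA ler_pM2l //.
apply: le_trans (ler_weight_sqr s0 c0); rewrite ler_pM2l //.
have cs : 0 < c * (1 + sx x) by rewrite mulr_gt0 // addr_gt0.
rewrite lef_pV2 ?posrE ?exprn_gt0 //.
  by rewrite expr2; apply: ler_pM; rewrite ?(ltW cs) //; exact: le_trans H H2.
apply: mulr_gt0; first exact: lt_le_trans H.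
by apply: lt_le_trans H2; exact: lt_le_trans H.
Qed.

(** Over the common denominator the numerator is $(u-v)(w\bar w-uv)$. With $s$ for [sx x], it is of
    order $s|y-t|(1+s^2)$, while the denominator is at least $c^4(1+s)^4$; the quotient is of the
    order of [weight x]. *)
Lemma ker_lip w c x y t : 0 < complex.Im w -> 0 <= y <= 1 -> 0 <= t <= 1 -> 0 < c ->
  c * (1 + sx x) <= normc (wexp (x +i* y) - w) ->
  c * (1 + sx x) <= normc (wexp (x +i* t) - w) ->
  normc (ker w (x +i* y) - ker w (x +i* t)) <=
   complex.Im w * (2 * pi) * (1 + normc w ^+ 2) * c ^- 4 * `|y - t| * weight x.
Proof.
move=> w0 y01 t01 c0 H H'; rewrite !kerE; have s0 := sx_gt0 x.
have H2 : normc (wexp (x +i* y) - w) <= normc (wexp (x +i* y) - w^*%C).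
  by apply: normc_wexp_subJ; [exact: ltW|exact: Im_wexp_ge0].
have H2' : normc (wexp (x +i* t) - w) <= normc (wexp (x +i* t) - w^*%C).
  by apply: normc_wexp_subJ; [exact: ltW|exact: Im_wexp_ge0].
have L := wexp_lip x y t.
have Nw s : normc (wexp (x +i* s)) = sx x.
  by rewrite wexp_cexp normc_cexp ReM /= mul0r subr0.
have cs : 0 < c * (1 + sx x) by rewrite mulr_gt0 // addr_gt0.
have N1 := Nw y; have N2 := Nw t.
move: (wexp (x +i* y)) (wexp (x +i* t)) H H' H2 H2' L N1 N2 => u v H H' H2 H2' L N1 N2.
have u1 : u - w != 0 by rewrite -normc_gt0; exact: lt_le_trans cs H.
have v1 : v - w != 0 by rewrite -normc_gt0; exact: lt_le_trans cs H'.
have u2 : u - w^*%C != 0.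
  by rewrite -normc_gt0; apply: lt_le_trans H2; rewrite normc_gt0.
have v2 : v - w^*%C != 0.
  by rewrite -normc_gt0; apply: lt_le_trans H2'; rewrite normc_gt0.
have -> : (complex.Im w)%:C * u / ((u - w) * (u - w^*%C)) -
   (complex.Im w)%:C * v / ((v - w) * (v - w^*%C)) =
   (complex.Im w)%:C * ((u - v) * (w * w^*%C - u * v) /
     (((u - w) * (u - w^*%C)) * ((v - w) * (v - w^*%C)))).
  by field; rewrite u1 u2 v1 v2.
rewrite normcM normc_real (gtr0_norm w0).
rewrite [leRHS](_ : _ = complex.Im w * (2 * (pi * ((1 + normc w ^+ 2) *
  (c ^- 4 * (`|y - t| * weight x)))))); last by ring.
rewrite ler_pM2l // !normcM normcV !normcM.
have B1 : normc (w * w^*%C - u * v) <= (1 + normc w ^+ 2) * (1 + sx x ^+ 2).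
  apply: le_trans (ler_normcB _ _) _; rewrite !normcM normc_conj N1 N2 -!expr2.
  have : 0 <= normc w ^+ 2 by rewrite exprn_ge0 ?normc_ge0.
  have : 0 <= sx x ^+ 2 by rewrite exprn_ge0 // ltW.
  move=> *; nra.
have B2 : (normc (u - w) * normc (u - w^*%C) * (normc (v - w) * normc (v - w^*%C)))^-1
    <= c ^- 4 * (1 + sx x ^+ 2) ^- 2.
  have h1 : 0 < 1 + sx x ^+ 2 by rewrite ltr_pwDl // exprn_ge0 // ltW.
  rewrite -invfM lef_pV2 ?posrE; last 2 first.
  - by rewrite !mulr_gt0 // normc_gt0.
  - by rewrite mulr_gt0 // exprn_gt0.
  apply: (@le_trans _ _ ((c * (1 + sx x)) * (c * (1 + sx x)) *
     ((c * (1 + sx x)) * (c * (1 + sx x))))).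
    have -> : c * (1 + sx x) * (c * (1 + sx x)) * (c * (1 + sx x) * (c * (1 + sx x))) =
       c ^+ 4 * ((1 + sx x) ^+ 2) ^+ 2 by ring.
    rewrite ler_pM2l ?exprn_gt0 //.
    by rewrite ler_pXn2r ?nnegrE ?sqr_ge0 ?(ltW h1) //; nra.
  have c0' := ltW cs; have m0 := mulr_ge0 c0' c0'.
  apply: ler_pM => //; apply: ler_pM => //; exact: le_trans H2 || exact: le_trans H2'.
have h1 : 0 < 1 + sx x ^+ 2 by rewrite ltr_pwDl // exprn_ge0 // ltW.
have -> : 2 * (pi * ((1 + normc w ^+ 2) * (c ^- 4 * (`|y - t| * weight x)))) =
   2 * pi * sx x * `|y - t| * (((1 + normc w ^+ 2) * (1 + sx x ^+ 2)) *
     (c ^- 4 * (1 + sx x ^+ 2) ^- 2)).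
  by rewrite /weight; field; rewrite !gt_eqF.
have n3 : 0 <= (normc (u - w) * normc (u - w^*%C) * (normc (v - w) * normc (v - w^*%C)))^-1.
  by rewrite invr_ge0 !mulr_ge0 ?normc_ge0.
rewrite -(mulrA (normc (u - v))).
exact: ler_pM (normc_ge0 _) (mulr_ge0 (normc_ge0 _) n3) L (ler_pM (normc_ge0 _) n3 B1 B2).
Qed.

Lemma zeta_lip w c x y t : 0 < complex.Im w -> 0 <= y <= 1 -> 0 <= t <= 1 -> 0 < c ->
  c * (1 + sx x) <= normc (wexp (x +i* y) - w) ->
  c * (1 + sx x) <= normc (wexp (x +i* t) - w) ->
  normc (zeta w (x +i* y) - zeta w (x +i* t)) <=
    4 * pi * complex.Im w * c ^- 2 * `|y - t|.
Proof.
move=> w0 y01 t01 c0 H H'; rewrite !zetaE; have s0 := sx_gt0 x.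
have H2 : normc (wexp (x +i* y) - w) <= normc (wexp (x +i* y) - w^*%C).
  by apply: normc_wexp_subJ; [exact: ltW|exact: Im_wexp_ge0].
have H2' : normc (wexp (x +i* t) - w) <= normc (wexp (x +i* t) - w^*%C).
  by apply: normc_wexp_subJ; [exact: ltW|exact: Im_wexp_ge0].
have L := wexp_lip x y t.
have cs : 0 < c * (1 + sx x) by rewrite mulr_gt0 // addr_gt0.
move: (wexp (x +i* y)) (wexp (x +i* t)) H H' H2 H2' L => u v H H' H2 H2' L.
have u2 : u - w^*%C != 0.
  by rewrite -normc_gt0; apply: lt_le_trans H2; exact: lt_le_trans cs H.
have v2 : v - w^*%C != 0.
  by rewrite -normc_gt0; apply: lt_le_trans H2'; exact: lt_le_trans cs H'.
have -> : (u - w) / (u - w^*%C) - (v - w) / (v - w^*%C) =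
   (u - v) * ((w - w^*%C) / ((u - w^*%C) * (v - w^*%C))).
  by field; rewrite u2 v2.
have NI : normc (w - w^*%C) = 2 * complex.Im w.
  have -> : w - w^*%C = 0 +i* (2 * complex.Im w).
    by case: (w) => ? ?; apply: eq_ReIm => /=; ring.
  by rewrite normcE2 /= expr0n add0r sqrtr_sqr ger0_norm // mulr_ge0 // ltW.
rewrite !normcM NI normcV normcM.
have B2 : (normc (u - w^*%C) * normc (v - w^*%C))^-1 <= ((c * (1 + sx x)) ^+ 2)^-1.
  rewrite lef_pV2 ?posrE ?exprn_gt0 // ?mulr_gt0 ?normc_gt0 //.
  by rewrite expr2; exact: ler_pM (ltW cs) (ltW cs) (le_trans H H2) (le_trans H' H2').
apply: (@le_trans _ _ (2 * pi * sx x * `|y - t| * (2 * complex.Im w *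
   ((c * (1 + sx x)) ^+ 2)^-1))).
  apply: ler_pM L _; first exact: normc_ge0.
    by rewrite !mulr_ge0 ?invr_ge0 ?mulr_ge0 ?normc_ge0 ?(ltW w0).
  by rewrite ler_pM2l // mulr_gt0.
have -> : 2 * pi * sx x * `|y - t| * (2 * complex.Im w * ((c * (1 + sx x)) ^+ 2)^-1) =
  4 * pi * complex.Im w * `|y - t| * (sx x / (c * (1 + sx x)) ^+ 2).
  by field; rewrite !gt_eqF // addr_gt0.
have -> : 4 * pi * complex.Im w * c ^- 2 * `|y - t| =
  4 * pi * complex.Im w * `|y - t| * c ^- 2 by ring.
rewrite ler_wpM2l ?mulr_ge0 ?(ltW w0) ?pi_ge0 //.
apply: le_trans (ler_weight_sqr s0 c0) _.
rewrite ler_piMr ?invr_ge0 ?exprn_ge0 ?(ltW c0) //.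
by rewrite ler_pdivrMr ?mul1r; nra.
Qed.

(** Both bounds carry the factor [weight x] and are uniform in [x]. The second one allows the kernel
    to be moved to a boundary line while [h] stays at its own height. The distance [e] from the
    height of [z0] keeps the pole away. *)
Lemma phi_estimates (z0 : R[i]) p e : 0 < complex.Im z0 < 1 -> 0 < e ->
  exists2 C : R, 0 <= C & forall x y t, 0 <= y <= 1 -> 0 <= t <= 1 ->
    e <= `|y - complex.Im z0| -> e <= `|t - complex.Im z0| ->
    normc (phi (wexp z0) p (x +i* y)) <= C * weight x /\
    normc (phi (wexp z0) p (x +i* y) - phi (wexp z0) p (x +i* t)) <=
      C * `|y - t| * weight x.
Proof.
move=> z01 e0; have w0 := Im_wexp_gt0 z01.
have [c c0 Hc] := wexp_gap z01 e0.
set w := wexp z0 in w0 Hc *.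
have [K K0 HK] := horner_bounded p; have [L L0 HL] := horner_lipschitz p.
pose C1 := complex.Im w * c ^- 2.
pose C2 := complex.Im w * (2 * pi) * (1 + normc w ^+ 2) * c ^- 4.
pose C3 := 4 * pi * complex.Im w * c ^- 2.
have c2 : 0 <= c ^- 2 by rewrite invr_ge0 exprn_ge0 // ltW.
have c4 : 0 <= c ^- 4 by rewrite invr_ge0 exprn_ge0 // ltW.
have pi0 := @pi_ge0 R; have w00 := ltW w0.
have C10 : 0 <= C1 by rewrite mulr_ge0.
have C20 : 0 <= C2.
  have n : 0 <= 1 + normc w ^+ 2 by rewrite addr_ge0 // exprn_ge0 // normc_ge0.
  by do 3![apply: mulr_ge0 => //]; exact: mulr_ge0.
have C30 : 0 <= C3 by do 2![apply: mulr_ge0 => //]; exact: mulr_ge0.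
have e1 := expR_ge0 K.
have c5 : 0 <= C1 * expR K by rewrite mulr_ge0.
have c6 : 0 <= C2 * expR K by rewrite mulr_ge0.
have c7 : 0 <= C1 * (4 * expR K * (L * C3)).
  exact: mulr_ge0 C10 (mulr_ge0 (mulr_ge0 (ler0n _ 4) e1) (mulr_ge0 L0 C30)).
exists (C1 * expR K + (C2 * expR K + C1 * (4 * expR K * (L * C3)))).
  by rewrite !addr_ge0.
move=> x y t y01 t01 ey et.
have W0 := weight_ge0 x.
have z1 s : 0 <= s <= 1 -> normc (zeta w (x +i* s)) <= 1.
  by move=> s01; apply: normc_zeta_le1.
have Re_p u : normc u <= 1 -> complex.Re (- p.[u]) <= K.
  move=> u1; apply: le_trans (ler_norm _) _; apply: le_trans (ler_Re_normc _) _.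
  by rewrite normcN HK.
have B s : 0 <= s <= 1 -> normc (cexp (- p.[zeta w (x +i* s)])) <= expR K.
  by move=> s01; rewrite normc_cexp ler_expR Re_p // z1.
have k1 := ker_bound w0 y01 c0 (Hc x y y01 ey).
have k2 := ker_lip w0 y01 t01 c0 (Hc x y y01 ey) (Hc x t t01 et).
have k3 := ker_bound w0 t01 c0 (Hc x t t01 et).
have zl := zeta_lip w0 y01 t01 c0 (Hc x y y01 ey) (Hc x t t01 et).
have el : normc (cexp (- p.[zeta w (x +i* y)]) - cexp (- p.[zeta w (x +i* t)])) <=
    4 * expR K * (L * (C3 * `|y - t|)).
  apply: le_trans (@cexp_lipschitz _ K _ _ _ _) _; rewrite ?Re_p ?z1 //.
  rewrite ler_wpM2l ?mulr_ge0 //.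
  have -> : - p.[zeta w (x +i* y)] - - p.[zeta w (x +i* t)] =
    - (p.[zeta w (x +i* y)] - p.[zeta w (x +i* t)]) by ring.
  rewrite normcN; apply: le_trans (HL _ _ (z1 _ y01) (z1 _ t01)) _.
  by rewrite ler_wpM2l.
split.
  rewrite phiE normcM; apply: (@le_trans _ _ (C1 * weight x * expR K)).
    by apply: ler_pM; rewrite ?normc_ge0 ?B.
  by rewrite mulrAC ler_wpM2r // lerDl addr_ge0.
rewrite !phiE.
set k := ker w (x +i* y) in k1 k2 *; set k' := ker w (x +i* t) in k2 k3 *.
set q := cexp _ in el *; set q' := cexp (- _) in el *.
have -> : k * q - k' * q' = (k - k') * q + k' * (q - q') by ring.
apply: le_trans (ler_normcD _ _) _; rewrite (normcM (k - k')) (normcM k').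
apply: (@le_trans _ _ (C2 * `|y - t| * weight x * expR K +
   C1 * weight x * (4 * expR K * (L * (C3 * `|y - t|))))).
  apply: lerD.
    exact: ler_pM (normc_ge0 _) (normc_ge0 _) k2 (B y y01).
  exact: ler_pM (normc_ge0 _) (normc_ge0 _) k3 el.
have -> : C2 * `|y - t| * weight x * expR K +
   C1 * weight x * (4 * expR K * (L * (C3 * `|y - t|))) =
   (C2 * expR K + C1 * (4 * expR K * (L * C3))) * `|y - t| * weight x by ring.
by rewrite ler_wpM2r // ler_wpM2r // lerDr.
Qed.

Lemma pker_gt0 a b x : 0 < b -> 0 < pker a b x.
Proof.
move=> b0; rewrite /pker divr_gt0 ?mulr_gt0 ?sx_gt0 //.
by rewrite ltr_wpDl ?sqr_ge0 // exprn_gt0.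
Qed.

Lemma normc_conj_mul z w : (z - w) * (z - w^*%C) =
  z ^+ 2 - (2 * complex.Re w)%:C * z + (complex.Re w ^+ 2 + complex.Im w ^+ 2)%:C.
Proof.
by case: z => x y; case: w => a b; apply: eq_ReIm;
  rewrite !(ReM, ImM, ReD, ImD, ReN, ImN) /=; ring.
Qed.

Lemma ker_line0 w x : 0 < complex.Im w ->
  ker w (x +i* 0) = (pker (complex.Re w) (complex.Im w) x)%:C.
Proof.
move=> w0; rewrite kerE wexp_line0 normc_conj_mul -rmorphM -rmorphXn -!rmorphM.
rewrite -rmorphB -rmorphD -fmorphV -rmorphM; congr (_%:C); rewrite /pker.
by congr (_ / _); ring.
Qed.

Lemma ker_line1 w x : 0 < complex.Im w ->
  ker w (x +i* 1) = (- pker (- complex.Re w) (complex.Im w) x)%:C.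
Proof.
move=> w0; rewrite kerE wexp_line1 normc_conj_mul -rmorphM -rmorphXn -!rmorphM.
rewrite -rmorphB -rmorphD -fmorphV -rmorphM; congr (_%:C); rewrite /pker.
by rewrite mulrN mulNr; congr (- (_ / _)); ring.
Qed.

Lemma is_derive_sx x : is_derive x (1 : R) (@sx R) (pi * sx x).
Proof.
have -> : @sx R = expR \o ( *%R pi) by [].
by apply: is_derive_eq; rewrite /GRing.scale /= mulr1 mulrC.
Qed.

Lemma continuous_sx : continuous (@sx R).
Proof.
move=> x; have := is_derive_sx x => H.
by apply/differentiable_continuous/derivable1_diffP; exact: ex_derive.
Qed.

Lemma continuous_pker a b : 0 < b -> continuous (pker a b).
Proof.
move=> b0 x; have cs := @continuous_sx x.
apply: cvgM; first by apply: cvgM => //; exact: cvg_cst.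
apply: cvgV.
  by rewrite gt_eqF // ltr_wpDl ?sqr_ge0 // exprn_gt0.
apply: cvgD; last exact: cvg_cst.
by apply: cvgM; apply: cvgB => //; exact: cvg_cst.
Qed.

Lemma cvg_sx_pinfty : sx x @[x --> +oo] --> (+oo : set_system R).
Proof.
have p0 := @pi_gt0 R.
apply/cvgryPge => A; near=> x.
apply: le_trans (expR_ge1Dx _).
have : A / pi <= x by near: x; apply: nbhs_pinfty_ge; rewrite num_real.
by rewrite ler_pdivrMr // mulrC; lra.
Unshelve. all: by end_near. Qed.

Lemma cvg_sx_ninfty : sx x @[x --> -oo] --> (0 : R).
Proof.
have p0 := @pi_gt0 R.
apply/cvgrPdist_le => e e0; near=> x; rewrite sub0r normrN (gtr0_norm (sx_gt0 _)).
rewrite /sx -[e]invrK -[pi * x]opprK expRN lef_pV2 ?posrE ?expR_gt0 ?invr_gt0 //.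
apply: le_trans (expR_ge1Dx _).
have : x <= - (e^-1 / pi) by near: x; apply: nbhs_ninfty_le; rewrite num_real.
by rewrite lerNr ler_pdivrMr // mulrC -mulrN; lra.
Unshelve. all: by end_near. Qed.

Lemma cvg_atan_pinfty : atan x @[x --> +oo] --> (pi / 2 : R).
Proof.
apply/cvgrPdist_le => e e0.
pose d := Num.min e (pi / 2).
have p0 := @pi_gt0 R.
have d0 : 0 < d by rewrite lt_min e0 divr_gt0.
have d2 : d <= pi / 2 by rewrite ge_min lexx orbT.
have de : d <= e by rewrite ge_min lexx.
near=> x.
have H : tan (pi / 2 - d) <= x by near: x; apply: nbhs_pinfty_ge; rewrite num_real.
have lt := atan_ltpi2 x; have gt := atan_gtNpi2 x.
rewrite ger0_norm ?subr_ge0 ?(ltW lt) // lerBlDr.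
apply: (@le_trans _ _ (d + atan x)); last by rewrite lerD2r.
rewrite -lerBlDl leNgt; apply/negP => H2.
have : tan (atan x) < tan (pi / 2 - d) by rewrite ltr_tan ?in_itv //=; lra.
by rewrite atanK; lra.
Unshelve. all: by end_near. Qed.

(** The primitive $\frac1\pi\arctan((e^{\pi x}-a)/b)$ starts from $-\frac1\pi\arctan(a/b)$, because
    [sx] vanishes at the left end, and ends at one half. *)
Lemma integral_pker a b : 0 < b -> rint (setT : set RT) (pker a b) /\
  \int[mu]_x pker a b x = 2^-1 + atan (a / b) / pi.
Proof.
move=> b0; have p0 := @pi_gt0 R.
have -> : 2^-1 + atan (a / b) / pi = pi^-1 * (pi / 2) - pi^-1 * atan ((0 - a) / b) :> R.
  rewrite sub0r mulNr atanN; move: (@pi R) p0 => q q0.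
  by field; rewrite gt_eqF.
apply: (@FTC_line _ _ (fun x => pi^-1 * atan ((sx x - a) / b))).
- exact: continuous_pker.
- by move=> x; apply/ltW/pker_gt0.
- move=> x; have := is_derive_sx x => dsx.
  have -> : (fun x => pi^-1 * atan ((sx x - a) / b)) =
    pi^-1 \*: (atan \o (b^-1 \*: (@sx R - cst a))).
    by apply/funext => t; rewrite !fctE /GRing.scale /= [_ / b]mulrC.
  apply: is_derive_eq; rewrite /GRing.scale /= !fctE /GRing.scale /= subr0 /pker.
  have d0 : 0 < (sx x - a) ^+ 2 + b ^+ 2 by rewrite ltr_wpDl ?sqr_ge0 // exprn_gt0.
  have -> : (b^-1 * (sx x - a)) ^+ 2 = (sx x - a) ^+ 2 / b ^+ 2 by rewrite exprMn exprVn mulrC.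
  move: (@pi R) p0 => q q0.
  by field; rewrite !gt_eqF //= addrC.
- apply: cvgM; first exact: cvg_cst.
  apply: (@continuous_cvg _ _ _ _ _ _ (@atan R)); first exact: continuous_atan.
  apply: cvgM; last exact: cvg_cst.
  by apply: cvgB; [exact: cvg_sx_ninfty|exact: cvg_cst].
- apply: cvgM; first exact: cvg_cst.
  apply: (@cvg_comp _ _ _ (fun x => (sx x - a) / b) (@atan R) _ +oo%R); last first.
    exact: cvg_atan_pinfty.
  apply/cvgryPge => A; near=> x; rewrite ler_pdivlMr // lerBrDr.
  near: x; have /cvgryPge := cvg_sx_pinfty; exact.
Unshelve. all: by end_near. Qed.

Lemma weight_pker x : weight x = pker 0 1 x.
Proof. by rewrite /weight /pker subr0 mul1r expr1n addrC. Qed.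

Lemma rint_weight : rint (setT : set RT) (@weight R).
Proof.
have [+ _] := @integral_pker 0 1 ltr01; apply: rint_eq => // x _.
by rewrite weight_pker.
Qed.

Lemma integral_pker_total a b : 0 < b ->
  \int[mu]_x pker a b x + \int[mu]_x pker (- a) b x = 1.
Proof.
move=> b0; rewrite !(integral_pker _ b0).2 mulNr atanN; lra.
Qed.

End KernelEstimates.

(** * Double integrals of continuous functions *)

Section PlaneIntegral.
Context {R : realType}.
Local Notation mu := (@lebesgue_measure R).
Local Notation RT := (measurableTypeR R).
Implicit Types (f : R * R -> R) (A B : set RT).

Definition cont2 f : Prop := forall p (e : R), 0 < e -> exists2 d : R, 0 < d &
  forall q, `|q.1 - p.1| < d -> `|q.2 - p.2| < d -> `|f q - f p| < e.

(** The sets where [f] exceeds a constant are open, hence countable unions of boxes with rational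
    centre and radius, and boxes are measurable for the product sigma-algebra. *)
Lemma cont2_measurable f : cont2 f ->
  measurable_fun (setT : set (RT * RT)%type) (f : RT * RT -> R).
Proof.
move=> cf mD; apply: (measurability _ (RGenOInfty.measurableE R)) => //.
move=> /= _ [_ [c ->] <-]; rewrite setTI.
set U := (X in measurable X).
pose box (q1 q2 r : rat) : set (RT * RT) :=
  `]ratr q1 - ratr r, ratr q1 + ratr r[%classic `*`
  `]ratr q2 - ratr r, ratr q2 + ratr r[%classic.
have -> : U = \bigcup_q1 \bigcup_q2 \bigcup_r
    (if `[< box q1 q2 r `<=` U >] then box q1 q2 r else set0).
  apply/seteqP; split => [[x y] Uxy|p [q1 _ [q2 _ [r _]]]]; last first.
    by case: asboolP => // H /H.
  have fc : 0 < f (x, y) - c.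
    by rewrite subr_gt0; move: Uxy; rewrite /U /= in_itv /= andbT.
  have [d d0 Hd] := cf (x, y) _ fc.
  have [r] : exists r : rat, ratr r \in `]0, d / 2[ by apply: rat_in_itvoo; rewrite divr_gt0.
  rewrite in_itv /= => /andP[r0 rd].
  have [q1] : exists q : rat, ratr q \in `]x - ratr r, x + ratr r[.
    by apply: rat_in_itvoo; lra.
  have [q2] : exists q : rat, ratr q \in `]y - ratr r, y + ratr r[.
    by apply: rat_in_itvoo; lra.
  rewrite !in_itv /= => /andP[h1 h2] /andP[h3 h4].
  exists q1 => //; exists q2 => //; exists r => //; rewrite asboolT.
    by split => /=; rewrite in_itv /=; lra.
  move=> [x' y'] [/=]; rewrite !in_itv /= => /andP[h5 h6] /andP[h7 h8].
  rewrite /U /= in_itv /= andbT.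
  have := Hd (x', y'); rewrite /= !ltr_norml => H.
  by have := H ltac:(lra) ltac:(lra); lra.
do 3![apply: bigcupT_measurable_rat => ?].
by case: asboolP => // _; apply: measurableX; exact: measurable_itv.
Qed.

Lemma tonelli_continuous f A B : cont2 f -> (forall p, 0 <= f p) ->
  measurable A -> measurable B ->
  (\int[mu]_(x in A) \int[mu]_(y in B) (f (x, y))%:E =
   \int[mu]_(y in B) \int[mu]_(x in A) (f (x, y))%:E)%E.
Proof.
move=> cf f0 mA mB.
pose g : RT * RT -> \bar R := (EFin \o f) \_ (A `*` B).
have mg : measurable_fun (setT : set (RT * RT)%type) g.
  apply/(measurable_restrictT (EFin \o f)); first exact: measurableX.
  by apply: measurable_funTS; apply/measurable_EFinP; exact: cont2_measurable.
have g0 p : (0 <= g p)%E.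
  by rewrite /g /patch; case: ifP => // _; rewrite lee_fin.
have := @fubini_tonelli _ _ _ _ _ mu mu g mg g0.
have -> : (\int[mu]_x \int[mu]_y g (x, y) = \int[mu]_(x in A) \int[mu]_(y in B) (f (x, y))%:E)%E.
  rewrite [RHS]integral_mkcond; apply: eq_integral => x _.
  rewrite /patch; case: ifPn => xA.
    rewrite [RHS]integral_mkcond; apply: eq_integral => y _.
    by rewrite /g /patch in_setX xA.
  by rewrite integral0_eq // => y _; rewrite /g /patch in_setX (negbTE xA).
have -> // : (\int[mu]_y \int[mu]_x g (x, y) = \int[mu]_(y in B) \int[mu]_(x in A) (f (x, y))%:E)%E.
rewrite [RHS]integral_mkcond; apply: eq_integral => y _.
rewrite /patch; case: ifPn => yB.
  rewrite [RHS]integral_mkcond; apply: eq_integral => x _.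
  by rewrite /g /patch in_setX yB andbT.
by rewrite integral0_eq // => x _; rewrite /g /patch in_setX (negbTE yB) andbF.
Qed.

(** If the integrals along all the segments over [A] exceeded [e], the double integral would be
    infinite, whereas Tonelli bounds it by $(b-a)M$. This takes the place of a decay estimate when
    vertical sides are chosen far out. *)
Lemma small_section f A (a b M e : R) : cont2 f -> (forall p, 0 <= f p) ->
  measurable A -> mu A = +oo%E -> 0 < e -> a <= b ->
  (forall y, a <= y <= b -> (\int[mu]_(x in A) (f (x, y))%:E <= M%:E)%E) ->
  exists2 x, A x & \int[mu]_(y in `[a, b]) f (x, y) <= e.
Proof.
move=> cf f0 mA Aoo e0 ab fM.
apply: contrapT => H.
have ify x : rint (`[a, b] : set RT) (fun y => f (x, y)).
  apply: continuous_rint => y _; apply/cvgrPdist_lt => e' e'0.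
  have [d d0 Hd] := cf (x, y) _ e'0; apply/nbhs_ballP; exists d => //= t.
  rewrite /ball /= => yt; rewrite distrC; apply: Hd; rewrite /= ?subrr ?normr0 //.
  by rewrite distrC.
have H1 x : A x -> (e%:E <= \int[mu]_(y in `[a, b]) (f (x, y))%:E)%E.
  move=> Ax; rewrite -[X in (_ <= X)%E]fineK; last first.
    by apply: integrable_fin_num => //; exact: ify.
  by rewrite lee_fin leNgt; apply/negP => /ltW H2; apply: H; exists x.
have mF : measurable_fun A (fun x => \int[mu]_(y in `[a, b]) (f (x, y))%:E)%E.
  apply: measurable_funTS.
  pose g : RT * RT -> \bar R := (EFin \o f) \_ (setT `*` `[a, b]).
  have mg : measurable_fun (setT : set (RT * RT)%type) g.
    apply/(measurable_restrictT (EFin \o f)); first exact: measurableX.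
    by apply: measurable_funTS; apply/measurable_EFinP; exact: cont2_measurable.
  have g0 p : (0 <= g p)%E.
    by rewrite /g /patch; case: ifP => // _; rewrite lee_fin.
  have := @measurable_fun_fubini_tonelli_F _ _ _ _ _ mu g mg g0.
  apply: eq_measurable_fun => x _; rewrite [RHS]integral_mkcond.
  by apply: eq_integral => y _; rewrite /g /patch in_setX in_setT.
have : (e%:E * mu A <= ((b - a) * M)%:E)%E.
  rewrite -integral_cst //; apply: (@le_trans _ _
    (\int[mu]_(x in A) \int[mu]_(y in `[a, b]) (f (x, y))%:E)%E).
    apply: ge0_le_integral => //.
    by move=> x _; rewrite lee_fin ltW.
  rewrite tonelli_continuous //.
  apply: (@le_trans _ _ (\int[mu]_(y in `[a, b]) (cst M%:E) y)%E).
    apply: ge0_le_integral => //.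
    - by move=> y _; apply: integral_ge0 => x _; rewrite lee_fin.
    - apply: measurable_funTS.
      pose g : RT * RT -> \bar R := (EFin \o f) \_ (A `*` setT).
      have mg : measurable_fun (setT : set (RT * RT)%type) g.
        apply/(measurable_restrictT (EFin \o f)); first exact: measurableX.
        by apply: measurable_funTS; apply/measurable_EFinP; exact: cont2_measurable.
      have g0 p : (0 <= g p)%E.
        by rewrite /g /patch; case: ifP => // _; rewrite lee_fin.
      have := @measurable_fun_fubini_tonelli_G _ _ _ _ _ mu g mg g0.
      apply: eq_measurable_fun => y _; rewrite [RHS]integral_mkcond.
      by apply: eq_integral => x _; rewrite /g /patch in_setX in_setT andbT.
  rewrite integral_cst //= lebesgue_measure_itv /= lte_fin.
  case: ltP => [_|ba]; first by rewrite -EFinB -EFinM lee_fin mulrC.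
  have -> : b = a by apply/eqP; rewrite eq_le ba ab.
  by rewrite subrr mul0r mule0.
by rewrite Aoo gt0_muley ?lte_fin.
Qed.

End PlaneIntegral.

(** * Cauchy's theorem for the kernel times the damped function *)

Section StripCauchy.
Context {R : realType}.
Local Notation mu := (@lebesgue_measure R).
Local Notation RT := (measurableTypeR R).
Implicit Types (x y : R) (z u : R[i]) (h G : R[i] -> R[i]).

(** At horizontal distance at least 1 the moduli of the two values differ by a factor of at least
    $e^{\pi}$, so they are separated at all heights. *)
Lemma wexp_gap_far (z0 : R[i]) : exists2 c : R, 0 < c & forall x y,
  1 <= `|x - complex.Re z0| -> c * (1 + sx x) <= normc (wexp (x +i* y) - wexp z0).
Proof.
case: z0 => x0 y0 /=; have s0 := sx_gt0 x0; have p0 := @pi_gt0 R.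
pose q := expR (- pi : R).
have q1 : q < 1 by rewrite expR_lt1; lra.
have q0 : 0 < q by exact: expR_gt0.
pose m := Num.min 1 (sx x0).
have m0 : 0 < m by rewrite lt_min ltr01.
have m1 : m <= 1 by rewrite ge_min lexx.
have m2 : m <= sx x0 by rewrite ge_min lexx orbT.
exists ((1 - q) / 2 * m); first by rewrite mulr_gt0 // divr_gt0 //; lra.
move=> x y xx0; have s1 := sx_gt0 x.
have N (t s : R) : normc (wexp (t +i* s)) = sx t.
  by rewrite wexp_cexp normc_cexp ReM /= mul0r subr0.
have far (t s : R) : s + 1 <= t -> sx s <= q * sx t.
  by move=> ts; rewrite /sx /q -expRD ler_expR; nra.
have H1 : sx x - sx x0 <= normc (wexp (x +i* y) - wexp (x0 +i* y0)).
  by rewrite -(N x y) -(N x0 y0); exact: lerB_normc.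
have H2 : sx x0 - sx x <= normc (wexp (x +i* y) - wexp (x0 +i* y0)).
  by rewrite normcBC -(N x y) -(N x0 y0); exact: lerB_normc.
have key : (1 - q) / 2 * m * (1 + sx x) <= (1 - q) / 2 * (sx x0 + sx x).
  rewrite -mulrA ler_pM2l ?divr_gt0 ?subr_gt0 //; nra.
apply: le_trans key _.
have [xle|xge] : x0 + 1 <= x \/ x + 1 <= x0.
- by move: xx0; case: (leP x0 x) => xx; [rewrite ger0_norm; lra|rewrite ler0_norm; lra].
- by have := far _ _ xle; nra.
- by have := far _ _ xge; nra.
Qed.

Definition strip_holo h : Prop := forall x y, 0 < y < 1 -> cdiff h (x +i* y).

(* The Poisson kernels of the strip are comparable to [weight]. *)
Definition weighted_bound h (M : R) : Prop := forall y, 0 < y < 1 ->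
  (\int[mu]_x (normc (h (x +i* y)) * weight x)%:E <= M%:E)%E.

Lemma cmeas_line h y : strip_holo h -> 0 < y < 1 ->
  cmeas (setT : set RT) (fun x => h (x +i* y)).
Proof.
by move=> hh y01; apply: ccont_cmeas => x; apply: cdiff_ccont_h; exact: hh.
Qed.

Lemma measurable_weight : measurable_fun (setT : set RT) (@weight R).
Proof. exact: rint_measurable rint_weight. Qed.

Lemma weighted_bound_rint h M y : strip_holo h -> weighted_bound h M -> 0 < y < 1 ->
  rint (setT : set RT) (fun x => normc (h (x +i* y)) * weight x) /\
  \int[mu]_x (normc (h (x +i* y)) * weight x) <= M.
Proof.
move=> hh hM y01.
have m1 : measurable_fun (setT : set RT) (fun x => normc (h (x +i* y)) * weight x).
  by apply: measurable_funM; [apply: cmeas_normc; exact: cmeas_line|exact: measurable_weight].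
have i1 : rint (setT : set RT) (fun x => normc (h (x +i* y)) * weight x).
  apply/integrableP; split; first exact/measurable_EFinP.
  apply: (@le_lt_trans _ _ M%:E); last exact: ltry.
  apply: le_trans (hM _ y01); rewrite le_eqVlt; apply/orP; left; apply/eqP.
  apply: eq_integral => x _ /=.
  by rewrite ger0_norm // mulr_ge0 ?normc_ge0 ?weight_ge0.
split => //; rewrite -lee_fin /Rintegral fineK; first exact: hM.
by apply: integrable_fin_num.
Qed.

(** The two ends of the truncation vary independently, because the left and right sides of the
    rectangles are chosen separately. *)
Lemma cintegrable_limit g (e : R) : cintegrable (setT : set RT) g -> 0 < e ->
  exists N : R, forall X X', N <= X -> N <= X' ->
    normc (cintegral setT g - cintegral `[- X', X] g) <= e.
Proof.
move=> ig e0; have ng := cintegrable_normc (@measurableT _ RT) ig.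
have := integrable_limit_itv ng => /cvgrPdist_le /(_ e e0)[N _ HN].
exists N%:R => X X' XN XN'; have {}HN := HN N (leqnn N).
have X0 : - X' <= X.
  have : (0 : R) <= N%:R by [].
  by lra.
have sub : `[- N%:R, N%:R] `<=` (`[- X', X] : set R).
  by apply: subset_itv; rewrite bnd_simp //; lra.
have mX : measurable (`[- X', X] : set RT) by exact: measurable_itv.
have mC : measurable (~` `[- X', X] : set RT) by exact: measurableC.
have mN : measurable (~` `[- N%:R, N%:R] : set RT) by apply: measurableC; exact: measurable_itv.
have iC : cintegrable (~` `[- X', X] : set RT) g.
  by case: ig => i1 i2; split; apply: (rint_sub _ _ _ i1) || apply: (rint_sub _ _ _ i2).
have RU (v : R -> R) (D : set RT) : measurable D -> rint (setT : set RT) v ->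
    \int[mu]_x v x = \int[mu]_(x in D) v x + \int[mu]_(x in ~` D) v x.
  move=> mD iv; rewrite -Rintegral_setU ?setUv //.
  - exact: measurableC.
  - by apply/disj_setPS => t [].
have -> : cintegral setT g - cintegral `[- X', X] g = cintegral (~` `[- X', X]) g.
  case: ig => i1 i2; rewrite /cintegral (RU _ _ mX i1) (RU _ _ mX i2).
  by apply: eq_ReIm => /=; ring.
apply: le_trans (normc_cintegral mC iC) _.
apply: (@le_trans _ _ (\int[mu]_(x in ~` `[- N%:R, N%:R]) normc (g x))); last first.
  apply: le_trans HN; rewrite (RU _ _ (measurable_itv `[- N%:R, N%:R]) ng).
  by rewrite addrAC subrr add0r ler_norm.
have -> : \int[mu]_(x in ~` `[- X', X]) normc (g x) =
   \int[mu]_(x in ~` `[- N%:R, N%:R]) ((fun x => normc (g x)) \_ (~` `[- X', X])) x.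
  rewrite -Rintegral_mkcondr setIidr //.
  exact: subsetC.
apply: ler_Rint => //.
- apply: rint_le (rint_sub _ mN _ ng) => //.
    apply: measurable_funTS; apply/(measurable_restrictT (fun x => normc (g x))) => //.
    by apply: measurable_funTS; exact: (rint_measurable ng).
  by move=> x _; rewrite /patch; case: ifP; rewrite ?normr0 ?normc_ge0 // ger0_norm ?normc_ge0.
- exact: rint_sub ng.
- by move=> x _; rewrite /patch; case: ifP; rewrite ?normc_ge0.
Qed.

Variables (h : R[i] -> R[i]) (M : R) (p : {poly R[i]}) (z0 : R[i]).
Hypotheses (hh : strip_holo h) (hM : weighted_bound h M) (z01 : 0 < complex.Im z0 < 1).
Local Notation w := (wexp z0).

Definition damped z : R[i] := h z * cexp (- p.[zeta w z]).
(** Subtracting the value at [z0] cancels the simple pole of [ker], so the singularity is removable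
    and all rectangle integrals vanish. The residue is recovered afterwards from the total mass of
    the kernel. *)
Definition residue_fun z : R[i] := ker w z * (damped z - damped z0).

Let w0 : 0 < complex.Im w := Im_wexp_gt0 z01.

Lemma cdiff_damped x y : 0 < y < 1 -> cdiff damped (x +i* y).
Proof.
move=> y01; apply: cdiffM; first exact: hh.
by apply: cdiff_cexp_horner => //=; lra.
Qed.

Lemma cdiff_residue_fun x y : 0 < y < 1 -> x +i* y != z0 ->
  cdiff residue_fun (x +i* y).
Proof.
move=> y01 ne; apply: cdiffM.
  apply: cdiff_ker => //=; first by lra.
  apply/eqP => E; move/eqP: ne; apply; apply: wexp_inj_strip E => /=; first by lra.
  by move: z01 => /andP[? ?]; apply/andP; split; lra.
by apply: cdiffB; [exact: cdiff_damped|exact: cdiff_cst].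
Qed.

(** The numerator is $O(|z-z_0|)$ by differentiability of [damped]. In the denominator one factor is
    at least a multiple of $|z-z_0|$ by [wexp_near], the other at least the imaginary part of
    [wexp z0]. *)
Lemma residue_fun_bounded : exists2 r : R, 0 < r & exists2 K : R, 0 <= K &
  forall x y, `|x - complex.Re z0| <= r -> `|y - complex.Im z0| <= r ->
    x +i* y != z0 -> normc (residue_fun (x +i* y)) <= K.
Proof.
have [l Hl] : cdiff damped z0 by move: z01; case: (z0) => *; exact: cdiff_damped.
have [d d0 Hd] := Hl 1 ltr01; have p0 := @pi_gt0 R.
have /andP[za zb] := z01.
pose m := normc w * pi / 4.
have m0 : 0 < m.
  rewrite divr_gt0 // mulr_gt0 // normc_gt0; apply/eqP => E.
  by move: w0; rewrite E ltxx.
(* Increments have modulus at most [2 * r]. The first term puts them inside the radius [d] of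
   differentiability, the second in the range of [wexp_near], and the third keeps the heights in the
   strip. *)
pose r := Num.min (Num.min (d / 4) ((4 * pi)^-1 / 2)) (Num.min (complex.Im z0) (1 - complex.Im z0) / 2).
have m4 : 0 < (4 * pi)^-1 :> R by rewrite invr_gt0 mulr_gt0.
have r0 : 0 < r.
  by rewrite !lt_min !divr_gt0 //= lt_min; lra.
have [rd rp ry] : [/\ r <= d / 4, r <= (4 * pi)^-1 / 2 &
    r <= Num.min (complex.Im z0) (1 - complex.Im z0) / 2].
  by rewrite /r !ge_min !lexx !orbT.
pose S := sx (complex.Re z0 + r).
have S0 : 0 <= S by exact/ltW/sx_gt0.
have L0 : 0 <= 1 + normc l by rewrite addr_ge0 ?normc_ge0.
exists r => //; exists (S / m * (1 + normc l)); first by rewrite mulr_ge0 // divr_ge0 // ltW.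
move=> x y xr yr ne; set u := x +i* y - z0.
have uE : x +i* y = z0 + u by rewrite /u; ring.
have ur : normc u <= 2 * r.
  apply: le_trans (ler_normc_ReIm _) _; rewrite /u !(ReB, ImB) /=; lra.
have u0 : 0 < normc u by rewrite normc_gt0 subr_eq0.
have y01 : 0 <= y <= 1.
  move: ry; rewrite ler_pdivlMr // le_min => /andP[h1 h2].
  by move: yr; rewrite ler_norml; lra.
have H1 : normc (damped (x +i* y) - damped z0) <= (1 + normc l) * normc u.
  have := Hd u; rewrite mul1r -uE => H; have {}H := H ltac:(lra).
  have := ler_normcD (damped (x +i* y) - damped z0 - l * u) (l * u).
  by rewrite subrK normcM mulrDl mul1r => H2; lra.
have H2 : m * normc u <= normc (wexp (x +i* y) - w).
  by rewrite uE; apply: wexp_near; lra.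
have H3 : complex.Im w <= normc (wexp (x +i* y) - w^*%C).
  apply: le_trans (ler_Im_normc _); apply: le_trans (ler_norm _).
  have := Im_wexp_ge0 x y01; rewrite ImB.
  have -> : complex.Im (w^*)%C = - complex.Im w by case: (w).
  lra.
have H4 : normc (wexp (x +i* y)) <= S.
  rewrite wexp_cexp normc_cexp ReM /= mul0r subr0 ler_expR ler_pM2l //.
  by move: xr; rewrite ler_norml; lra.
rewrite /residue_fun kerE !normcM normcV normcM normc_real (gtr0_norm w0).
have m1 : 0 < normc (wexp (x +i* y) - w) by apply: lt_le_trans H2; rewrite mulr_gt0.
have m2 : 0 < normc (wexp (x +i* y) - w^*%C) by apply: lt_le_trans H3.
move: (normc (wexp (x +i* y) - w)) (normc (wexp (x +i* y) - w^*%C)) (normc (wexp (x +i* y)))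
  (normc_ge0 (wexp (x +i* y))) H2 H3 H4 m1 m2 => A B W W0 H2 H3 H4 A0 B0.
move: (complex.Im w) w0 H3 => v v0 H3; clearbody m S.
have -> : S / m * (1 + normc l) = (v * S) / (m * normc u * v) *
    ((1 + normc l) * normc u).
  by field; rewrite !gt_eqF.
have vW : 0 <= v * W by rewrite mulr_ge0 // ltW.
have AB : 0 <= (A * B)^-1 by rewrite invr_ge0 mulr_ge0 // ltW.
have mu0 : 0 < m * normc u by rewrite mulr_gt0.
apply: ler_pM H1; [exact: mulr_ge0|exact: normc_ge0|].
apply: ler_pM => //; first by rewrite ler_pM2l.
rewrite lef_pV2 ?posrE; [|exact: mulr_gt0|exact: mulr_gt0].
by apply: ler_pM => //; exact: ltW.
Qed.

Lemma rectint_residue_fun a b c d : a < complex.Re z0 < b -> 0 < c < complex.Im z0 ->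
  complex.Im z0 < d < 1 -> rectint residue_fun a b c d = 0.
Proof.
move=> hx hc hd; have [r r0 [K K0 HK]] := residue_fun_bounded.
have ne x y : (x != complex.Re z0) || (y != complex.Im z0) -> x +i* y != z0.
  by move=> H; apply/eqP => E; move: H; rewrite -E /= !eqxx.
have hy : c < complex.Im z0 < d by lra.
apply: (@goursat_removable _ _ _ _ _ _ _ _ r K hx hy _ r0 K0).
  by move=> x y hx' hy' ne'; apply: cdiff_residue_fun; [lra|exact: ne].
by move=> x y hx' hy' ne'; apply: HK => //; exact: ne.
Qed.

Lemma damped_weight : exists2 C : R, 0 <= C & forall x y, 0 < y < 1 ->
  normc (damped (x +i* y)) <= C * normc (h (x +i* y)).
Proof.
have [K K0 HK] := horner_bounded p.
exists (expR K); first exact: expR_ge0.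
move=> x y y01; rewrite /damped normcM mulrC ler_wpM2r ?normc_ge0 //.
rewrite normc_cexp ler_expR; apply: le_trans (ler_norm _) _.
apply: le_trans (ler_Re_normc _) _; rewrite normcN HK // normc_zeta_le1 //=; lra.
Qed.

Lemma residue_fun_le_of_ker (c : R) x y : 0 < y < 1 -> 0 <= c ->
  normc (ker w (x +i* y)) <= c * weight x ->
  forall C, 0 <= C -> normc (damped (x +i* y)) <= C * normc (h (x +i* y)) ->
  normc (residue_fun (x +i* y)) <= c * C * (normc (h (x +i* y)) * weight x) +
     c * normc (damped z0) * weight x.
Proof.
move=> y01 c0 k1 C C0 k2; rewrite /residue_fun normcM.
have := ler_normcB (damped (x +i* y)) (damped z0) => k3.
have := normc_ge0 (ker w (x +i* y)); have W0 := weight_ge0 x.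
have := normc_ge0 (damped z0); have := normc_ge0 (damped (x +i* y)).
move=> d1 d2 k0; apply: (@le_trans _ _ (c * weight x * (C * normc (h (x +i* y)) + normc (damped z0)))).
  by apply: ler_pM; rewrite ?normc_ge0 //; lra.
by rewrite le_eqVlt; apply/orP; left; apply/eqP; ring.
Qed.

End StripCauchy.

Section Clamping.
Context {R : realType}.
Implicit Types (c x y : R).

Lemma max_lipschitz c x y : `|Num.max c x - Num.max c y| <= `|x - y|.
Proof.
have := normr_ge0 (x - y); have := ler_norm (x - y); have := ler_norm (y - x).
rewrite (distrC y x) => h1 h2 h3.
case: (leP c x) => h4; case: (leP c y) => h5; rewrite ler_norml; lra.
Qed.

Lemma min_lipschitz c x y : `|Num.min c x - Num.min c y| <= `|x - y|.
Proof.
have := normr_ge0 (x - y); have := ler_norm (x - y); have := ler_norm (y - x).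
rewrite (distrC y x) => h1 h2 h3.
case: (leP c x) => h4; case: (leP c y) => h5; rewrite ler_norml; lra.
Qed.

Lemma measure_ge_infty c : lebesgue_measure `[c, +oo[ = +oo%E.
Proof. by rewrite lebesgue_measure_itv /= ltry. Qed.

Lemma measure_le_infty c : lebesgue_measure `]-oo, c] = +oo%E.
Proof. by rewrite lebesgue_measure_itv /= ltNyr. Qed.

End Clamping.

Section StripIdentity.
Context {R : realType}.
Local Notation mu := (@lebesgue_measure R).
Local Notation RT := (measurableTypeR R).
Implicit Types (x y : R) (z u : R[i]).
Variables (h : R[i] -> R[i]) (M : R) (p : {poly R[i]}) (z0 : R[i]).
Hypotheses (hh : strip_holo h) (hM : weighted_bound h M) (z01 : 0 < complex.Im z0 < 1).
Local Notation w := (wexp z0).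
Local Notation G := (residue_fun h p z0).

Lemma normc_sub_ge (u v : R[i]) : `|normc u - normc v| <= normc (u - v).
Proof.
rewrite ler_norml; have := lerB_normc u v; have := lerB_normc v u.
by rewrite (normcBC v u) => *; apply/andP; split; lra.
Qed.

(** [cont2] asks for continuity on the whole plane, while [residue_fun] is continuous only in the
    strip away from [z0]. The Lipschitz maps [a] and [b], in practice maxima and minima with
    constants, keep the point in that region. *)
Lemma cont2_residue_fun (a b : R -> R) :
  (forall x x', `|a x - a x'| <= `|x - x'|) ->
  (forall x x', `|b x - b x'| <= `|x - x'|) ->
  (forall x, 1 <= `|a x - complex.Re z0|) -> (forall y, 0 < b y < 1) ->
  cont2 (fun q => normc (G (a q.1 +i* b q.2))).
Proof.
move=> La Lb Ha Hb [x y] e e0 /=.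
have ne : a x +i* b y != z0.
  apply/eqP => E; have := Ha x; rewrite -E /= subrr normr0; lra.
have [d d0 Hd] := cdiff_continuous (cdiff_residue_fun p hh z01 (Hb y) ne) e0.
exists (d / 2); first by rewrite divr_gt0.
move=> [x' y'] /= xx yy; apply: le_lt_trans (normc_sub_ge _ _) _.
have -> : a x' +i* b y' = a x +i* b y + (a x' - a x) +i* (b y' - b y).
  by apply: eq_ReIm => /=; ring.
apply: Hd; apply: le_lt_trans (ler_normc_ReIm _) _ => /=.
by have := La x' x; have := Lb y' y; lra.
Qed.

(** On [A], at horizontal distance at least 1 from [z0], the kernel is at most a multiple of
    [weight]. By [weighted_bound] the integral of [normc G] over [A] is then bounded uniformly in
    the height, and [small_section] applies because [A] has infinite measure. *)
Lemma vertical_side_small (a : R -> R) (A : set RT) (d1 d2 e : R) :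
  (forall x x', `|a x - a x'| <= `|x - x'|) ->
  (forall x, 1 <= `|a x - complex.Re z0|) ->
  measurable A -> mu A = +oo%E -> (forall x, A x -> a x = x) ->
  0 < d1 -> d1 <= d2 -> d2 < 1 -> 0 < e ->
  exists2 x, A x & \int[mu]_(y in `[d1, d2]) normc (G (x +i* y)) <= e.
Proof.
move=> La Ha mA Aoo aA d10 d12 d21 e0.
pose b y := Num.max d1 (Num.min d2 y).
have b01 y : 0 < b y < 1.
  by rewrite /b lt_max d10 /= gt_max gt_min d21 (le_lt_trans d12 d21).
have bE y : d1 <= y <= d2 -> b y = y.
  by move=> /andP[h1 h2]; rewrite /b min_r // max_r.
have Lb x x' : `|b x - b x'| <= `|x - x'|.
  exact: le_trans (max_lipschitz _ _ _) (min_lipschitz _ _ _).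
have cf := cont2_residue_fun La Lb Ha b01.
pose f (q : R * R) : R := normc (G (a q.1 +i* b q.2)).
have [c c0 Hc] := wexp_gap_far z0.
have w0 := Im_wexp_gt0 z01.
pose k := complex.Im w * c ^- 2.
have k0 : 0 <= k by rewrite /k mulr_ge0 ?(ltW w0) ?invr_ge0 ?exprn_ge0 ?(ltW c0).
have [C C0 HC] := damped_weight h p z01.
pose K1 := k * C; pose K2 := k * normc (damped h p z0 z0).
have K10 : 0 <= K1 by exact: mulr_ge0.
have K20 : 0 <= K2 by apply: mulr_ge0 => //; exact: normc_ge0.
have fA x y : A x -> d1 <= y <= d2 -> f (x, y) = normc (G (x +i* y)).
  by move=> Ax hy; rewrite /f /= aA // bE.
have [x Ax Hx] : exists2 x, A x & \int[mu]_(y in `[d1, d2]) f (x, y) <= e.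
  apply: (@small_section _ f A d1 d2 (K1 * M + K2 * \int[mu]_x weight x) e) => //.
    by move=> q; exact: normc_ge0.
  move=> y hy; have y01 : 0 < y < 1 by lra.
  have [i1 I1] := weighted_bound_rint hh hM y01.
  pose u x := K1 * (normc (h (x +i* y)) * weight x) + K2 * weight x.
  have iu : rint (setT : set RT) u.
    by apply: rintD => //; apply: rintZ => //; exact: rint_weight.
  have u0 x : 0 <= u x.
    by rewrite addr_ge0 // mulr_ge0 ?weight_ge0 // mulr_ge0 ?weight_ge0 // normc_ge0.
  apply: (@le_trans _ _ (\int[mu]_(x in A) (u x)%:E)%E).
    apply: ge0_le_integral => //.
    - by move=> x _; rewrite lee_fin normc_ge0.
    - apply: measurable_funTS; apply/measurable_EFinP.
      apply: continuous_measurable_fun => x; apply/cvgrPdist_lt => e' e'0.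
      have [d d0 Hd] := cf (x, y) _ e'0; apply/nbhs_ballP; exists d => //= t.
      rewrite /ball /= => xt; rewrite distrC; apply: Hd; rewrite /= ?subrr ?normr0 //.
      by rewrite distrC.
    - by apply: measurable_funTS; apply/measurable_EFinP; exact: rint_measurable iu.
    - move=> x Ax; rewrite lee_fin fA //.
      rewrite /u /K1 /K2; apply: residue_fun_le_of_ker => //; last exact: HC.
      by apply: ker_bound => //; [lra|apply: Hc; rewrite -(aA _ Ax)].
  apply: (@le_trans _ _ (\int[mu]_x (u x)%:E)%E).
    apply: ge0_subset_integral => //.
    - by apply/measurable_EFinP; exact: rint_measurable iu.
    - by move=> x _; rewrite lee_fin.
  rewrite -[leLHS]fineK; last by apply: integrable_fin_num.
  rewrite lee_fin -/(Rintegral mu setT u) RintegralD //; last 2 first.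
  - exact: rintZ.
  - by apply: rintZ => //; exact: rint_weight.
  rewrite !RintegralZl //; last exact: rint_weight.
  by rewrite lerD2r ler_wpM2l.
exists x => //; apply: le_trans Hx; rewrite le_eqVlt; apply/orP; left; apply/eqP.
by apply: eq_Rint => y; rewrite /= in_itv /= => hy; rewrite fA.
Qed.

Lemma residue_line_integrable y : 0 < y < 1 -> y != complex.Im z0 ->
  cintegrable (setT : set RT) (fun x => G (x +i* y)).
Proof.
move=> y01 yz; have w0 := Im_wexp_gt0 z01.
have e0 : 0 < `|y - complex.Im z0| by rewrite normr_gt0 subr_eq0.
have [c c0 Hc] := wexp_gap z01 e0.
pose k := complex.Im w * c ^- 2.
have k0 : 0 <= k by rewrite /k mulr_ge0 ?(ltW w0) ?invr_ge0 ?exprn_ge0 ?(ltW c0).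
have [C C0 HC] := damped_weight h p z01.
have [i1 I1] := weighted_bound_rint hh hM y01.
apply: (@cintegrable_le _ _ _ (fun x => k * C * (normc (h (x +i* y)) * weight x) +
    k * normc (damped h p z0 z0) * weight x)).
- exact: measurableT.
- apply: ccont_cmeas => x; apply: cdiff_ccont_h; apply: cdiff_residue_fun => //.
  by apply/eqP => E; move: yz; rewrite -E /= eqxx.
- move=> x _; apply: residue_fun_le_of_ker => //; last exact: HC.
  by apply: ker_bound => //; [lra|apply: Hc => //; lra].
- by apply: rintD => //; apply: rintZ => //; exact: rint_weight.
Qed.

Theorem residue_line_eq (d1 d2 : R) : 0 < d1 -> d1 < complex.Im z0 ->
  complex.Im z0 < d2 -> d2 < 1 ->
  cintegral setT (fun x => G (x +i* d1)) = cintegral setT (fun x => G (x +i* d2)).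
Proof.
move=> d10 d1z zd2 d21.
have i1 : cintegrable (setT : set RT) (fun x => G (x +i* d1)).
  by apply: residue_line_integrable; [lra|rewrite lt_eqF].
have i2 : cintegrable (setT : set RT) (fun x => G (x +i* d2)).
  by apply: residue_line_integrable; [lra|rewrite gt_eqF].
apply/eqP; rewrite -subr_eq0 -normc_eq0 eq_le normc_ge0 andbT -cintegralB //.
apply/ler_addgt0Pr => e e0; rewrite add0r.
have e3 : 0 < e / 3 by rewrite divr_gt0.
have i12 := cintegrableB (@measurableT _ RT) i1 i2.
have [N HN] := cintegrable_limit i12 e3.
have p0 := @pi_gt0 R.
(* Beyond [N] the truncation error is small; the second threshold gives the horizontal distance 1
   from [z0]. The left side is found symmetrically. *)
have [X /= XN HX] : exists2 X, `[Num.max N (complex.Re z0 + 1), +oo[%classic X &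
    \int[mu]_(y in `[d1, d2]) normc (G (X +i* y)) <= e / 3.
  apply: (@vertical_side_small (Num.max (complex.Re z0 + 1))) => //.
  - exact: max_lipschitz.
  - move=> x; apply: le_trans (ler_norm _); rewrite lerBrDl le_max; apply/orP; left.
    by rewrite lexx.
  - exact: measure_ge_infty.
  - by move=> x /=; rewrite in_itv /= andbT ge_max => /andP[_ ?]; rewrite max_r.
  - exact: ltW (lt_trans d1z zd2).
have [X' /= XN' HX'] : exists2 X, `]-oo, Num.min (- N) (complex.Re z0 - 1)]%classic X &
    \int[mu]_(y in `[d1, d2]) normc (G (X +i* y)) <= e / 3.
  apply: (@vertical_side_small (Num.min (complex.Re z0 - 1))) => //.
  - exact: min_lipschitz.
  - move=> x; rewrite distrC; apply: le_trans (ler_norm _).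
    by rewrite lerBrDr -lerBrDl ge_min lexx.
  - exact: measure_le_infty.
  - by move=> x /=; rewrite in_itv /= le_min => /andP[_ ?]; rewrite min_r.
  - exact: ltW (lt_trans d1z zd2).
move: XN XN'; rewrite !in_itv /= andbT ge_max le_min => /andP[XN Xz] /andP[XN' Xz'].
have NX' : N <= - X' by lra.
have := HN X (- X') XN NX'; rewrite opprK.
have R0 : rectint G X' X d1 d2 = 0.
  by apply: rectint_residue_fun => //; lra.
move: R0 => /eqP; rewrite /rectint addr_eq0 => /eqP ->.
have side (x : R) : x != complex.Re z0 ->
    cintegrable (`[d1, d2] : set RT) (fun y => G (x +i* y)).
  move=> xz; apply: cint_v => y hy; apply: cdiff_residue_fun => //; first by lra.
  by apply/eqP => E; move: xz; rewrite -E /= eqxx.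
have sX : cintegrable (`[d1, d2] : set RT) (fun y => G (X +i* y)).
  by apply: side; rewrite gt_eqF //; lra.
have sX' : cintegrable (`[d1, d2] : set RT) (fun y => G (X' +i* y)).
  by apply: side; rewrite lt_eqF //; lra.
rewrite (cintegralB _ sX sX') // opprK => H.
set I := cintegral setT _ in H; suff : normc I <= e by [].
set S := 'i%C * _ in H.
have -> : I = (I + S) - S by ring.
apply: le_trans (ler_normcB _ _) _.
have : normc S <= e / 3 + e / 3.
  rewrite /S normcM normc_i mul1r; apply: le_trans (ler_normcB _ _) _.
  by apply: lerD; [apply: le_trans HX|apply: le_trans HX']; exact: normc_cintegral.
lra.
Qed.

End StripIdentity.

(** * Representation of the value at a point by boundary limits *)

Section StripRepresentation.
Context {R : realType}.
Local Notation mu := (@lebesgue_measure R).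
Local Notation RT := (measurableTypeR R).
Implicit Types (x y t e : R) (z u : R[i]).

Lemma eq_le_trans (a b c : R) : a = b -> b <= c -> a <= c.
Proof. by move=> ->. Qed.

(** Bookkeeping for [strip_representation], one index per boundary line. [X] is the integral of [h]
    times [phi] at a nearby height, [Y] that of the bare kernel; in [P] the test function of [X] is
    moved to the line, and [L] is the limit of [P]; [A] is the signed mass of the kernel on the
    line. [D] is [damped] at [z0]. *)
Lemma approx_residue (D A0 A1 X0 X1 Y0 Y1 P0 P1 L0 L1 : R[i]) (e d C0 C1 B0 B1 : R) :
  A0 - A1 = 1 -> X0 - D * Y0 = X1 - D * Y1 ->
  normc (X0 - P0) <= C0 * d -> normc (X1 - P1) <= C1 * d ->
  normc (Y0 - A0) <= B0 * d -> normc (Y1 - A1) <= B1 * d ->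
  normc (P0 - L0) <= e / 4 -> normc (P1 - L1) <= e / 4 ->
  0 <= d -> (1 + C0 + C1 + normc D * (B0 + B1)) * d <= e / 4 ->
  normc (D - (L0 - L1)) <= e.
Proof.
move=> T E s1 s2 s3 s4 s5 s6 d0 Kd.
have -> : D - (L0 - L1) = (X0 - P0) + (P0 - L0) - (X1 - P1) - (P1 - L1)
   - D * (Y0 - A0) + D * (Y1 - A1).
  have -> : X0 - P0 + (P0 - L0) - (X1 - P1) - (P1 - L1) - D * (Y0 - A0) + D * (Y1 - A1) =
    (X0 - D * Y0) - (X1 - D * Y1) + D * (A0 - A1) - (L0 - L1) by ring.
  by rewrite T E; ring.
have n1 : normc (D * (Y0 - A0)) <= normc D * (B0 * d).
  by rewrite normcM ler_wpM2l ?normc_ge0.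
have n2 : normc (D * (Y1 - A1)) <= normc D * (B1 * d).
  by rewrite normcM ler_wpM2l ?normc_ge0.
move: (X0 - P0) (P0 - L0) (X1 - P1) (P1 - L1) (D * (Y0 - A0)) (D * (Y1 - A1))
  s1 s2 s5 s6 n1 n2 => a b c f g i s1 s2 s5 s6 n1 n2.
have h1 := ler_normcD (a + b - c - f - g) i; have h2 := ler_normcB (a + b - c - f) g.
have h3 := ler_normcB (a + b - c) f; have h4 := ler_normcB (a + b) c.
have h5 := ler_normcD a b.
have u : (1 + C0 + C1 + normc D * (B0 + B1)) * d =
  d + C0 * d + C1 * d + normc D * (B0 * d) + normc D * (B1 * d) by ring.
rewrite u in Kd; have e0 := le_trans (normc_ge0 b) s5; clear u.
have H := le_trans h1 (lerD (le_trans h2 (lerD (le_trans h3 (lerD (le_trans h4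
  (lerD h5 (lexx _))) (lexx _))) (lexx _))) (lexx _)).
apply: (le_trans H); clear H h1 h2 h3 h4 h5.
have H := lerD (lerD (lerD (lerD (lerD s1 s5) s2) s6) n1) n2.
apply: (le_trans H); clear H s1 s5 s2 s6 n1 n2.
lra.
Qed.

Lemma small_height (t K e r0 r1 : R) : 0 < t < 1 -> 0 < K -> 0 < e -> 0 < r0 -> 0 < r1 ->
  exists d, [/\ 0 < d, d < t, t < 1 - d, 0 < d < 1 & 0 < 1 - d < 1] /\
    [/\ d <= r0, d <= r1, d <= Num.min t (1 - t) / 2 & K * d <= e].
Proof.
move=> t01 K0 e0 r00 r10.
pose d := Num.min (Num.min r0 r1) (Num.min (Num.min t (1 - t) / 4) (e / K)).
have d0 : 0 < d.
  by rewrite /d !lt_min r00 r10 (divr_gt0 e0 K0) divr_gt0 // lt_min; lra.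
have [dr0 dr1 dg dK] : [/\ d <= r0, d <= r1, d <= Num.min t (1 - t) / 4 & d <= e / K].
  by rewrite /d !ge_min !lexx !orbT.
exists d; clearbody d.
have m1 : Num.min t (1 - t) <= t by rewrite ge_min lexx.
have m2 : Num.min t (1 - t) <= 1 - t by rewrite ge_min lexx orbT.
have m0 : 0 < Num.min t (1 - t) by rewrite lt_min; lra.
move: (Num.min t (1 - t)) m0 m1 m2 dg => m m0 m1 m2 dg.
rewrite ler_pdivlMr // mulrC in dK.
by split; split => //; lra.
Qed.

Lemma cdiff_phi (z0 : R[i]) p z : 0 < complex.Im z0 < 1 -> 0 <= complex.Im z <= 1 ->
  z != z0 -> cdiff (phi (wexp z0) p) z.
Proof.
move=> z01 z1 ne; have w0 := Im_wexp_gt0 z01.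
have -> : phi (wexp z0) p = fun z => ker (wexp z0) z * cexp (- p.[zeta (wexp z0) z]).
  by apply/funext => u; exact: phiE.
apply: cdiffM; last exact: cdiff_cexp_horner.
apply: cdiff_ker => //; apply/eqP => E; move/eqP: ne; apply.
apply: wexp_inj_strip E => //; move: z01 => /andP[? ?]; apply/andP; split; exact: ltW.
Qed.

Lemma Rint0 (D : set RT) : \int[mu]_(x in D) (0 : R) = 0.
Proof. by rewrite /Rintegral integral0. Qed.

Lemma phi0 w z : phi w 0 z = ker w z.
Proof. by rewrite phiE horner0 oppr0 cexp0 mulr1. Qed.

Lemma phi_line_cmeas (z0 : R[i]) p t : 0 < complex.Im z0 < 1 -> 0 <= t <= 1 ->
  t != complex.Im z0 -> cmeas (setT : set RT) (fun x => phi (wexp z0) p (x +i* t)).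
Proof.
move=> z01 t01 tz; apply: ccont_cmeas => x; apply: cdiff_ccont_h.
by apply: cdiff_phi => //; apply/eqP => E; move: tz; rewrite -E /= eqxx.
Qed.

Lemma cmeasM (D : set RT) (f g : R -> R[i]) : measurable D -> cmeas D f -> cmeas D g ->
  cmeas D (fun x => f x * g x).
Proof.
move=> mD [f1 f2] [g1 g2]; split.
  under eq_fun do rewrite ReM.
  by apply: measurable_funB; exact: measurable_funM.
under eq_fun do rewrite ImM.
by apply: measurable_funD; exact: measurable_funM.
Qed.

Lemma cmeasB (D : set RT) (f g : R -> R[i]) : measurable D -> cmeas D f -> cmeas D g ->
  cmeas D (fun x => f x - g x).
Proof.
move=> mD [f1 f2] [g1 g2]; split.
  by under eq_fun do rewrite ReB; exact: measurable_funB.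
by under eq_fun do rewrite ImB; exact: measurable_funB.
Qed.

Lemma phi_line_bound (z0 : R[i]) p t : 0 < complex.Im z0 < 1 -> 0 <= t <= 1 ->
  t != complex.Im z0 -> exists2 C : R, 0 <= C & forall x,
    normc (phi (wexp z0) p (x +i* t)) <= C * weight x.
Proof.
move=> z01 t01 tz; have e0 : 0 < `|t - complex.Im z0| by rewrite normr_gt0 subr_eq0.
have [C C0 HC] := phi_estimates p z01 e0.
by exists C => // x; have [] := HC x t t t01 t01 (lexx _) (lexx _).
Qed.

Variables (h : R[i] -> R[i]) (M : R) (p : {poly R[i]}) (z0 : R[i]).
Hypotheses (hh : strip_holo h) (hM : weighted_bound h M) (z01 : 0 < complex.Im z0 < 1).
Local Notation w := (wexp z0).

Lemma cintegrable_line_phi q y t : 0 < y < 1 -> 0 <= t <= 1 -> t != complex.Im z0 ->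
  cintegrable (setT : set RT) (fun x => h (x +i* y) * phi w q (x +i* t)).
Proof.
move=> y01 t01 tz; have [C C0 HC] := phi_line_bound q z01 t01 tz.
have [i1 _] := weighted_bound_rint hh hM y01.
apply: (@cintegrable_le _ _ _ (fun x => C * (normc (h (x +i* y)) * weight x))) => //.
- by apply: cmeasM; [exact: measurableT|exact: cmeas_line|exact: phi_line_cmeas].
- move=> x _; rewrite normcM [leRHS]mulrCA.
  by apply: ler_wpM2l; [exact: normc_ge0|exact: HC].
- exact: rintZ.
Qed.

Lemma cintegrable_phi q t : 0 <= t <= 1 -> t != complex.Im z0 ->
  cintegrable (setT : set RT) (fun x => phi w q (x +i* t)).
Proof.
move=> t01 tz; have [C C0 HC] := phi_line_bound q z01 t01 tz.
apply: (@cintegrable_le _ _ _ (fun x => C * weight x)).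
- exact: measurableT.
- exact: phi_line_cmeas.
- by move=> x _; exact: HC.
- by apply: rintZ; [exact: measurableT|exact: rint_weight].
Qed.

(** Half the distance from [z0] to the boundary: a height within this gap of a boundary line is
    still at least the same gap away from [z0] ([far_from_z0]). *)
Definition height_gap : R := Num.min (complex.Im z0) (1 - complex.Im z0) / 2.

Lemma height_gap_gt0 : 0 < height_gap.
Proof. by move: z01 => /andP[? ?]; rewrite divr_gt0 // lt_min subr_gt0; apply/andP. Qed.

Lemma far_from_z0 j y : j = 0 \/ j = 1 -> 0 <= y <= 1 -> `|y - j| <= height_gap ->
  height_gap <= `|y - complex.Im z0|.
Proof.
have h1 : 2 * height_gap <= complex.Im z0 by rewrite mulrC divfK // ge_min lexx.
have h2 : 2 * height_gap <= 1 - complex.Im z0 by rewrite mulrC divfK // ge_min lexx orbT.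
move=> [->|->] y01; rewrite ler_norml => H.
  by rewrite distrC; apply: le_trans (ler_norm _); lra.
by apply: le_trans (ler_norm _); lra.
Qed.

(** Tempered convergence tests [h] against a fixed function, whereas Cauchy's theorem yields a
    kernel at the same height as [h]. The exchange costs $O(|y-j|)$, because the Lipschitz bound of
    [phi_estimates] carries [weight], against which the modulus of [h] has bounded integrals. *)
Lemma line_phi_shift q j : j = 0 \/ j = 1 -> exists2 C : R, 0 <= C &
  forall y, 0 < y < 1 -> `|y - j| <= height_gap ->
    normc (cintegral setT (fun x => h (x +i* y) * phi w q (x +i* y)) -
           cintegral setT (fun x => h (x +i* y) * phi w q (x +i* j))) <= C * `|y - j| /\
    normc (cintegral setT (fun x => phi w q (x +i* y)) -
           cintegral setT (fun x => phi w q (x +i* j))) <= C * `|y - j|.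
Proof.
move=> hj; have g0 := height_gap_gt0.
have [C C0 HC] := phi_estimates q z01 g0.
have j01 : 0 <= j <= 1 by case: hj => ->; rewrite lexx ler01.
have fj : height_gap <= `|j - complex.Im z0|.
  by apply: (far_from_z0 hj) => //; rewrite subrr normr0 ltW.
have ne (t : R) : height_gap <= `|t - complex.Im z0| -> t != complex.Im z0.
  by move=> H; apply/eqP => E; move: H; rewrite E subrr normr0 leNgt g0.
have rw := @rint_weight R; have mT := @measurableT _ RT.
have I0 : 0 <= \int[mu]_x weight x by apply: Rintegral_ge0 => x _; exact: weight_ge0.
have M0 : 0 <= M.
  have h2 : 0 < (2^-1 : R) < 1 by lra.
  have [_] := weighted_bound_rint hh hM h2; apply: le_trans.
  by apply: Rintegral_ge0 => x _; rewrite mulr_ge0 ?normc_ge0 ?weight_ge0.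
exists (C * (M + \int[mu]_x weight x)); first by rewrite mulr_ge0 // addr_ge0.
move=> y y01 yj; have y01' : 0 <= y <= 1 by lra.
have fy := far_from_z0 hj y01' yj.
have K x := (HC x y j y01' j01 fy fj).2.
have [i1 I1] := weighted_bound_rint hh hM y01.
have Cy : 0 <= C * `|y - j| by rewrite mulr_ge0.
split.
  rewrite -cintegralB //; [|apply: cintegrable_line_phi => //; exact: ne..].
  apply: le_trans (@normc_cintegral_le _ _ _
     (fun x => C * `|y - j| * (normc (h (x +i* y)) * weight x)) _ _ _ _) _.
  - exact: measurableT.
  - by apply: cmeasB; [exact: measurableT|apply: cmeasM..]; try exact: measurableT;
      try exact: cmeas_line; apply: phi_line_cmeas => //; exact: ne.
  - move=> x _; rewrite -mulrBr normcM [leRHS]mulrCA.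
    by apply: ler_wpM2l; [exact: normc_ge0|exact: K].
  - exact: rintZ.
  rewrite RintegralZl // mulrAC ler_wpM2r // ler_wpM2l //.
  by apply: le_trans I1 _; rewrite lerDl.
rewrite -cintegralB //; [|apply: cintegrable_phi => //; exact: ne..].
apply: le_trans (@normc_cintegral_le _ _ _ (fun x => C * `|y - j| * weight x) _ _ _ _) _.
- exact: measurableT.
- by apply: cmeasB; [exact: measurableT|apply: phi_line_cmeas => //; exact: ne..].
- by move=> x _; exact: K.
- exact: rintZ.
by rewrite RintegralZl // mulrAC ler_wpM2r // ler_wpM2l // lerDr.
Qed.

(** The kernel is negative on the upper line, so the difference is a sum of two Poisson masses, that
    is, the total harmonic measure. *)
Lemma cintegral_ker_total :
  cintegral setT (fun x => phi w 0 (x +i* 0)) - cintegral setT (fun x => phi w 0 (x +i* 1)) = 1.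
Proof.
have w0 := Im_wexp_gt0 z01.
have [ia _] := integral_pker (complex.Re w) w0.
have [ib _] := integral_pker (- complex.Re w) w0.
have -> : cintegral setT (fun x => phi w 0 (x +i* 0)) =
    (\int[mu]_x pker (complex.Re w) (complex.Im w) x)%:C.
  apply: eq_ReIm => /=; first by apply: eq_Rint => x _; rewrite phi0 ker_line0.
  under eq_Rintegral do rewrite phi0 ker_line0 //=.
  exact: Rint0.
have -> : cintegral setT (fun x => phi w 0 (x +i* 1)) =
    (- \int[mu]_x pker (- complex.Re w) (complex.Im w) x)%:C.
  apply: eq_ReIm => /=.
    rewrite -mulN1r -RintegralZl //; apply: eq_Rint => x _.
    by rewrite phi0 ker_line1 // mulN1r.
  under eq_Rintegral do rewrite phi0 ker_line1 //=.
  exact: Rint0.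
by rewrite -rmorphB opprK integral_pker_total.
Qed.

Lemma residue_line_split y : 0 < y < 1 -> y != complex.Im z0 ->
  cintegral setT (fun x => residue_fun h p z0 (x +i* y)) =
  cintegral setT (fun x => h (x +i* y) * phi w p (x +i* y)) -
  damped h p z0 z0 * cintegral setT (fun x => phi w 0 (x +i* y)).
Proof.
move=> y01 yz; have y01' : 0 <= y <= 1 by move: y01 => /andP[? ?]; rewrite !ltW.
have i0 := cintegrable_phi 0 y01' yz.
have i1 := cintegrable_line_phi p y01 y01' yz.
rewrite -(cintegralZ _ _ i0) // -(cintegralB _ i1) //; last exact: cintegrableZ.
apply: eq_cintegral => x _; rewrite phi0 /residue_fun.
by rewrite {1}/damped phiE; ring.
Qed.

Definition line_limit (j : R) (u : R -> R -> R[i]) (L : R[i]) : Prop :=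
  forall e, 0 < e -> exists2 d, 0 < d & forall y, 0 < y < 1 -> `|y - j| <= d ->
    normc (cintegral setT (u y) - L) <= e.

(** [residue_line_eq] reads $X_0-DY_0=X_1-DY_1$ for a line near each boundary. As the lines approach
    the boundary, $X_j$ tends to $L_j$ and $Y_0-Y_1$ to 1. Since [zeta] vanishes at [z0], $D$ is the
    left-hand side. *)
Theorem strip_representation (L0 L1 : R[i]) :
  line_limit 0 (fun y x => h (x +i* y) * phi w p (x +i* 0)) L0 ->
  line_limit 1 (fun y x => h (x +i* y) * phi w p (x +i* 1)) L1 ->
  h z0 * cexp (- p.[0]) = L0 - L1.
Proof.
move=> H0 H1; have g0 := height_gap_gt0.
pose D := damped h p z0 z0.
have -> : h z0 * cexp (- p.[0]) = D by rewrite /D /damped zetaE subrr mul0r.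
have [C0 C00 HC0] := line_phi_shift p (or_introl (erefl 0)).
have [C1 C10 HC1] := line_phi_shift p (or_intror (erefl 1)).
have [B0 B00 HB0] := line_phi_shift 0 (or_introl (erefl 0)).
have [B1 B10 HB1] := line_phi_shift 0 (or_intror (erefl 1)).
apply/eqP; rewrite -subr_eq0 -normc_eq0 eq_le normc_ge0 andbT.
apply/ler_addgt0Pr => e e0; rewrite add0r.
have e4 : 0 < e / 4 by rewrite divr_gt0.
have [r0 r00 Hr0] := H0 _ e4; have [r1 r10 Hr1] := H1 _ e4.
pose K := 1 + C0 + C1 + normc D * (B0 + B1).
have K0 : 0 < K.
  have DB : 0 <= normc D * (B0 + B1) by rewrite mulr_ge0 ?normc_ge0 ?addr_ge0.
  by rewrite /K ltr_pwDl // ltr_pwDl // ltr_pwDl.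
have [d [[d0 dz zd d1 d2] [dr0 dr1 dg dK]]] := small_height z01 K0 e4 r00 r10.
have ad : `|d - 0| = d by rewrite subr0 ger0_norm // ltW.
have a1d : `|1 - d - 1| = d by rewrite addrAC subrr add0r normrN ger0_norm // ltW.
have E := residue_line_eq p hh hM z01 d0 dz zd (andP d2).2.
rewrite !(@residue_line_split d) ?(@residue_line_split (1 - d)) // ?(lt_eqF dz) ?(gt_eqF zd) // in E.
have s1 := (HC0 d d1 (eq_le_trans ad dg)).1.
have s3 := (HC1 _ d2 (eq_le_trans a1d dg)).1.
have s5 := (HB0 d d1 (eq_le_trans ad dg)).2.
have s6 := (HB1 _ d2 (eq_le_trans a1d dg)).2.
have s7 := Hr0 d d1 (eq_le_trans ad dr0).
have s8 := Hr1 _ d2 (eq_le_trans a1d dr1).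
rewrite ad in s1 s5; rewrite a1d in s3 s6.
exact: (approx_residue cintegral_ker_total E s1 s3 s5 s6 s7 s8 (ltW d0) dK).
Qed.

End StripRepresentation.

(** * Boundary values tested on Schwartz functions *)

Section SchwartzKernels.
Context {R : realType}.
Local Notation RT := (measurableTypeR R).
Implicit Types (x : R) (f g : R -> R).

(** [weight x] is at most $e^{-\pi|x|}\le e^{-|x|}$, and $|x|^m\le m!\,e^{|x|}$ by the exponential
    series. *)
Lemma weight_decay m x : `|x| ^+ m * weight x <= m`!%:R.
Proof.
have p0 := @pi_ge2 R; have s0 := sx_gt0 x.
have w1 : weight x <= expR (- `|x|).
  apply: (@le_trans _ _ (expR (- (pi * `|x|)))); last first.
    by rewrite ler_expR lerN2 ler_peMl //; lra.
  rewrite /weight; have h0 : 0 < 1 + sx x ^+ 2 by have := sqr_ge0 (sx x); lra.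
  rewrite ler_pdivrMr //; case: (leP 0 x) => x0.
    rewrite (ger0_norm x0) expRN -/(sx x) mulrDr mulr1 expr2 mulrA mulVf ?gt_eqF // mul1r.
    by rewrite lerDr invr_ge0 ltW.
  rewrite (ltr0_norm x0) mulrN opprK -/(sx x); nra.
have fm : (1 : R) <= m`!%:R by rewrite ler1n fact_gt0.
have w2 : `|x| ^+ m <= m`!%:R * expR `|x|.
  case: m fm => [|m] fm; first by rewrite fact0 expr0 mul1r -expR0 ler_expR.
  have := expR_ge1Dxn m (normr_ge0 x); rewrite -ler_pdivrMl ?(lt_le_trans ltr01) //.
  by rewrite mulrC; lra.
apply: (@le_trans _ _ (m`!%:R * expR `|x| * expR (- `|x|))).
  by apply: ler_pM => //; rewrite ?exprn_ge0 ?weight_ge0.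
by rewrite -mulrA expRxMexpNx_1 mulr1.
Qed.

Variables (a b s : R).
Hypothesis b0 : 0 < b.

(** For [s] equal to 1 or -1, [s * sx x] is the value of [wexp] on a boundary line. With $w=a+ib$,
    [lineK] is then [ker w] on that line, and [lineX], [lineY] are the real and imaginary parts of
    [zeta w] ([ker_line_real]). *)
Definition lineD x := (s * sx x - a) ^+ 2 + b ^+ 2.
Definition lineK x := b * s * sx x / lineD x.
Definition lineX x := ((s * sx x - a) ^+ 2 - b ^+ 2) / lineD x.
Definition lineY x := - (2 * b * (s * sx x - a)) / lineD x.

Lemma lineD_gt0 x : 0 < lineD x.
Proof. by rewrite ltr_wpDl ?sqr_ge0 // exprn_gt0. Qed.

Lemma is_derive_lineS x : is_derive x (1 : R) (fun x => s * sx x - a) (pi * (s * sx x)).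
Proof.
have dsx := is_derive_sx x.
apply: (is_derive_eq (is_deriveB (is_deriveZ s dsx) (is_derive_cst a x (1 : R)))).
by rewrite /GRing.scale /= subr0 mulrCA.
Qed.

Lemma is_derive_lineDV x : is_derive x (1 : R) (fun x => (lineD x)^-1)
  (- (2 * (s * sx x - a) * (pi * (s * sx x))) / lineD x ^+ 2).
Proof.
have D0 := lineD_gt0 x; have dS := is_derive_lineS x.
have dD : is_derive x (1 : R) lineD (2 * (s * sx x - a) * (pi * (s * sx x))).
  have -> : lineD = (fun x => s * sx x - a) * (fun x => s * sx x - a) + cst (b ^+ 2).
    by apply/funext => t.
  apply: (is_derive_eq (is_deriveD (is_deriveM dS dS) (is_derive_cst (b ^+ 2) x (1 : R)))).
  rewrite addr0 /GRing.scale /=; move: (pi * _) => q.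
  by ring.
have H := is_deriveV (lt0r_neq0 D0) dD.
apply: (is_derive_eq H); rewrite /GRing.scale /= -exprVn.
by move: (_ ^-1) => t; ring.
Qed.

Lemma is_derive_lineK x : is_derive x (1 : R) lineK
  (lineK x * (pi / b * (a * lineY x - b * lineX x))).
Proof.
have dsx := is_derive_sx x; have D0 := lineD_gt0 x; have dV := is_derive_lineDV x.
apply: (is_derive_eq (is_deriveM (is_deriveZ (b * s) dsx) dV)).
rewrite /lineK /lineX /lineY; have -> : ((b * s) \*: @sx R) x = b * s * sx x by [].
rewrite /GRing.scale /=.
have DE : lineD x = (s * sx x - a) ^+ 2 + b ^+ 2 by [].
move: (sx x) (@pi R) (lineD x) DE D0 => t q D DE D0.
suff : (D * b * t - b * (2 * (s * t - a) * (s * t)) * t) =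
  t * (a * - (2 * b * (s * t - a)) - b * ((s * t - a) ^+ 2 - b ^+ 2)).
  move=> E; have b1 : b != 0 by exact: lt0r_neq0.
  have D1 : D != 0 by exact: lt0r_neq0.
  transitivity (q * s * (D * b * t - b * (2 * (s * t - a) * (s * t)) * t) / D ^+ 2).
    by field.
  by rewrite E; field; rewrite b1 D1.
by rewrite DE; ring.
Qed.

Lemma is_derive_lineX x : is_derive x (1 : R) lineX (- (2 * pi) * (lineK x * lineY x)).
Proof.
have dS := is_derive_lineS x; have D0 := lineD_gt0 x; have dV := is_derive_lineDV x.
have -> : lineX = ((fun x => s * sx x - a) * (fun x => s * sx x - a) - cst (b ^+ 2)) *
  (fun x => (lineD x)^-1) by apply/funext => t.
apply: (is_derive_eq (is_deriveM (is_deriveB (is_deriveM dS dS)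
  (is_derive_cst (b ^+ 2) x (1 : R))) dV)).
rewrite !fctE /GRing.scale /= /lineK /lineY.
have DE : lineD x = (s * sx x - a) ^+ 2 + b ^+ 2 by [].
move: (sx x) (@pi R) (lineD x) DE D0 => t q D DE D0.
have D1 : D != 0 by exact: lt0r_neq0.
transitivity (2 * q * (s * t) * (s * t - a) * (D - ((s * t - a) ^+ 2 - b ^+ 2)) / D ^+ 2).
  by field.
by rewrite {1}DE; field.
Qed.

Lemma is_derive_lineY x : is_derive x (1 : R) lineY (2 * pi * (lineK x * lineX x)).
Proof.
have dS := is_derive_lineS x; have D0 := lineD_gt0 x; have dV := is_derive_lineDV x.
have -> : lineY = (cst (- (2 * b)) * (fun x => s * sx x - a)) * (fun x => (lineD x)^-1).
  by apply/funext => t; rewrite /lineY -mulNr.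
apply: (is_derive_eq (is_deriveM (is_deriveM (is_derive_cst (- (2 * b)) x (1 : R)) dS) dV)).
rewrite !fctE /GRing.scale /= /lineK /lineX.
have DE : lineD x = (s * sx x - a) ^+ 2 + b ^+ 2 by [].
move: (sx x) (@pi R) (lineD x) DE D0 => t q D DE D0.
have D1 : D != 0 by exact: lt0r_neq0.
transitivity (2 * q * b * (s * t) * (2 * (s * t - a) ^+ 2 - D) / D ^+ 2).
  by field.
by rewrite {1}DE; field.
Qed.

(* An algebra of bounded functions, stable under differentiation. *)
Inductive line_alg : (R -> R) -> Prop :=
| line_cst c : line_alg (fun=> c)
| line_K : line_alg lineK
| line_X : line_alg lineX
| line_Y : line_alg lineY
| line_add f g : line_alg f -> line_alg g -> line_alg (fun x => f x + g x)
| line_mul f g : line_alg f -> line_alg g -> line_alg (fun x => f x * g x)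
| line_exp f : line_alg f -> line_alg (fun x => expR (f x))
| line_cos f : line_alg f -> line_alg (fun x => cos (f x))
| line_sin f : line_alg f -> line_alg (fun x => sin (f x)).

Lemma line_opp f : line_alg f -> line_alg (fun x => - f x).
Proof.
by move=> /(line_mul (line_cst (-1))); congr line_alg; apply/funext => x; rewrite mulN1r.
Qed.

Lemma line_alg_derive f : line_alg f -> exists2 g, line_alg g &
  forall x, is_derive x (1 : R) f (g x).
Proof.
elim=> {f}.
- by move=> c; exists (fun=> 0); [exact: line_cst|move=> x; exact: is_derive_cst].
- exists (fun x => lineK x * (pi / b * (a * lineY x + - (b * lineX x)))).
    apply: line_mul; first exact: line_K.
    apply: line_mul; first exact: line_cst.
    apply: line_add; first by apply: line_mul; [exact: line_cst|exact: line_Y].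
    by apply: line_opp; apply: line_mul; [exact: line_cst|exact: line_X].
  exact: is_derive_lineK.
- exists (fun x => - (2 * pi) * (lineK x * lineY x)); last exact: is_derive_lineX.
  by apply: line_mul; [exact: line_cst|apply: line_mul; [exact: line_K|exact: line_Y]].
- exists (fun x => 2 * pi * (lineK x * lineX x)); last exact: is_derive_lineY.
  by apply: line_mul; [exact: line_cst|apply: line_mul; [exact: line_K|exact: line_X]].
- move=> f g lf [f' lf' df] lg [g' lg' dg].
  by exists (fun x => f' x + g' x); [exact: line_add|move=> x; exact: is_deriveD].
- move=> f g lf [f' lf' df] lg [g' lg' dg].
  exists (fun x => f x * g' x + g x * f' x).
    by apply: line_add; exact: line_mul.
  by move=> x; exact: is_deriveM.
- move=> f lf [f' lf' df]; exists (fun x => expR (f x) * f' x).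
    by apply: line_mul => //; exact: line_exp.
  by move=> x; exact: (is_derive1_comp (is_derive_expR (f x)) (df x)).
- move=> f lf [f' lf' df]; exists (fun x => - sin (f x) * f' x).
    by apply: line_mul => //; apply: line_opp; exact: line_sin.
  by move=> x; exact: (is_derive1_comp (is_derive_cos (f x)) (df x)).
- move=> f lf [f' lf' df]; exists (fun x => cos (f x) * f' x).
    by apply: line_mul => //; exact: line_cos.
  by move=> x; exact: (is_derive1_comp (is_derive_sin (f x)) (df x)).
Qed.

Hypothesis K_le : exists2 C : R, 0 <= C & forall x, `|lineK x| <= C * weight x.

Lemma line_alg_bounded f : line_alg f -> exists2 C : R, 0 <= C & forall x, `|f x| <= C.
Proof.
elim=> {f}.
- by move=> c; exists `|c|.
- have [C C0 HC] := K_le; exists C => // x; apply: le_trans (HC x) _.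
  have := weight_decay 0 x; rewrite expr0 mul1r fact0 => H.
  by rewrite ler_piMr.
- exists 1 => // x; have D0 := lineD_gt0 x.
  rewrite normrM normfV (gtr0_norm D0) ler_pdivrMr // mul1r /lineD.
  have := sqr_ge0 (s * sx x - a); have := sqr_ge0 b.
  by rewrite ler_norml => *; apply/andP; split; lra.
- exists 1 => // x; have D0 := lineD_gt0 x.
  rewrite normrM normfV (gtr0_norm D0) ler_pdivrMr // mul1r normrN /lineD.
  have := sqr_ge0 (s * sx x - a - b); have := sqr_ge0 (s * sx x - a + b).
  by rewrite ler_norml => *; apply/andP; split; lra.
- move=> f g _ [C C0 HC] _ [D D0 HD]; exists (C + D); first exact: addr_ge0.
  by move=> x; apply: le_trans (ler_normD _ _) _; exact: lerD.
- move=> f g _ [C C0 HC] _ [D D0 HD]; exists (C * D); first exact: mulr_ge0.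
  by move=> x; rewrite normrM ler_pM.
- move=> f _ [C C0 HC]; exists (expR C); first exact: expR_ge0.
  move=> x; rewrite (ger0_norm (expR_ge0 _)) ler_expR.
  by apply: le_trans (ler_norm _) (HC x).
- by move=> f _ _; exists 1 => // x; exact: cos_max.
- by move=> f _ _; exists 1 => // x; exact: sin_max.
Qed.

(** Every derivative keeps the factor [lineK]. Its exponential decay handles the powers of [x] in
    the Schwartz seminorms, so the cofactor only has to be bounded. *)
Lemma derive1n_lineK n f : line_alg f -> exists2 g, line_alg g &
  derive1n n (fun x => lineK x * f x) = (fun x => lineK x * g x).
Proof.
elim: n f => [|n IH] f lf; first by exists f.
have [g lg E] := IH f lf; have [g' lg' dg] := line_alg_derive lg.
have [k lk dk] := line_alg_derive line_K.
exists (fun x => pi / b * (a * lineY x - b * lineX x) * g x + g' x).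
  apply: line_add => //; apply: line_mul => //.
  apply: line_mul; first exact: line_cst.
  apply: line_add; first by apply: line_mul; [exact: line_cst|exact: line_Y].
  by apply: line_opp; apply: line_mul; [exact: line_cst|exact: line_X].
rewrite derive1nS E; apply/funext => x.
have dK := is_derive_lineK x; have dgx := dg x.
rewrite derive1E; have := is_deriveM dK dgx => H.
rewrite (@derive_val _ _ _ _ _ _ _ H) /GRing.scale /=; ring.
Qed.

Lemma schwartz_lineK f : line_alg f -> schwartz_real (fun x => lineK x * f x).
Proof.
move=> lf; split=> [n x|m n].
  have [g lg ->] := derive1n_lineK n lf; have [g' lg' dg] := line_alg_derive lg.
  have dK := is_derive_lineK x; have dgx := dg x.
  by have H := is_deriveM dK dgx; exact: (@ex_derive _ _ _ _ _ _ _ H).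
have [g lg ->] := derive1n_lineK n lf.
have [C C0 HC] := K_le; have [D D0 HD] := line_alg_bounded lg.
exists (m`!%:R * (C * D)) => x; rewrite normrM normrX (normrM (lineK x)).
apply: (@le_trans _ _ (`|x| ^+ m * ((C * weight x) * D))).
  by rewrite ler_wpM2l ?exprn_ge0 // ler_pM.
have -> : `|x| ^+ m * (C * weight x * D) = `|x| ^+ m * weight x * (C * D) by ring.
by rewrite ler_wpM2r ?mulr_ge0 // weight_decay.
Qed.

Lemma line_alg_horner (p : {poly R[i]}) :
  line_alg (fun x => complex.Re p.[lineX x +i* lineY x]) /\
  line_alg (fun x => complex.Im p.[lineX x +i* lineY x]).
Proof.
elim/poly_ind : p => [|p c [IH1 IH2]].
  by split; under eq_fun do rewrite horner0 /=; exact: line_cst.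
split; under eq_fun do rewrite hornerMXaddC ?ReD ?ImD ?ReM ?ImM /=.
  apply: line_add; last exact: line_cst.
  apply: line_add; first by apply: line_mul => //; exact: line_X.
  by apply: line_opp; apply: line_mul => //; exact: line_Y.
apply: line_add; last exact: line_cst.
apply: line_add; first by apply: line_mul => //; exact: line_Y.
by apply: line_mul => //; exact: line_X.
Qed.

Lemma schwartz_line (p : {poly R[i]}) :
  schwartz (fun x => (lineK x)%:C * cexp (- p.[lineX x +i* lineY x])).
Proof.
have [h1 h2] := line_alg_horner p; have n1 := line_opp h1; have n2 := line_opp h2.
split.
  have -> : (fun x => complex.Re ((lineK x)%:C * cexp (- p.[lineX x +i* lineY x]))) =
    fun x => lineK x * (expR (- complex.Re p.[lineX x +i* lineY x]) *
      cos (- complex.Im p.[lineX x +i* lineY x])).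
    by apply/funext => x; rewrite ReM /= mul0r subr0 Re_cexp ReN ImN.
  by apply: schwartz_lineK; apply: line_mul; [exact: line_exp|exact: line_cos].
have -> : (fun x => complex.Im ((lineK x)%:C * cexp (- p.[lineX x +i* lineY x]))) =
  fun x => lineK x * (expR (- complex.Re p.[lineX x +i* lineY x]) *
    sin (- complex.Im p.[lineX x +i* lineY x])).
  by apply/funext => x; rewrite ImM /= mul0r addr0 Im_cexp ReN ImN.
by apply: schwartz_lineK; apply: line_mul; [exact: line_exp|exact: line_sin].
Qed.

End SchwartzKernels.

Section SchwartzPhi.
Context {R : realType}.
Implicit Types (z : R[i]) (p : {poly R[i]}).

Lemma ker_line_real (w : R[i]) (s : R) x y : 0 < complex.Im w ->
  wexp (x +i* y) = (s * sx x)%:C ->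
  ker w (x +i* y) = (lineK (complex.Re w) (complex.Im w) s x)%:C /\
  zeta w (x +i* y) = lineX (complex.Re w) (complex.Im w) s x +i*
    lineY (complex.Re w) (complex.Im w) s x.
Proof.
move=> w0 E; have D0 := lineD_gt0 (complex.Re w) s w0 x.
split.
  rewrite kerE E normc_conj_mul -rmorphM -rmorphXn -!rmorphM.
  rewrite -rmorphB -rmorphD -fmorphV -rmorphM; congr (_%:C); rewrite /lineK /lineD.
  by congr (_ / _); ring.
rewrite zetaE E; move: D0; rewrite /lineX /lineY /lineD.
case: w w0 {E} => a b /= b0 D0; set t := s * sx x in D0 *.
have E : t%:C - a +i* (- b) = (t - a) +i* b by apply: eq_ReIm => /=; ring.
have ne : t%:C - a +i* (- b) != 0.
  by rewrite E; apply/eqP => -[_ b1]; rewrite b1 ltxx in b0.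
apply: (mulIf ne); rewrite divfK // E.
have d1 : (t - a) ^+ 2 + b ^+ 2 != 0 by exact: lt0r_neq0.
by apply: eq_ReIm => /=; field.
Qed.

Lemma schwartz_phi z p (j s : R) : 0 < complex.Im z < 1 -> 0 <= j <= 1 ->
  j != complex.Im z -> (forall x, wexp (x +i* j) = (s * sx x)%:C) ->
  schwartz (fun x => phi (wexp z) p (x +i* j)).
Proof.
move=> z01 j01 jz H; have w0 := Im_wexp_gt0 z01.
have -> : (fun x => phi (wexp z) p (x +i* j)) =
  fun x => (lineK (complex.Re (wexp z)) (complex.Im (wexp z)) s x)%:C *
   cexp (- p.[lineX (complex.Re (wexp z)) (complex.Im (wexp z)) s x +i*
     lineY (complex.Re (wexp z)) (complex.Im (wexp z)) s x]).
  by apply/funext => x; have [k1 k2] := ker_line_real w0 (H x); rewrite phiE k1 k2.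
apply: schwartz_line => //.
have [C C0 HC] := phi_line_bound 0 z01 j01 jz; exists C => // x.
by have [k1 k2] := ker_line_real w0 (H x); have := HC x; rewrite phi0 k1 normc_real.
Qed.

Lemma schwartz_phi0 z p : 0 < complex.Im z < 1 ->
  schwartz (fun x => phi (wexp z) p (x +i* 0)).
Proof.
move=> z01; apply: (schwartz_phi p (s := 1)) => //; rewrite ?lexx ?ler01 //.
  by move: z01 => /andP[+ _]; move/lt_eqF ->.
by move=> x; rewrite wexp_line0 mul1r.
Qed.

Lemma schwartz_phi1 z p : 0 < complex.Im z < 1 ->
  schwartz (fun x => phi (wexp z) p (x +i* 1)).
Proof.
move=> z01; apply: (schwartz_phi p (s := -1)) => //; rewrite ?lexx ?ler01 //.
  by move: z01 => /andP[_ +]; move/gt_eqF ->.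
by move=> x; rewrite wexp_line1 mulN1r.
Qed.

End SchwartzPhi.

(** * Harmonic approximation from above *)

Section BernsteinApproximation.
Context {R : realType}.
Implicit Types (x a s : R) (g : nat -> R).

(* [(bernstein n g).[x]] is the expectation of [g] at a binomial variable of
   parameters [n] and [x]. *)
Fixpoint bernstein n g : {poly R} :=
  if n is n'.+1 then (1 - 'X) * bernstein n' g + 'X * bernstein n' (fun k => g k.+1)
  else (g 0%N)%:P.

Lemma bernstein_le n g g' x : 0 <= x <= 1 -> (forall k, g k <= g' k) ->
  (bernstein n g).[x] <= (bernstein n g').[x].
Proof.
move=> /andP[x0 x1]; elim: n g g' => [|n IH] g g' H /=; first by rewrite !hornerC.
by rewrite !hornerE; apply: lerD; apply: ler_wpM2l; rewrite ?subr_ge0 //; apply: IH.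
Qed.

(** Under the binomial law $k$ has mean $nx$ and variance $nx(1-x)$; the expectation of $(k-a)^2$ is
    the squared bias plus the variance. *)
Lemma bernstein_quadratic n c e a x :
  (bernstein n (fun k => c + e * (k%:R - a) ^+ 2)).[x] =
  c + e * ((n%:R * x - a) ^+ 2 + n%:R * x * (1 - x)).
Proof.
elim: n c e a => [|n IH] c e a /=; first by rewrite hornerC; ring.
rewrite !hornerE IH.
have -> : (fun k => c + e * (k.+1%:R - a) ^+ 2) = (fun k => c + e * (k%:R - (a - 1)) ^+ 2).
  by apply/funext => k; rewrite -natr1; congr (_ + _ * _ ^+ 2); ring.
rewrite IH -natr1; ring.
Qed.

(** By $Lt\le L(\frac s2+\frac{t^2}{2s})$ a Lipschitz function lies between two quadratic functions
    touching it up to $Ls/2$. Positivity of the Bernstein operator ([bernstein_le]) carries this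
    over to the polynomials, where quadratics are explicit. *)
Lemma bernstein_approx (f : R -> R) (L e : R) : 0 < e ->
  (forall d d', `|f d - f d'| <= L * `|d - d'|) ->
  exists q : {poly R}, forall x, 0 <= x <= 1 -> `|q.[x] - f x| <= e.
Proof.
move=> e0 fL; have L0 : 0 <= L.
  by have := fL 1 0; rewrite subr0 normr1 mulr1; apply: le_trans.
(* [s] makes the constant term $Ls/2$ at most $e/2$; the degree, larger than $L/(se)$, does the same
   for the variance term. *)
pose s := e / (L + 1); have s0 : 0 < s by rewrite divr_gt0 // ltr_wpDl.
pose N := Num.bound (L / (s * e)).
have HN : L / (s * e) < N%:R by apply: archi_boundP; rewrite divr_ge0 // ltW // mulr_gt0.
pose n := N.+1; have n0 : 0 < n%:R :> R by rewrite ltr0n.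
have Ls : L * s <= e by rewrite mulrCA ler_piMr ?(ltW e0) // ler_pdivrMr ?ltr_wpDl // mul1r lerDl.
have Ln : L / (s * n%:R) <= e.
  have : L / (s * e) <= n%:R by rewrite ltW // (lt_trans HN) // ltr_nat.
  rewrite (ler_pdivrMr _ _ (mulr_gt0 s0 e0)) (ler_pdivrMr _ _ (mulr_gt0 s0 n0)).
  by have -> : n%:R * (s * e) = e * (s * n%:R) by ring.
exists (bernstein n (fun k => f (k%:R / n%:R))) => x x01.
pose c := L * s / 2; pose q := L / (2 * s * n%:R ^+ 2).
have Hk k : `|f (k%:R / n%:R) - f x| <= c + q * (k%:R - n%:R * x) ^+ 2.
  apply: le_trans (fL _ _) _; set t := `|_|.
  have -> : q * (k%:R - n%:R * x) ^+ 2 = L * (t ^+ 2 / (2 * s)).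
    rewrite /t real_normK ?num_real // /q.
    by field; rewrite !gt_eqF.
  rewrite /c -mulrA -mulrDr ler_wpM2l //.
  have := sqr_ge0 (t - s) => H.
  rewrite -(ler_pM2l (mulr_gt0 (ltr0Sn R 1) s0)).
  have -> : 2 * s * (s / 2 + t ^+ 2 / (2 * s)) = s ^+ 2 + t ^+ 2.
    by field; rewrite !gt_eqF.
  nra.
have E : c + q * ((n%:R * x - n%:R * x) ^+ 2 + n%:R * x * (1 - x)) <= e.
  have x2 : x * (1 - x) <= 1 by nra.
  have -> : q * ((n%:R * x - n%:R * x) ^+ 2 + n%:R * x * (1 - x)) =
    L / (s * n%:R) / 2 * (x * (1 - x)).
    by rewrite /q; field; rewrite !gt_eqF.
  have r0 : 0 <= L / (s * n%:R) by rewrite divr_ge0 // ltW // mulr_gt0.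
  by rewrite /c; move: (L / _) r0 Ln => r r0 Ln; nra.
have B1 := @bernstein_le n (fun k => f (k%:R / n%:R))
  (fun k => (f x + c) + q * (k%:R - n%:R * x) ^+ 2) x x01.
have B2 := @bernstein_le n (fun k => (f x - c) + (- q) * (k%:R - n%:R * x) ^+ 2)
  (fun k => f (k%:R / n%:R)) x x01.
rewrite bernstein_quadratic in B1; rewrite bernstein_quadratic in B2.
have {}B1 := B1 (fun k => _); have {}B2 := B2 (fun k => _).
rewrite ler_norml; apply/andP; split.
  have /B2 : forall k, f x - c + - q * (k%:R - n%:R * x) ^+ 2 <= f (k%:R / n%:R).
    by move=> k; have := Hk k; rewrite ler_norml mulNr => /andP[H _]; lra.
  by rewrite mulNr; lra.
have /B1 : forall k, f (k%:R / n%:R) <= f x + c + q * (k%:R - n%:R * x) ^+ 2.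
  by move=> k; have := Hk k; rewrite ler_norml => /andP[_ H]; lra.
by lra.
Qed.

End BernsteinApproximation.

(** * Functions of the harmonic density as real parts of polynomials *)

Section DensityPolynomials.
Context {R : realType}.
Local Notation mu := (@lebesgue_measure R).
Local Notation RT := (measurableTypeR R).
Implicit Types (x y : R) (z w : R[i]) (p : {poly R[i]}).

Lemma poly_headE p : exists q c, p = q * 'X + c%:P.
Proof.
elim/poly_ind: p => [|p c _]; last by exists p, c.
by exists 0, 0; rewrite mul0r add0r.
Qed.

(* On the unit circle [Re (c z) * Re p.[z]] is again the real part of a
   polynomial, since [z^-1 = z^*]. *)
Lemma circle_poly (q : {poly R}) (a : R) (c : R[i]) :
  exists p : {poly R[i]}, forall z, normc z = 1 ->
    complex.Re p.[z] = q.[a + complex.Re (c * z)].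
Proof.
elim/poly_ind: q => [|q k [p Hp]]; first by exists 0 => z _; rewrite !horner0.
have [p' [c' E]] := poly_headE p.
(* On the circle $\mathrm{Re}(cz)\,\mathrm{Re}\,P=\frac12\mathrm{Re}(czP+\bar c z^{-1}P)$. Since
   $z^{-1}(p'z+c')=p'+c'\bar z$, the last piece contributes $\mathrm{Re}(\bar cc'\bar
   z)=\mathrm{Re}(c\,\overline{c'}z)$. *)
exists (a%:C%:P * p + (2^-1)%:C%:P * (c%:P * 'X * p + (c^*%C)%:P * p' +
  (c * c'^*%C)%:P * 'X) + k%:C%:P) => z z1.
rewrite hornerMXaddC -Hp // E !hornerE.
have : complex.Re z ^+ 2 + complex.Im z ^+ 2 = 1 by rewrite -sqr_normc z1 expr1n.
move: (p'.[z]) c Hp c' E => t [c1 c2] _ [e1 e2] _; case: z {z1} => X Y; case: t => u v.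
rewrite !(ReM, ImM, ReD, ImD, ReN, ImN) /= => H.
apply/eqP; rewrite -subr_eq0; apply/eqP.
transitivity ((c1 * u + c2 * v) / 2 * (1 - (X ^+ 2 + Y ^+ 2))); last by rewrite H subrr mulr0.
by field.
Qed.

(** Since the density depends affinely on $\mathrm{Re}(\bar w\zeta)$ with $|\zeta|=1$, a polynomial
    in the density comes within reach of [circle_poly]. *)
Lemma zeta_circle w s x y : 0 < complex.Im w -> wexp (x +i* y) = (s * sx x)%:C ->
  normc (zeta w (x +i* y)) = 1 /\
  lineK (complex.Re w) (complex.Im w) s x =
    (complex.Re w - complex.Re (w^*%C * zeta w (x +i* y))) / (2 * complex.Im w).
Proof.
move=> w0 E; have [_ ->] := ker_line_real w0 E.
have := lineD_gt0 (complex.Re w) s w0 x; rewrite /lineX /lineY /lineK.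
have : lineD (complex.Re w) (complex.Im w) s x =
  (s * sx x - complex.Re w) ^+ 2 + complex.Im w ^+ 2 by [].
move: (lineD _ _ _ _) => D; case: w w0 {E} => a b /= b0 DE D0.
have D1 : D != 0 by exact: lt0r_neq0.
have b1 : b != 0 by exact: lt0r_neq0.
split.
  rewrite -[RHS](@sqrtr1 R); congr Num.sqrt.
  transitivity (((s * sx x - a) ^+ 2 + b ^+ 2) ^+ 2 / D ^+ 2); first by field.
  by rewrite -DE divff // expf_neq0.
apply: (mulIf (mulf_neq0 (mulf_neq0 (lt0r_neq0 (ltr0Sn R 1)) b1) D1)).
transitivity (2 * b ^+ 2 * (s * sx x)); first by field.
transitivity (a * D - (a * ((s * sx x - a) ^+ 2 - b ^+ 2) - b * (2 * b * (s * sx x - a)))).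
  by rewrite DE; ring.
by field; rewrite b1 D1.
Qed.

(** The sign distinguishes the two lines, so that one function of a single real variable can
    prescribe unrelated data on them. The modulus is the Poisson kernel. *)
Definition density w x (top : bool) : R :=
  if top then - pker (- complex.Re w) (complex.Im w) x
  else pker (complex.Re w) (complex.Im w) x.

Definition zline w x (top : bool) : R[i] := zeta w (x +i* (if top then 1 else 0)).

Lemma density_zline w x top : 0 < complex.Im w -> normc (zline w x top) = 1 /\
  density w x top = (complex.Re w - complex.Re (w^*%C * zline w x top)) / (2 * complex.Im w).
Proof.
move=> w0; case: top; rewrite /density /zline.
  have E : wexp (x +i* 1) = (-1 * sx x)%:C by rewrite wexp_line1 mulN1r.
  have [h1 h2] := zeta_circle w0 E; split => //; rewrite -h2 /lineK /lineD /pker.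
  have -> : -1 * sx x - complex.Re w = - (sx x - - complex.Re w) by ring.
  by rewrite sqrrN -mulNr; congr (_ / _); ring.
have E : wexp (x +i* 0) = (1 * sx x)%:C by rewrite wexp_line0 mul1r.
have [h1 h2] := zeta_circle w0 E; split => //; rewrite -h2 /lineK /lineD /pker.
by rewrite mul1r mulr1.
Qed.

Definition density_bound w : R := (`|complex.Re w| + normc w) / (2 * complex.Im w).

Lemma density_bound_gt0 w : 0 < complex.Im w -> 0 < density_bound w.
Proof.
move=> w0; rewrite divr_gt0 ?mulr_gt0 // ltr_wpDl //.
by rewrite normc_gt0; apply/eqP => w00; rewrite w00 ltxx in w0.
Qed.

Lemma density_le w x top : 0 < complex.Im w -> `|density w x top| <= density_bound w.
Proof.
move=> w0; have [h1 ->] := density_zline x top w0.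
rewrite normrM normfV (gtr0_norm (mulr_gt0 (ltr0Sn R 1) w0)).
rewrite ler_wpM2r ?invr_ge0 ?mulr_ge0 ?(ltW w0) //.
apply: le_trans (ler_normB _ _) _; rewrite lerD2l.
by apply: le_trans (ler_Re_normc _) _; rewrite normcM h1 mulr1 normc_conj.
Qed.

Lemma density_poly w (f : R -> R) (L e : R) : 0 < complex.Im w -> 0 < e ->
  (forall d d', `|f d - f d'| <= L * `|d - d'|) ->
  exists p : {poly R[i]}, forall x top,
    `|complex.Re p.[zline w x top] - f (density w x top)| <= e.
Proof.
move=> w0 e0 fL; have D0 := density_bound_gt0 w0.
set D := density_bound w in D0 *.
have [|q Hq] := @bernstein_approx R (fun t => f (2 * D * t - D)) (L * (2 * D)) e e0.
  move=> d d'; apply: le_trans (fL _ _) _.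
  have -> : 2 * D * d - D - (2 * D * d' - D) = 2 * D * (d - d') by ring.
  by rewrite normrM (gtr0_norm (mulr_gt0 (ltr0Sn R 1) D0)) [in leRHS]mulrAC mulrA mulrAC.
(* The coefficients of the affine map taking the density from $[-D,D]$ to $[0,1]$, expressed through
   [zeta] by [density_zline]. *)
have [p Hp] := circle_poly q (complex.Re w / (2 * complex.Im w) / (2 * D) + 2^-1)
    ((- (2 * complex.Im w)^-1 / (2 * D))%:C * w^*%C).
exists p => x top; have [h1 h2] := density_zline x top w0.
have h3 := density_le x top w0; rewrite -/D ler_norml in h3.
have Rc r (u : R[i]) : complex.Re (r%:C * u) = r * complex.Re u by rewrite ReM /= mul0r subr0.
rewrite Hp // -(mulrA _%:C) Rc.
set d := density w x top in h2 h3 *.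
set t := (X in q.[X]).
have D1 : D != 0 by exact: lt0r_neq0.
have tE : 2 * D * t - D = d.
  rewrite h2 /t; move: (complex.Re (_ * _)) => r; field.
  by rewrite D1 lt0r_neq0.
rewrite -tE; apply: Hq.
have -> : t = (d + D) / (2 * D) by rewrite -tE; field.
have DD : 0 < 2 * D by rewrite mulr_gt0.
move: h3; clear -D0 DD; move: D d D0 DD => D d D0 DD /andP[h3 h4].
by rewrite ler_pdivrMr // ler_pdivlMr //; apply/andP; split; lra.
Qed.

(* The argument is the density of the harmonic measure, signed so that it is
   negative on the other line. The profile is
   approximated from above by Lipschitz functions that eventually coincide
   with it at each point. *)
Definition profile (k c c' d : R) : R := if 0 < d then c + k * ln d else c'.

Definition profile_lip (n : nat) (k c c' d : R) : R :=
  Num.max (c + k * ln (Num.max d n.+1%:R^-1)) (c' - n.+1%:R * Num.max d 0).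

Lemma ln_lipschitz (n a b : R) : 0 < n -> n^-1 <= a -> n^-1 <= b ->
  `|ln a - ln b| <= n * `|a - b|.
Proof.
move=> n0; have i0 : 0 < n^-1 by rewrite invr_gt0.
have H (u v : R) : n^-1 <= u -> n^-1 <= v -> ln u - ln v <= n * `|u - v|.
  move=> un vn; have u0 := lt_le_trans i0 un; have v0 := lt_le_trans i0 vn.
  rewrite -ln_div ?posrE //.
  have h : ln (u / v) <= u / v - 1.
    rewrite -{1}[u / v](subrK 1) addrC; apply: le_ln1Dx.
    by rewrite ltrBrDr addrC subrr divr_gt0.
  apply: le_trans h _.
  have -> : u / v - 1 = v^-1 * (u - v) by field; exact: lt0r_neq0.
  apply: le_trans (ler_norm _) _; rewrite normrM ler_wpM2r // gtr0_norm ?invr_gt0 //.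
  by rewrite -[n]invrK lef_pV2 ?posrE.
move=> an bn; rewrite ler_norml; have h1 := H _ _ an bn; have h2 := H _ _ bn an.
by rewrite (distrC b) in h2; apply/andP; split; lra.
Qed.

Lemma max_lipschitz2 (a b a' b' : R) :
  `|Num.max a b - Num.max a' b'| <= `|a - a'| + `|b - b'|.
Proof.
have h1 := max_lipschitz b a a'; have h2 := max_lipschitz a' b b'.
rewrite !(maxC b) in h1; have := ler_normD (Num.max a b - Num.max a' b)
  (Num.max a' b - Num.max a' b').
rewrite addrA subrK => h; apply: (le_trans h); exact: lerD.
Qed.

Lemma profile_lip_lipschitz n (k c c' d d' : R) : 0 <= k ->
  `|profile_lip n k c c' d - profile_lip n k c c' d'| <= (k + 1) * n.+1%:R * `|d - d'|.
Proof.
move=> k0; have n0 : 0 < n.+1%:R :> R by rewrite ltr0n.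
apply: le_trans (max_lipschitz2 _ _ _ _) _.
rewrite -mulrA mulrDl mul1r; apply: lerD.
  have -> u v : c + k * u - (c + k * v) = k * (u - v) by ring.
  rewrite normrM (ger0_norm k0) ler_wpM2l //.
  apply: le_trans (ln_lipschitz n0 _ _) _; rewrite ?le_max ?lexx ?orbT //.
  rewrite ler_wpM2l ?(ltW n0) //.
  by rewrite !(maxC _ n.+1%:R^-1); exact: max_lipschitz.
have -> u v : c' - n.+1%:R * u - (c' - n.+1%:R * v) = n.+1%:R * (v - u) by ring.
rewrite normrM (gtr0_norm n0) ler_wpM2l ?(ltW n0) // distrC.
by rewrite !(maxC _ 0); exact: max_lipschitz.
Qed.

Lemma profile_le n (k c c' d : R) : 0 <= k -> profile k c c' d <= profile_lip n k c c' d.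
Proof.
move=> k0; rewrite /profile /profile_lip le_max; case: ltP => d0.
  apply/orP; left; rewrite lerD2l ler_wpM2l // ler_ln ?posrE // ?lt_max ?d0 //.
  by rewrite le_max lexx.
by apply/orP; right; rewrite mulr0 subr0.
Qed.

Lemma profile_lip_le n (k c c' d B : R) : 0 <= k -> d <= B -> 1 <= B ->
  profile_lip n k c c' d <= Num.max (c + k * ln B) c'.
Proof.
move=> k0 dB B1; rewrite /profile_lip ge_max !le_max; apply/andP; split.
  apply/orP; left; rewrite lerD2l ler_wpM2l // ler_ln ?posrE //.
  - by rewrite ge_max dB (le_trans _ B1) // invf_le1 ?ltr0n // ler1n.
  - by rewrite lt_max invr_gt0 ltr0n orbT.
  - exact: lt_le_trans ltr01 B1.
by apply/orP; right; rewrite gerBl mulr_ge0 // le_max lexx orbT.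
Qed.

(** For [d < 0] the logarithmic branch is the constant $c-k\ln(n+1)$, which eventually falls below
    $c'$. The rank does not depend on [d]; this uniformity is what later bounds the extremal
    functions on the $L^\infty$ line. *)
Lemma profile_lip_neg (k c c' : R) : 0 < k ->
  \forall n \near \oo, forall d : R, d < 0 -> profile_lip n k c c' d = c'.
Proof.
move=> k0; near=> n => d d1; have n0 : 0 < n.+1%:R :> R by rewrite ltr0n.
rewrite /profile_lip (@max_r _ _ d 0) ?(ltW d1) // mulr0 subr0 (@max_r _ _ d); last first.
  by rewrite ltW // (lt_trans d1) // invr_gt0.
rewrite max_r // lnV ?posrE // mulrN.
have : (c - c') / k <= ln n.+1%:R.
  rewrite -ler_expR lnK ?posrE //.
  apply: (@le_trans _ _ n%:R); last by rewrite ler_nat.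
  by near: n; apply: nbhs_infty_ger.
by rewrite ler_pdivrMr // mulrC; lra.
Unshelve. all: by end_near.
Qed.

Lemma profile_lip_cvg (k c c' d : R) : 0 < k -> d != 0 ->
  \forall n \near \oo, profile_lip n k c c' d = profile k c c' d.
Proof.
move=> k0 d0; rewrite /profile /profile_lip; case: ltP => d1.
  (* Past the first number the truncation of the logarithm is inactive at [d]; past the second the
     linear branch lies below the logarithmic one. *)
  pose N := Num.max d^-1 ((c' - c - k * ln d) / d).
  near=> n; have Nn : N <= n.+1%:R.
    apply: (@le_trans _ _ n%:R); last by rewrite ler_nat.
    by near: n; apply: nbhs_infty_ger.
  move: Nn; rewrite ge_max => /andP[N1 N2].
  have n0 : 0 < n.+1%:R :> R by rewrite ltr0n.
  rewrite (@max_l _ _ d n.+1%:R^-1); last by rewrite -[d]invrK lef_pV2 ?posrE ?invr_gt0.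
  rewrite max_l //.
  by rewrite ler_pdivrMr // in N2; lra.
have {}d1 : d < 0 by rewrite lt_neqAle d0.
have H := profile_lip_neg c c' k0.
near=> n; have : profile_lip n k c c' d = c' by near: n; apply: filterS H => n; exact.
by rewrite /profile_lip (@max_r _ _ d 0) // ltW.
Unshelve. all: by end_near.
Qed.

End DensityPolynomials.

(** * Mean value property and outer approximation of a profile *)

Section HarmonicMeasure.
Context {R : realType}.
Local Notation mu := (@lebesgue_measure R).
Local Notation RT := (measurableTypeR R).
Implicit Types (x y : R) (p : {poly R[i]}).

Variable z0 : R[i].
Hypothesis z01 : 0 < complex.Im z0 < 1.
Let w := wexp z0.
Let w0 : 0 < complex.Im w := Im_wexp_gt0 z01.
Local Notation P0 := (pker (complex.Re w) (complex.Im w)).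
Local Notation P1 := (pker (- complex.Re w) (complex.Im w)).

Lemma level_line (top : bool) (j := if top then 1 else 0 : R) :
  [/\ j = 0 \/ j = 1, 0 <= j <= 1 & height_gap z0 <= `|j - complex.Im z0|].
Proof.
have g0 := height_gap_gt0 z01.
have h : j = 0 \/ j = 1 by rewrite /j {j}; case: top; [right|left].
have h' : 0 <= j <= 1 by case: h => ->; rewrite ?lexx ?ler01.
by split => //; apply: (far_from_z0 h h'); rewrite subrr normr0 ltW.
Qed.

Lemma cmeas_horner_zline p top : cmeas (setT : set RT) (fun x => p.[zline w x top]).
Proof.
have [j1 j01 jg] := level_line top.
apply: ccont_cmeas => x; apply: (@cdiff_ccont_h _ (fun z => p.[zeta w z])).
by apply: cdiff_comp; [exact: cdiff_zeta|exact: cdiff_horner].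
Qed.

(** The function $p\circ\zeta$ is itself bounded and holomorphic in the strip, so
    [strip_representation] applies to it with exponent 0. Its line limits come from [zeta_lip],
    which is uniform in [x]. *)
Lemma poly_harmonic p : complex.Re p.[0] =
  \int[mu]_x (P0 x * complex.Re p.[zline w x false]) +
  \int[mu]_x (P1 x * complex.Re p.[zline w x true]).
Proof.
have g0 := height_gap_gt0 z01.
have [K K0 HK] := horner_bounded p; have [L L0 HL] := horner_lipschitz p.
have z1 x y : 0 <= y <= 1 -> normc (zeta w (x +i* y)) <= 1.
  by move=> y01; apply: normc_zeta_le1.
pose h z := p.[zeta w z].
have hh : strip_holo h.
  move=> x y /andP[y0 y1]; apply: cdiff_comp; last exact: cdiff_horner.
  by apply: cdiff_zeta => //=; rewrite !ltW.
have iw := @rint_weight R.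
have hM : weighted_bound h (K * \int[mu]_x weight x).
  move=> y y01; have y01' : 0 <= y <= 1 by case/andP: y01 => *; rewrite !ltW.
  have mh := cmeas_normc (cmeas_line hh y01).
  have iK := rintZ K measurableT iw.
  have ih : rint (setT : set RT) (fun x => normc (h (x +i* y)) * weight x).
    apply: rint_le iK => //.
      by apply: measurable_funM => //; exact: measurable_weight.
    move=> x _; rewrite ger0_norm.
      by apply: ler_wpM2r; [exact: weight_ge0|rewrite HK // z1].
    exact: mulr_ge0 (normc_ge0 _) (weight_ge0 x).
  have := ler_Rint measurableT ih iK.
  rewrite -[leRHS]/(\int[mu]_x _) RintegralZl // => H.
  have fi : (\int[mu]_x (normc (h (x +i* y)) * weight x)%:E)%E \is a fin_num.
    exact: integrable_fin_num.
  rewrite -(fineK fi) lee_fin; apply: H => x _.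
  by apply: ler_wpM2r; [exact: weight_ge0|rewrite HK // z1].
pose lim (j : R) := cintegral setT (fun x => h (x +i* j) * phi w 0 (x +i* j)).
have LL (top : bool) (j := if top then 1 else 0) :
    line_limit j (fun y x => h (x +i* y) * phi w 0 (x +i* j)) (lim j).
  have [j1 j01 jg] := level_line top; rewrite -/j in j1 j01 jg.
  have jn : j != complex.Im z0.
    by rewrite -subr_eq0 -normr_gt0 (lt_le_trans g0).
  have [C C0 HC] := phi_line_bound 0 z01 j01 jn.
  have [c c0 Hc] := wexp_gap z01 g0.
  pose C3 := 4 * pi * complex.Im w * c ^- 2.
  have C30 : 0 <= C3.
    apply: mulr_ge0; last by rewrite invr_ge0 exprn_ge0 // ltW.
    by apply: mulr_ge0; [rewrite mulr_ge0 ?pi_ge0|exact: ltW].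
  have I0 : 0 <= \int[mu]_x @weight R x by apply: Rintegral_ge0 => x _; exact: weight_ge0.
  pose Q := L * C3 * C * \int[mu]_x weight x.
  have Q0 : 0 <= Q by do 2!apply: mulr_ge0 => //; exact: mulr_ge0.
  move=> e e0; exists (Num.min (height_gap z0) (e / (Q + 1))).
    by rewrite lt_min g0 divr_gt0 // ltr_wpDl.
  move=> y y01 yj; have y01' : 0 <= y <= 1 by case/andP: y01 => *; rewrite !ltW.
  have yg : height_gap z0 <= `|y - complex.Im z0|.
    by apply: (far_from_z0 j1) => //; apply: le_trans yj _; rewrite ge_min lexx.
  have hl (t : R) : 0 <= t <= 1 -> cmeas (setT : set RT) (fun x => h (x +i* t)).
    move=> t01; apply: ccont_cmeas => x; apply: (@cdiff_ccont_h _ h).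
    by apply: cdiff_comp; [exact: cdiff_zeta|exact: cdiff_horner].
  have mp : cmeas (setT : set RT) (fun x => phi w 0 (x +i* j)) by exact: phi_line_cmeas.
  have ci (t : R) : 0 <= t <= 1 ->
      cintegrable (setT : set RT) (fun x => h (x +i* t) * phi w 0 (x +i* j)).
    move=> t01; apply: (@cintegrable_le _ _ _ (fun x => K * C * weight x)) => //.
    - by apply: cmeasM => //; exact: hl.
    - move=> x _; rewrite normcM -mulrA; apply: ler_pM.
      + exact: normc_ge0.
      + exact: normc_ge0.
      + by apply: HK; exact: z1.
      + exact: HC.
    - exact: (rintZ (K * C) measurableT iw).
  rewrite -cintegralB; [|exact: measurableT|exact: ci|exact: ci].
  apply: le_trans (@normc_cintegral_le _ _ _
    (fun x => L * C3 * `|y - j| * C * weight x) _ _ _ _) _ => //.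
  - by apply: cmeasB; [exact: measurableT|apply: cmeasM..];
      try exact: measurableT; try exact: mp; exact: hl.
  - move=> x _; rewrite -mulrBl normcM -[_ * C * _]mulrA.
    apply: ler_pM; rewrite ?normc_ge0 ?HC //.
    apply: le_trans (HL _ _ (z1 _ _ y01') (z1 _ _ j01)) _.
    rewrite -mulrA ler_wpM2l //.
    exact: (zeta_lip w0 y01' j01 c0 (Hc x y y01' yg) (Hc x j j01 jg)).
  - exact: (rintZ (L * C3 * `|y - j| * C) measurableT iw).
  rewrite RintegralZl //.
  have -> : L * C3 * `|y - j| * C * \int[mu]_x weight x = Q * `|y - j|.
    by rewrite /Q; ring.
  have : `|y - j| <= e / (Q + 1) by apply: le_trans yj _; rewrite ge_min lexx orbT.
  by rewrite ler_pdivlMr ?ltr_wpDl // => H; have := normr_ge0 (y - j); nra.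
have := strip_representation hh hM z01 (LL false) (LL true).
have -> : h z0 = p.[0] by rewrite /h zetaE subrr mul0r.
rewrite horner0 oppr0 cexp0 mulr1 => ->; rewrite ReB /=.
have ph x y : phi w 0 (x +i* y) = ker w (x +i* y).
  by rewrite phiE horner0 oppr0 cexp0 mulr1.
rewrite /lim /=; congr (_ + _).
  by apply: eq_Rint => x _; rewrite ph ker_line0 // ReM /= mulr0 subr0 mulrC.
have ip : rint (setT : set RT) (fun x => P1 x * complex.Re p.[zline w x true]).
  have [i1 _] := integral_pker (- complex.Re w) w0.
  apply: rint_le (rintZ K measurableT i1) => //.
    apply: measurable_funM; first exact: rint_measurable i1.
    by have [] := cmeas_horner_zline p true.
  move=> x _; rewrite normrM mulrC (gtr0_norm (pker_gt0 _ _ w0)).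
  apply: ler_wpM2r; first exact: ltW (pker_gt0 _ _ w0).
  by apply: le_trans (ler_Re_normc _) _; rewrite HK // z1 // ler01 lexx.
rewrite -mulN1r -RintegralZl //; last first.
  apply: rint_eq (rintZ (-1) measurableT ip) => // x _.
  by rewrite ph ker_line1 // ReM /= mulr0 subr0 mulN1r mulrN mulrC.
apply: eq_Rint => x _; rewrite ph ker_line1 // ReM /= mulr0 subr0.
by rewrite mulN1r mulrN opprK mulrC.
Qed.

Variables (k c c' s : R).
Hypotheses (k0 : 0 < k) (s1 : `|s| = 1).

Let v top x := profile k c c' (s * density w x top).

Hypothesis v_integrable : forall top, rint (setT : set RT)
  (fun x => `|density w x top| * v top x).

Lemma density_abs x top : `|density w x top| = if top then P1 x else P0 x.
Proof.
by rewrite /density; case: top; rewrite ?normrN gtr0_norm // pker_gt0.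
Qed.

Lemma sdensity_neq0 x top : s * density w x top != 0.
Proof.
rewrite -normr_eq0 normrM s1 mul1r density_abs.
by case: top; rewrite gt_eqF // pker_gt0.
Qed.

Lemma rint_density top : rint (setT : set RT) (fun x => `|density w x top|).
Proof.
have H (a : R) := (integral_pker a w0).1.
by case: top; [apply: rint_eq (H (- complex.Re w))|apply: rint_eq (H (complex.Re w))] => // x _;
  rewrite density_abs.
Qed.

(** The polynomial of rank [n] is within $1/(n+1)$ of the Lipschitz profile raised by $1/(n+1)$. It
    thus lies above the true profile and below a fixed [M], and dominated convergence with
    [poly_harmonic] gives the limit at the centre. *)
Lemma outer_sequence : exists (p_ : nat -> {poly R[i]}) (M : R),
  [/\ forall n x top, v top x <= complex.Re (p_ n).[zline w x top] <= M,
      forall x top, complex.Re (p_ n).[zline w x top] @[n --> \oo] --> v top x,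
      forall e, 0 < e -> \forall n \near \oo, forall x top, s * density w x top < 0 ->
        complex.Re (p_ n).[zline w x top] <= c' + e &
      complex.Re (p_ n).[0] @[n --> \oo] -->
        \int[mu]_x (P0 x * v false x) + \int[mu]_x (P1 x * v true x)].
Proof.
have L (n : nat) d d' : `|profile_lip n k c c' (s * d) - profile_lip n k c c' (s * d')| <=
    (k + 1) * n.+1%:R * `|d - d'|.
  apply: le_trans (profile_lip_lipschitz _ _ _ _ _ (ltW k0)) _.
  by rewrite -mulrBr normrM s1 mul1r.
have e0 (n : nat) : 0 < n.+1%:R^-1 :> R by rewrite invr_gt0.
have ex n : exists p : {poly R[i]}, forall x top,
    `|complex.Re p.[zline w x top] -
      (profile_lip n k c c' (s * density w x top) + n.+1%:R^-1)| <= n.+1%:R^-1.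
  have [|p Hp] := @density_poly R w (fun d => profile_lip n k c c' (s * d) + n.+1%:R^-1)
    ((k + 1) * n.+1%:R) n.+1%:R^-1 w0 (e0 n); last by exists p.
  by move=> d d'; rewrite opprD addrACA subrr addr0; exact: L.
have [p_ Hp] := choice ex.
pose B := Num.max 1 (density_bound w).
pose M := Num.max (c + k * ln B) c' + 2; pose u n top x := complex.Re (p_ n).[zline w x top].
have i1 (n : nat) : n.+1%:R^-1 <= 1 :> R by rewrite invf_le1 ?ltr0n // ler1n.
have uM n top x : v top x <= u n top x <= M.
  have := Hp n x top; rewrite ler_distl -/(u n top x) => /andP[h1 h2].
  have p1 := profile_le n c c' (s * density w x top) (ltW k0).
  have := @profile_lip_le R n k c c' (s * density w x top) B (ltW k0).
  have sB : s * density w x top <= B.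
    rewrite le_max; apply/orP; right.
    apply: le_trans (ler_norm _) _; rewrite normrM s1 mul1r; exact: density_le.
  have B1 : 1 <= B by rewrite le_max lexx.
  move=> /(_ sB B1) p2; have i2 := i1 n; rewrite /v /M.
  apply/andP; split; first by rewrite addrK in h1; exact: le_trans p1 h1.
  apply: (le_trans h2); rewrite -addrA; apply: lerD => //.
  by apply: lerD.
have uv top x : u n top x @[n --> \oo] --> v top x.
  have cl := profile_lip_cvg c c' k0 (sdensity_neq0 x top).
  apply/cvgrPdist_le => e eg0; near=> n.
  have E : profile_lip n k c c' (s * density w x top) = v top x by near: n.
  have := Hp n x top; rewrite E ler_distl -/(u n top x) => /andP[h1 h2].
  have h3 : 2 / e <= n.+1%:R.
    by apply: (@le_trans _ _ n%:R); [near: n; apply: nbhs_infty_ger|rewrite ler_nat].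
  have {}h3 : 2 * n.+1%:R^-1 <= e.
    by rewrite ler_pdivrMr // in h3; rewrite ler_pdivrMr ?ltr0n // mulrC.
  rewrite addrK in h1; rewrite distrC ger0_norm ?subr_ge0 // lerBlDl.
  apply: le_trans h2 _; rewrite -addrA lerD2l; apply: le_trans h3.
  by rewrite -mulr2n -[_ *+ 2]mulr_natl.
exists p_, M; split; [by move=> n x top; exact: uM|by move=> x top; exact: uv| |].
  move=> e eg0; have neg := profile_lip_neg c c' k0; near=> n => x top sd.
  have E : profile_lip n k c c' (s * density w x top) = c' by apply: (near neg n).
  have := Hp n x top; rewrite E ler_distl -/(u n top x) => /andP[h1 h2].
  apply: le_trans h2 _; rewrite -addrA lerD2l -mulr2n -[_ *+ 2]mulr_natl.
  have h3 : 2 / e <= n.+1%:R.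
    by apply: (@le_trans _ _ n%:R); [near: n; apply: nbhs_infty_ger|rewrite ler_nat].
  by rewrite ler_pdivrMr // in h3; rewrite ler_pdivrMr ?ltr0n // mulrC.
have int top : \int[mu]_x (`|density w x top| * u n top x) @[n --> \oo] -->
    \int[mu]_x (`|density w x top| * v top x).
  (* The dominating function combines the two bounds $v\le u_n\le M$. *)
  have ib : rint (setT : set RT) (fun x => `|M| * `|density w x top| +
      `| `|density w x top| * v top x|).
    apply: rintD => //; [apply: rintZ => //; exact: rint_density|exact: rint_norm].
  apply: (@rdct R setT (fun n x => `|density w x top| * u n top x) _ _ _ _ _ _ _ ib).2 => //.
  - move=> n; apply: measurable_funM; first exact: rint_measurable (rint_density top).
    by have [] := cmeas_horner_zline (p_ n) top.
  - exact: rint_measurable (v_integrable top).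
  - by move=> x _; apply: cvgM; [exact: cvg_cst|exact: uv].
  - move=> n x _; rewrite !normrM normr_id (mulrC `|M|) -mulrDr ler_wpM2l //.
    have /andP[h1 h2] := uM n top x; rewrite ler_norml.
    have h3 := ler_norm M; have h4 := ler_norm (- v top x); rewrite normrN in h4.
    have h5 := normr_ge0 M; have h6 := normr_ge0 (v top x).
    by apply/andP; split; lra.
have -> : (fun n => complex.Re (p_ n).[0]) =
   (fun n => \int[mu]_x (`|density w x false| * u n false x) +
     \int[mu]_x (`|density w x true| * u n true x)).
  by apply/funext => n; rewrite poly_harmonic; congr (_ + _); apply: eq_Rint => x _;
    rewrite density_abs.
have -> : \int[mu]_x (P0 x * v false x) + \int[mu]_x (P1 x * v true x) =
   \int[mu]_x (`|density w x false| * v false x) +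
     \int[mu]_x (`|density w x true| * v true x).
  by congr (_ + _); apply: eq_Rint => x _; rewrite density_abs.
by apply: cvgD; exact: int.
Unshelve. all: by end_near.
Qed.

End HarmonicMeasure.

(** * Weighted means controlled by Lebesgue norms *)

Section LpNorms.
Context {R : realType}.
Local Notation mu := (@lebesgue_measure R).
Local Notation RT := (measurableTypeR R).
Implicit Types (x B : R) (u : R -> R) (f g : R -> R[i]) (p : \bar R).

Lemma rint_ge0_le u B : measurable_fun (setT : set RT) u -> (forall x, 0 <= u x) ->
  (\int[mu]_x (u x)%:E <= B%:E)%E -> rint (setT : set RT) u /\ \int[mu]_x u x <= B.
Proof.
move=> mu_ u0 uB.
have iu : rint (setT : set RT) u.
  apply/integrableP; split; first exact/measurable_EFinP.
  apply: (@le_lt_trans _ _ B%:E); last by rewrite ltry.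
  by under eq_integral => x _ do rewrite /= ger0_norm //.
split => //; rewrite -lee_fin; apply: le_trans uB.
by rewrite fineK //; apply: integrable_fin_num.
Qed.

Lemma cLnorm_ge0 p f : (0 <= cLnorm p f)%E.
Proof. exact: Lnorm_ge0. Qed.

Lemma cLnorm1E f : cLnorm 1%E f = (\int[mu]_x (normc (f x))%:E)%E.
Proof.
rewrite /cLnorm Lnorm1; apply: eq_integral => x _.
by rewrite /= ger0_norm // normc_ge0.
Qed.

Lemma cLnorm2E f : cLnorm 2%:E f = ((\int[mu]_x (normc (f x) ^+ 2)%:E) `^ 2^-1)%E.
Proof.
rewrite /cLnorm unlock; congr (_ `^ _)%E; apply: eq_integral => x _.
by rewrite /= ger0_norm ?normc_ge0 // powR_mulrn ?normc_ge0.
Qed.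

Lemma lebesgue_setT_gt0 : (0 < mu (setT : set RT))%E.
Proof. by rewrite -set_itvNyy lebesgue_measure_itv /= ltry. Qed.

Lemma ae_imply (P Q : R -> Prop) : (forall x, P x -> Q x) ->
  (\forall x \ae mu, P x) -> \forall x \ae mu, Q x.
Proof.
move=> PQ [N [mN N0 sN]]; exists N; split => // x /= nQ; apply: sN => /= px.
by apply: nQ; exact: PQ.
Qed.

Lemma cLnormyP f B : reflect (\forall x \ae mu, normc (f x) <= B) (cLnorm +oo f <= B%:E)%E.
Proof.
rewrite /cLnorm unlock lebesgue_setT_gt0.
apply: (iffP idP) => [/ess_sup_inf.ess_supP|H].
  by apply: ae_imply => x /=; rewrite lee_fin ger0_norm // normc_ge0.
apply/ess_sup_inf.ess_supP; apply: ae_imply H => x /=.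
by rewrite lee_fin ger0_norm // normc_ge0.
Qed.

Lemma cLnorm1_le f B : cmeasurable f -> (cLnorm 1%E f <= B%:E)%E ->
  rint (setT : set RT) (fun x => normc (f x)) /\ \int[mu]_x normc (f x) <= B.
Proof.
move=> mf; rewrite cLnorm1E; apply: rint_ge0_le; first exact: cmeas_normc mf.
by move=> x; exact: normc_ge0.
Qed.

Lemma cLnorm2_le f B : cmeasurable f -> (cLnorm 2%:E f <= B%:E)%E ->
  rint (setT : set RT) (fun x => normc (f x) ^+ 2) /\ \int[mu]_x (normc (f x) ^+ 2) <= B ^+ 2.
Proof.
move=> mf fB; have B0 : 0 <= B by rewrite -lee_fin; apply: le_trans fB; exact: cLnorm_ge0.
apply: rint_ge0_le.
- by apply: measurable_funX; exact: cmeas_normc mf.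
- by move=> x; exact: sqr_ge0.
rewrite cLnorm2E in fB.
have I0 : (0 <= \int[mu]_x (normc (f x) ^+ 2)%:E)%E.
  by apply: integral_ge0 => x _; rewrite lee_fin sqr_ge0.
move: (\int[mu]_x _)%E I0 fB => -[r| |] // r0; last by rewrite poweRyr.
rewrite poweR12_sqrt //= !lee_fin => H; rewrite lee_fin in r0.
by rewrite -[r]sqr_sqrtr // ler_pXn2r // nnegrE sqrtr_ge0.
Qed.

Lemma ae_rint_mul f u B : 0 <= B -> cmeasurable f -> (\forall x \ae mu, normc (f x) <= B) ->
  rint (setT : set RT) u -> (forall x, 0 <= u x) ->
  rint (setT : set RT) (fun x => u x * normc (f x)) /\
  \int[mu]_x (u x * normc (f x)) <= B * \int[mu]_x u x.
Proof.
move=> B0 mf fB iu u0; have mu_ := rint_measurable iu.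
have iB := rintZ B measurableT iu.
rewrite -RintegralZl //; apply: rint_ge0_le.
- by apply: measurable_funM => //; exact: cmeas_normc mf.
- by move=> x; apply: mulr_ge0 => //; exact: normc_ge0.
rewrite fineK; last exact: integrable_fin_num.
apply: ae_ge0_le_integral => //.
- by move=> x _; rewrite lee_fin; apply: mulr_ge0 => //; exact: normc_ge0.
- by apply/measurable_EFinP; apply: measurable_funM => //; exact: cmeas_normc mf.
- by move=> x _; rewrite lee_fin; exact: mulr_ge0.
- by apply/measurable_EFinP; exact: measurable_funM.
by apply: ae_imply fB => x H _; rewrite lee_fin mulrC ler_wpM2r.
Qed.

(** For exponent 1 the weight is at most 1, for infinity it is integrable, and for 2 one uses $at\le
    a^2+t$ when $a\ge0$ and $0\le t\le1$. The bound [K] is the same for all [f] of norm at most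
    [B]. *)
Lemma Lp_weight p : p = 1%E \/ p = 2%:E \/ p = +oo%E -> forall B, exists K : R,
  forall f, cmeasurable f -> (cLnorm p f <= B%:E)%E ->
    (\int[mu]_x (normc (f x) * weight x)%:E <= K%:E)%E.
Proof.
have iw := @rint_weight R; have w1 x : weight x <= 1.
  by have := weight_decay 0 x; rewrite expr0 mul1r fact0.
have mfw f : cmeasurable f -> measurable_fun (setT : set RT) (fun x => normc (f x) * weight x).
  by move=> mf; apply: measurable_funM; [exact: cmeas_normc mf|exact: measurable_weight].
have fw0 f x : 0 <= normc (f x) * weight x.
  by apply: mulr_ge0; [exact: normc_ge0|exact: weight_ge0].
have E f : cmeasurable f -> forall u : R -> R, rint (setT : set RT) u ->
    (forall x, normc (f x) * weight x <= u x) ->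
    (\int[mu]_x (normc (f x) * weight x)%:E <= (\int[mu]_x u x)%:E)%E.
  move=> mf u iu H.
  have ih : rint (setT : set RT) (fun x => normc (f x) * weight x).
    apply: rint_le iu => //; first exact: mfw.
    by move=> x _; rewrite ger0_norm.
  have -> : (\int[mu]_x (normc (f x) * weight x)%:E)%E =
      (\int[mu]_x (normc (f x) * weight x))%:E.
    by rewrite fineK //; apply: integrable_fin_num.
  by rewrite lee_fin; apply: ler_Rint.
case=> [->|[->|->]] B.
- exists B => f mf fB; have [i1 H1] := cLnorm1_le mf fB.
  apply: (@le_trans _ _ (\int[mu]_x normc (f x))%:E); last by rewrite lee_fin.
  by apply: E => // x; rewrite ler_piMr ?normc_ge0.
- exists (B ^+ 2 + \int[mu]_x weight x) => f mf fB; have [i1 H1] := cLnorm2_le mf fB.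
  apply: (@le_trans _ _ (\int[mu]_x (normc (f x) ^+ 2 + weight x))%:E).
    apply: E => //; first exact: rintD.
    move=> x; have := w1 x; have := weight_ge0 x; have := sqr_ge0 (normc (f x) - 1 / 2).
    by move: (normc _) (weight x) => a t; nra.
  by rewrite lee_fin RintegralD // lerD2r.
exists (B * \int[mu]_x weight x) => f mf fB.
have B0 : 0 <= B by rewrite -lee_fin; apply: le_trans fB; exact: cLnorm_ge0.
have [i1 H1] := ae_rint_mul B0 mf (elimT (cLnormyP _ _) fB) iw (@weight_ge0 R).
rewrite -lee_fin in H1; apply: le_trans H1.
apply: (@le_trans _ _ (\int[mu]_x (weight x * normc (f x)))%:E); last by [].
by apply: E => // x; rewrite mulrC.
Qed.

End LpNorms.

Section UpperBound.
Context {R : realType}.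
Local Notation mu := (@lebesgue_measure R).
Local Notation RT := (measurableTypeR R).
Implicit Types (x y : R) (h : R[i] -> R[i]) (p q : \bar R).

Lemma Hspace_strip_holo p q h : Hspace p q h -> strip_holo h.
Proof. by move=> [hh _] x y y01; apply/derivable_cdiffP; apply: hh. Qed.

(** At each height some splitting $h_y=f+g$ has cost below a fixed [B]. The factors $(1-y)^{-1}$ and
    $y^{-1}$ are at least 1, so the norms of $f$ and $g$ are below [B] uniformly in [y], and
    [Lp_weight] applies to both. *)
Lemma Hspace_weighted_bound p q h :
  p = 1%E \/ p = 2%:E \/ p = +oo%E -> q = 1%E \/ q = 2%:E \/ q = +oo%E ->
  Hspace p q h -> exists M, weighted_bound h M.
Proof.
move=> Hp Hq Hh; have sh := Hspace_strip_holo Hh; case: Hh => _ Hn.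
have [B HB] : exists B : R, forall y, 0 < y < 1 -> (sumnorm p q y (hline h y) < B%:E)%E.
  have [B0 HB0] : exists B : R, (Hnorm p q h <= B%:E)%E.
    case: (Hnorm p q h) Hn => [r _|//|_]; first by exists r.
    by exists 0; rewrite leNye.
  exists (B0 + 1) => y y01; apply: (@le_lt_trans _ _ B0%:E); last by rewrite lte_fin ltrDl.
  apply: le_trans HB0; apply: ereal_sup_ubound => /=.
  by exists y => //; rewrite in_itv.
have [Kp HKp] := Lp_weight Hp B; have [Kq HKq] := Lp_weight Hq B.
exists (Kp + Kq) => y y01; have /andP[y0 y1] := y01.
have := HB y y01; rewrite /sumnorm => /ereal_inf_lt[_ /= [f [g [mf mg fg ->]]] Hlt].
have nf : (0 <= ((1 - y)^-1)%:E * cLnorm p f)%E.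
  by rewrite mule_ge0 ?cLnorm_ge0 // lee_fin invr_ge0; lra.
have ng : (0 <= (y^-1)%:E * cLnorm q g)%E.
  by rewrite mule_ge0 ?cLnorm_ge0 // lee_fin invr_ge0; lra.
have fB : (cLnorm p f <= B%:E)%E.
  apply: (@le_trans _ _ (((1 - y)^-1)%:E * cLnorm p f)%E).
    rewrite -{1}[cLnorm p f]mul1e lee_wpmul2r ?cLnorm_ge0 // lee_fin.
    by rewrite invf_ge1; lra.
  by apply: le_trans (ltW Hlt); rewrite leeDl.
have gB : (cLnorm q g <= B%:E)%E.
  apply: (@le_trans _ _ ((y^-1)%:E * cLnorm q g)%E).
    rewrite -{1}[cLnorm q g]mul1e lee_wpmul2r ?cLnorm_ge0 // lee_fin.
    by rewrite invf_ge1; lra.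
  by apply: le_trans (ltW Hlt); rewrite leeDr.
have mw := @measurable_weight R.
have m (k : R -> R[i]) : cmeas (setT : set RT) k ->
    measurable_fun (setT : set RT) (fun x => (normc (k x) * weight x)%:E).
  move=> mk; apply/measurable_EFinP; apply: measurable_funM => //; exact: cmeas_normc mk.
have k0 (k : R -> R[i]) x : (0 <= (normc (k x) * weight x)%:E)%E.
  by rewrite lee_fin; apply: mulr_ge0; [exact: normc_ge0|exact: weight_ge0].
rewrite EFinD; apply: le_trans (leeD (HKp f mf fB) (HKq g mg gB)).
rewrite -ge0_integralD //; [|exact: m|exact: m].
apply: ge0_le_integral => //.
- by move=> x _; exact: (k0 (fun x => h (x +i* y))).
- by apply: m; exact: cmeas_line.
- by apply: emeasurable_funD; exact: m.
move=> x _; rewrite -EFinD lee_fin -mulrDl.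
apply: ler_wpM2r; first exact: weight_ge0.
by have := fg x; rewrite /hline => <-; exact: ler_normcD.
Qed.

End UpperBound.

(** * From a boundary profile to a bound at a point *)

Section HarmonicMajorant.
Context {R : realType}.
Local Notation mu := (@lebesgue_measure R).
Local Notation RT := (measurableTypeR R).
Implicit Types (x y : R) (h : R[i] -> R[i]) (f : R -> R[i]).

Lemma cvg_normc (F : set_system R) {FF : Filter F} (u : R -> R[i]) (l : R[i]) (e : R) :
  (u y : R[i]^o) @[y --> F] --> (l : R[i]^o) -> 0 < e ->
  \forall y \near F, normc (u y - l) <= e.
Proof.
move=> /cvgrPdist_le/(_ e%:C); rewrite ltcR => H /H {}H.
apply: filterS H => y; rewrite normr_normc lecR.
by rewrite normcBC.
Qed.

Lemma tempered_line_limit0 h f phi : tempered_cvg (0^'+) (hline h) f -> schwartz phi ->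
  line_limit 0 (fun y x => h (x +i* y) * phi x) (pairing f phi).
Proof.
move=> hf /hf H e e0; have : \forall y \near 0^'+, normc (pairing (hline h y) phi - pairing f phi) <= e.
  exact: cvg_normc H e0.
rewrite near_withinE => /nbhs_ballP[d /= d0 Hd]; exists (d / 2); first by rewrite divr_gt0.
move=> y /andP[y0 _] yd; apply: Hd => //.
by rewrite /ball /= distrC; apply: le_lt_trans yd _; rewrite ltr_pdivrMr // ltr_pMr // ltr1n.
Qed.

Lemma tempered_line_limit1 h f phi : tempered_cvg (1^'-) (hline h) f -> schwartz phi ->
  line_limit 1 (fun y x => h (x +i* y) * phi x) (pairing f phi).
Proof.
move=> hf /hf H e e0; have : \forall y \near 1^'-, normc (pairing (hline h y) phi - pairing f phi) <= e.
  exact: cvg_normc H e0.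
rewrite near_withinE => /nbhs_ballP[d /= d0 Hd]; exists (d / 2); first by rewrite divr_gt0.
move=> y /andP[_ y0] yd; apply: Hd => //.
by rewrite /ball /= distrC; apply: le_lt_trans yd _; rewrite ltr_pdivrMr // ltr_pMr // ltr1n.
Qed.

Variables (z0 : R[i]) (h : R[i] -> R[i]) (M : R) (f0 f1 : R -> R[i]).
Hypotheses (z01 : 0 < complex.Im z0 < 1) (hh : strip_holo h) (hM : weighted_bound h M).
Let w := wexp z0.
Let w0 : 0 < complex.Im w := Im_wexp_gt0 z01.
Local Notation P0 := (pker (complex.Re w) (complex.Im w)).
Local Notation P1 := (pker (- complex.Re w) (complex.Im w)).

Lemma normc_phi0 p x : normc (phi w p (x +i* 0)) =
  P0 x * expR (- complex.Re p.[zline w x false]).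
Proof.
rewrite phiE normcM ker_line0 // normc_real (gtr0_norm (pker_gt0 _ _ w0)) normc_cexp.
by rewrite ReN.
Qed.

Lemma normc_phi1 p x : normc (phi w p (x +i* 1)) =
  P1 x * expR (- complex.Re p.[zline w x true]).
Proof.
rewrite phiE normcM ker_line1 // normc_real normrN (gtr0_norm (pker_gt0 _ _ w0)) normc_cexp.
by rewrite ReN.
Qed.

Variables (k c c' s : R).
Hypotheses (k0 : 0 < k) (s1 : `|s| = 1).
Local Notation v0 x := (profile k c c' (s * P0 x)).
Local Notation v1 x := (profile k c c' (- s * P1 x)).

Hypothesis i0 : rint (setT : set RT) (fun x => P0 x * v0 x).
Hypothesis i1 : rint (setT : set RT) (fun x => P1 x * v1 x).
Hypotheses (mf0 : cmeasurable f0) (mf1 : cmeasurable f1).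
Hypotheses (tf0 : tempered_cvg (0^'+) (hline h) f0) (tf1 : tempered_cvg (1^'-) (hline h) f1).
Hypothesis if0 : rint (setT : set RT) (fun x => P0 x * expR (- v0 x) * normc (f0 x)).
Hypothesis if1 : rint (setT : set RT) (fun x => P1 x * expR (- v1 x) * normc (f1 x)).
Hypothesis f01 : \int[mu]_x (P0 x * expR (- v0 x) * normc (f0 x)) +
  \int[mu]_x (P1 x * expR (- v1 x) * normc (f1 x)) <= 1.

(** The polynomials lie above the profile, so $\exp(-\mathrm{Re}\,p_n)\le\exp(-v)$ and [f01] bounds
    the two boundary integrals by 1 for every [n]. Only $\mathrm{Re}\,p_n(0)$ is passed to the
    limit. *)
Lemma harmonic_majorant :
  normc (h z0) <= expR (\int[mu]_x (P0 x * v0 x) + \int[mu]_x (P1 x * v1 x)).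
Proof.
have vi top : rint (setT : set RT)
    (fun x => `|density w x top| * profile k c c' (s * density w x top)).
  case: top; [apply: rint_eq i1|apply: rint_eq i0] => // x _; rewrite (density_abs z01) //.
  by rewrite /density mulrN mulNr.
have [p [B [pB pv _ p0]]] := outer_sequence z01 k0 s1 vi.
have E1 : (fun x => P1 x * profile k c c' (s * density w x true)) = (fun x => P1 x * v1 x).
  by apply/funext => x; rewrite /density mulrN mulNr.
rewrite E1 in p0.
have key n : normc (h z0) <= expR (complex.Re (p n).[0]).
  have L0 := tempered_line_limit0 tf0 (schwartz_phi0 (p n) z01).
  have L1 := tempered_line_limit1 tf1 (schwartz_phi1 (p n) z01).
  have := strip_representation hh hM z01 L0 L1 => /(congr1 (@normc R)).
  rewrite normcM normc_cexp ReN => Ez.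
  suff : normc (h z0) * expR (- complex.Re (p n).[0]) <= 1.
    by rewrite expRN ler_pdivrMr ?expR_gt0 // mul1r.
  rewrite Ez; apply: le_trans (ler_normcB _ _) _; apply: le_trans f01; apply: lerD.
    apply: normc_cintegral_le => //.
      apply: cmeasM; [exact: measurableT|by []|apply: phi_line_cmeas => //].
        by rewrite lexx ler01.
      by move: z01 => /andP[+ _]; move/lt_eqF ->.
    move=> x _; rewrite normcM mulrC normc_phi0.
    apply: ler_wpM2r; first exact: normc_ge0.
    apply: ler_wpM2l; first exact: ltW (pker_gt0 _ _ w0).
    by rewrite ler_expR lerN2; have /andP[] := pB n x false.
  apply: normc_cintegral_le => //.
    apply: cmeasM; [exact: measurableT|by []|apply: phi_line_cmeas => //].
      by rewrite lexx ler01.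
    by move: z01 => /andP[_ +]; move/gt_eqF ->.
  move=> x _; rewrite normcM mulrC normc_phi1.
  apply: ler_wpM2r; first exact: normc_ge0.
  apply: ler_wpM2l; first exact: ltW (pker_gt0 _ _ w0).
  rewrite ler_expR lerN2; have /andP[+ _] := pB n x true.
  by rewrite /density mulrN mulNr.
have cE : expR (complex.Re (p n).[0]) @[n --> \oo] -->
    expR (\int[mu]_x (P0 x * v0 x) + \int[mu]_x (P1 x * v1 x)).
  by apply: continuous_cvg p0; exact: continuous_expR.
by apply: (@ler_cvg_to _ _ _ _ (cst (normc (h z0))) _ _ _ (cvg_cst _) cE); apply: nearW.
Qed.

End HarmonicMajorant.

(** * The Clausen function, entropies and the dilogarithm *)

Section ImproperIntegrals.
Context {R : realType}.
Local Notation mu := (@lebesgue_measure R).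
Local Notation RT := (measurableTypeR R).
Implicit Types (a b x t : R) (f F : R -> R).

Lemma measurable_continuous_oo f a b : (forall x, a < x < b -> {for x, continuous f}) ->
  measurable_fun (`]a, b[ : set RT) f.
Proof.
move=> cf; apply: subspace_continuous_measurable_fun => //.
by apply: continuous_in_subspaceT => x; rewrite inE /= in_itv /=; exact: cf.
Qed.

(** As in [FTC_line], positivity turns the limits of the primitive into integrability. The integrand
    may be singular at the ends, which form a null set. *)
Lemma FTC_oo f F a b (l1 l2 : R) : a < b ->
  (forall x, a < x < b -> {for x, continuous f}) -> (forall x, a < x < b -> 0 <= f x) ->
  (forall x, a < x < b -> is_derive x (1 : R) F (f x)) ->
  F x @[x --> a^'+] --> l1 -> F x @[x --> b^'-] --> l2 ->
  rint (`[a, b] : set RT) f /\ \int[mu]_(x in `[a, b]) f x = l2 - l1.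
Proof.
move=> ab cf f0 dF F1 F2.
have mo := measurable_continuous_oo cf.
have mc : measurable_fun (`[a, b] : set RT) f by exact: measurable_fun_itv_cc mo.
(* With [n.+3] twice the margin stays below [b - a] already for [n = 0], so the truncated interval
   is never degenerate. *)
pose d (n : nat) := (b - a) / n.+3%:R.
have d0 n : 0 < d n by rewrite divr_gt0 ?subr_gt0 // ltr0n.
have d1 n : d n * 2 < b - a.
  by rewrite mulrAC ltr_pdivrMr ?ltr0n // ltr_pM2l ?subr_gt0 // ltr_nat.
have dcvg : d n @[n --> \oo] --> 0.
  rewrite -[0](mulr0 (b - a)); apply: cvgM; first exact: cvg_cst.
  have := @cvg_harmonic R; rewrite -(cvg_shiftn 2) /harmonic.
  by under eq_fun do rewrite addn2.
pose A n := a + d n; pose B n := b - d n.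
have dn m n : (m <= n)%N -> d n <= d m.
  move=> mn; rewrite ler_pM2l ?subr_gt0 // lef_pV2 ?posrE ?ltr0n //.
  by rewrite ler_nat.
have cup : \bigcup_n [set` `[A n, B n]] = `]a, b[%classic.
  apply/seteqP; split => x /=.
    move=> [n _ /=]; rewrite !in_itv /= /A /B; have := d0 n; lra.
  rewrite in_itv /= => /andP[ax xb].
  have : \forall n \near \oo, d n <= Num.min (x - a) (b - x).
    have m0 : 0 < Num.min (x - a) (b - x) by rewrite lt_min !subr_gt0 ax.
    move/cvgrPdist_le : dcvg => /(_ _ m0); apply: filterS => n.
    by rewrite sub0r normrN gtr0_norm.
  move=> [n _ Hn]; exists n => //=; rewrite in_itv /= /A /B.
  by have := Hn n (leqnn n); rewrite le_min => /andP[]; lra.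
have AB n : A n < B n by rewrite /A /B; have := d1 n; lra.
have inab n x : A n <= x <= B n -> a < x < b by rewrite /A /B; have := d0 n; lra.
have I n : \int[mu]_(x in `[A n, B n]) f x = F (B n) - F (A n).
  have cF x : a < x < b -> {for x, continuous F}.
    by move=> /dF H; apply/differentiable_continuous/derivable1_diffP; exact: ex_derive.
  rewrite /Rintegral (continuous_FTC2 (F := F) (AB n)) //=.
  - apply: continuous_in_subspaceT => x; rewrite inE /= in_itv /= => /inab; exact: cf.
  - split.
    + move=> x; rewrite in_itv /= => /andP[x1 x2]; have H : a < x < b.
        by apply: (inab n); rewrite !ltW.
      by have := dF x H => ?; exact: ex_derive.
    + by apply: cvg_at_right_filter; apply: cF; apply: (inab n); rewrite lexx ltW.
    + by apply: cvg_at_left_filter; apply: cF; apply: (inab n); rewrite lexx ltW.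
  - move=> x; rewrite in_itv /= => /andP[x1 x2]; have H : a < x < b.
      by apply: (inab n); rewrite !ltW.
    by have := dF x H => ?; rewrite derive1E derive_val.
have ri n : rint (`[A n, B n] : set RT) f by apply: continuous_rint => x /inab; exact: cf.
have H1 : (\int[mu]_(x in `[A n, B n]) (f x)%:E)%E @[n --> \oo] -->
    (\int[mu]_(x in `]a, b[) (f x)%:E)%E.
  rewrite -cup; apply: ge0_nondecreasing_set_cvg_integral.
  - move=> m n mn; apply/subsetPset; apply: subset_itv; rewrite bnd_simp /A /B.
      by rewrite lerD2l dn.
    by rewrite lerD2l lerN2 dn.
  - by move=> n; exact: measurable_itv.
  - by move=> n; exact: (measurable_int _ (ri n)).
  - by move=> n x; rewrite /= in_itv /= => /inab H; rewrite lee_fin f0.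
have H2 : (\int[mu]_(x in `[A n, B n]) (f x)%:E)%E @[n --> \oo] --> (l2 - l1)%:E.
  have -> : (fun n : nat => \int[mu]_(x in `[A n, B n]) (f x)%:E)%E =
      EFin \o (fun n : nat => F (B n) - F (A n)).
    by apply/funext => n /=; rewrite -I fineK //; apply: integrable_fin_num => //; exact: ri.
  apply: cvg_EFin; [near=> n => //|].
  apply: cvgB.
    move/cvg_at_leftP : F2; apply; split => [n|]; first by rewrite /B gtrBl.
    by rewrite -[X in _ --> X]subr0; apply: cvgB => //; exact: cvg_cst.
  move/cvg_at_rightP : F1; apply; split => [n|]; first by rewrite /A ltrDl.
  by rewrite -[X in _ --> X]addr0; apply: cvgD => //; exact: cvg_cst.
have E : (\int[mu]_(x in `[a, b]) (f x)%:E)%E = (l2 - l1)%:E.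
  rewrite (@integral_itv_bndoo _ a b (EFin \o f) true false); last exact/measurable_EFinP.
  exact: cvg_unique H1 H2.
split; last by rewrite /Rintegral E.
apply/integrableP; split; first exact/measurable_EFinP.
rewrite (_ : (\int[mu]_(x in _) _)%E = (l2 - l1)%:E) ?ltry //.
rewrite -E (@integral_itv_bndoo _ a b (EFin \o f) true false); last exact/measurable_EFinP.
rewrite (@integral_itv_bndoo _ a b _ true false); last first.
  by apply/measurable_EFinP; apply: measurableT_comp => //; exact: mo.
by apply: eq_integral => x; rewrite inE /= in_itv /= => /f0 H; rewrite ger0_norm.
Unshelve. all: by end_near. Qed.

(** The inequality $\ln y<y$ at $y=x^{-1/2}$ gives $-\ln x\le2x^{-1/2}$. *)
Lemma xlnx_bound x : 0 < x -> x <= 1 -> `|x * ln x| <= 2 * Num.sqrt x.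
Proof.
move=> x0 x1; have s0 : 0 < Num.sqrt x by rewrite sqrtr_gt0.
have sE : Num.sqrt x ^+ 2 = x by rewrite sqr_sqrtr // ltW.
have l0 : ln x <= 0 by exact: ln_le0.
have H : - ln x <= 2 / Num.sqrt x.
  rewrite -sE lnXn // -mulNrn -lnV ?posrE // mulr2n.
  have := @ln_sublinear R (Num.sqrt x)^-1; rewrite invr_gt0 => /(_ s0).
  by rewrite sqrtr_sqr gtr0_norm //; move: (ln _) => u; lra.
rewrite ler0_norm ?mulr_ge0_le0 ?(ltW x0) // -mulrN -{1}sE expr2 -mulrA.
rewrite [leRHS]mulrC ler_pM2l //.
by have := ler_wpM2l (ltW s0) H; rewrite mulrCA divff ?gt_eqF // mulr1.
Qed.

Lemma cvg_xlnx : x * ln x @[x --> 0^'+] --> (0 : R).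
Proof.
have s : 2 * Num.sqrt x @[x --> 0^'+] --> (0 : R).
  have s0 : Num.sqrt x @[x --> (0 : R)^'+] --> Num.sqrt (0 : R).
    by apply: cvg_at_right_filter; exact: sqrt_continuous.
  by rewrite sqrtr0 in s0; rewrite -[X in _ --> X](mulr0 2); apply: cvgM => //; exact: cvg_cst.
apply/cvgrPdist_le => e e0; move/cvgrPdist_le : s => /(_ _ e0) s.
near=> x; rewrite sub0r normrN; apply: le_trans (xlnx_bound _ _) _; first 2 last.
- by apply: le_trans (ler_norm _) _; rewrite -normrN -sub0r; near: x; exact: s.
- by near: x; exact: nbhs_right_gt.
- by near: x; exact: nbhs_right_le.
Unshelve. all: by end_near. Qed.

(** Since $\ln x<x$, the constant [c] makes the integrand nonnegative on $(0,c)$, as [FTC_oo]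
    demands. *)
Lemma rint_ln c : 0 < c -> rint (`[0, c] : set RT) (fun x => c - ln x).
Proof.
move=> c0.
have cl x : 0 < x < c -> {for x, continuous (fun x => c - ln x)}.
  by move=> /andP[x0 _]; apply: cvgB; [exact: cvg_cst|exact: continuous_ln].
apply: (@FTC_oo _ (fun x => (c + 1) * x - x * ln x) 0 c 0
  ((c + 1) * c - c * ln c) c0 cl _ _ _ _).1.
- move=> x /andP[x0 xc]; rewrite subr_ge0; apply: ltW; apply: lt_trans xc.
  exact: ln_sublinear.
- move=> x /andP[x0 _]; have dl := is_derive1_ln x0.
  have -> : (fun x => (c + 1) * x - x * ln x) = (c + 1) \*: id - id * (@ln R).
    by apply/funext => t.
  apply: is_derive_eq; rewrite /GRing.scale /= divff ?gt_eqF //; ring.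
- rewrite -[X in _ --> X](subrr 0); apply: cvgB; last exact: cvg_xlnx.
  rewrite -[X in _ --> X](mulr0 (c + 1)); apply: cvgM; first exact: cvg_cst.
  by apply: cvg_at_right_filter; exact: cvg_id.
apply: cvg_at_left_filter; apply: cvgB; apply: cvgM => //; try exact: cvg_cst.
exact: continuous_ln.
Qed.

End ImproperIntegrals.

(** * Functional equations of the Clausen function *)

Section Clausen.
Context {R : realType}.
Local Notation mu := (@lebesgue_measure R).
Local Notation RT := (measurableTypeR R).
Implicit Types (a b x t : R) (f F : R -> R).

Lemma sin_piB x : sin (pi - x) = sin x.
Proof. by rewrite sinB sinpi cospi mul0r sub0r mulN1r opprK. Qed.

Lemma sin_pihalfB x : sin (pi / 2 - x) = cos x.
Proof. by rewrite sinB sin_pihalf cos_pihalf mul1r mul0r subr0. Qed.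

Definition lsin x : R := ln (2 * `|sin (x / 2)|).

Lemma sin_half_gt0 x : 0 < x < 2 * pi -> 0 < sin (x / 2).
Proof.
move=> /andP[x0 x1]; rewrite sin_gt0_pi // divr_gt0 //= ltr_pdivrMr //.
by rewrite mulrC.
Qed.

Lemma lsinE x : 0 < x < 2 * pi -> lsin x = ln (2 * sin (x / 2)).
Proof. by move=> /sin_half_gt0 s0; rewrite /lsin gtr0_norm. Qed.

Lemma continuous_lsin x : 0 < x < 2 * pi -> {for x, continuous lsin}.
Proof.
move=> x0; have s0 := sin_half_gt0 x0.
apply: (@continuous_comp _ _ _ (fun x => 2 * `|sin (x / 2)|) (@ln R)); last first.
  by apply: continuous_ln; rewrite mulr_gt0 // normr_gt0 gt_eqF.
apply: cvgM; first exact: cvg_cst.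
apply: cvg_norm; apply: (@continuous_comp _ _ _ (fun x => x / 2) (@sin R)).
  by apply: cvgM => //; exact: cvg_cst.
exact: continuous_sin.
Qed.

(** Near 0 the inequality $\sin(x/2)\ge x/4$ compares [lsin] with the integrable $\ln x$. From 1 to
    [a], still to the left of the second singularity $2\pi$, continuity gives a bound. *)
Lemma rint_lsin a : 1 <= a -> a < 2 * pi -> rint (`[0, a] : set RT) lsin.
Proof.
move=> a1 a2; have a0 := lt_le_trans ltr01 a1.
have cl x : 0 < x < a -> {for x, continuous lsin}.
  by move=> /andP[x0 x1]; apply: continuous_lsin; rewrite x0 (lt_trans x1).
have ml : measurable_fun (`[0, a] : set RT) lsin.
  exact: measurable_fun_itv_cc (measurable_continuous_oo cl).
have [m] : exists m, forall x, 1 <= x <= a -> `|lsin x| <= m.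
  have [|c _ Hc] := @EVT_max _ (fun x => `|lsin x|) 1 a a1.
    apply: continuous_in_subspaceT => x; rewrite inE /= in_itv /= => /andP[x1 xa].
    apply: cvg_norm; apply: continuous_lsin.
    by rewrite (lt_le_trans ltr01 x1) (le_lt_trans xa).
  by exists `|lsin c| => x x1; apply: Hc; rewrite in_itv.
move=> Hm; have [l Hl] : exists l, `|lsin 0| <= l by exists `|lsin 0|.
have il := rint_ln a0.
pose K := `|m| + `|l| + 2 * ln 2.
have ln20 : 0 <= ln 2 :> R by apply: ln_ge0; rewrite ler1n.
have nm := normr_ge0 m; have nl := normr_ge0 l.
have nm' := ler_norm m; have nl' := ler_norm l.
apply: (@rint_le _ _ _ (fun x => (a - ln x) + K)) => //; last first.
  by apply: rintD => //; exact: rint_cst.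
move=> x; rewrite /= in_itv /= => /andP[x0 xa]; move: x0; rewrite le_eqVlt => /orP[/eqP <-|x0].
  (* [ln 0] is 0 by convention; at this end the estimate rests on [l]. *)
  by rewrite ln0 // subr0 /K; lra.
have lx : ln x <= a by apply: ltW; apply: lt_le_trans xa; exact: ln_sublinear.
have [x1|x1] := leP 1 x; first by have := Hm x; rewrite x1 xa => /(_ isT); rewrite /K; lra.
have xpi : 0 < x < 2 * pi by rewrite x0 (le_lt_trans xa).
have s0 := sin_half_gt0 xpi; rewrite lsinE //.
have s1 : 2 * sin (x / 2) <= 2 by have := sin_le1 (x / 2); lra.
have s2 : x / 2 <= 2 * sin (x / 2).
  have := sin_sub_le (x / 2); rewrite ler_norml => /andP[h _]; nra.
have l1 : ln (2 * sin (x / 2)) <= ln 2 by rewrite ler_ln ?posrE // mulr_gt0.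
have l2 : ln x - ln 2 <= ln (2 * sin (x / 2)).
  by rewrite -ln_div ?posrE // ler_ln ?posrE // ?divr_gt0 // mulr_gt0.
by rewrite ler_norml /K; apply/andP; split; lra.
Qed.

(* The interval is empty for [x < 0], so that [clausen] vanishes there and is
   continuous at [0]. *)
Definition lsin_primitive x : R := \int[mu]_(t in `[0, x]) lsin t.
Definition clausen x : R := - lsin_primitive x.

Lemma CI2E x : 0 <= x -> CI2 x = clausen x.
Proof.
rewrite le_eqVlt => /orP[/eqP <-|x0]; rewrite /CI2 /clausen /lsin_primitive /oriented_integral.
  by rewrite !set_itv1 !Rintegral_set1 subrr.
by rewrite (@set_itv_ge _ _ (BLeft x)) ?Rintegral_set0 ?subr0 // bnd_simp -ltNge.
Qed.

Lemma clausen0 : clausen 0 = 0.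
Proof. by rewrite /clausen /lsin_primitive set_itv1 Rintegral_set1 oppr0. Qed.

Lemma derive1_is_derive F x (l : R) : derivable F x 1 -> F^`()%classic x = l ->
  is_derive x (1 : R) F l.
Proof. by move=> dF <-; rewrite derive1E; exact: derivableP. Qed.

Lemma is_derive_clausen x : 0 < x < 2 * pi ->
  is_derive x (1 : R) clausen (- ln (2 * sin (x / 2))).
Proof.
move=> xpi; have /andP[x0 x1] := xpi.
pose u := Num.max 1 ((x + 2 * pi) / 2).
have p2 := @pi_ge2 R.
have u1 : 1 <= u by rewrite le_max lexx.
have u2 : u < 2 * pi by rewrite gt_max; apply/andP; split; lra.
have xu : x < u by rewrite lt_max; apply/orP; right; lra.
have [d1 d2] : derivable lsin_primitive x 1 /\ lsin_primitive^`()%classic x = lsin x.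
  exact: continuous_FTC1_closed xu (rint_lsin u1 u2) x0 (continuous_lsin xpi).
rewrite -(lsinE xpi); exact: (is_deriveN (derive1_is_derive d1 d2)).
Qed.

Lemma continuous_clausen x : 0 <= x < 2 * pi -> {for x, continuous clausen}.
Proof.
have p2 := @pi_ge2 R.
move=> /andP[]; rewrite le_eqVlt => /orP[/eqP <- _|x0 x1]; last first.
  have H : is_derive x (1 : R) clausen (- ln (2 * sin (x / 2))).
    by apply: is_derive_clausen; rewrite x0.
  by apply/differentiable_continuous/derivable1_diffP; exact: ex_derive.
have i1 : rint (`[0, 1] : set RT) lsin by apply: rint_lsin => //; lra.
have H : lsin_primitive x @[x --> 0] --> (0 : R).
  exact: (@parameterized_integral_cvg_left R 0 1 lsin ltr01 i1).
have c0 : clausen x @[x --> 0] --> - (0 : R) by exact: cvgN.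
suff : clausen x @[x --> 0] --> clausen 0 by [].
by rewrite clausen0; rewrite oppr0 in c0.
Qed.

Lemma derive0_itv f a b : a <= b -> (forall x, a < x < b -> is_derive x (1 : R) f 0) ->
  (forall x, a <= x <= b -> {for x, continuous f}) -> f a = f b.
Proof.
move=> ab df cf.
have d0 x : x \in `]a, b[ -> is_derive x (1 : R) f ((fun=> 0) x).
  by rewrite in_itv /=; exact: df.
have c0 : {within `[a, b], continuous f}.
  by apply: continuous_in_subspaceT => x; rewrite inE /= in_itv /=; exact: cf.
have [c _] := MVT_segment ab d0 c0.
by rewrite mul0r => /eqP; rewrite subr_eq0 => /eqP.
Qed.

Lemma is_derive_clausen_affine (k c x : R) : 0 < k * x + c < 2 * pi ->
  is_derive x (1 : R) (fun x => clausen (k * x + c)) (- k * ln (2 * sin ((k * x + c) / 2))).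
Proof.
move=> /is_derive_clausen dc.
have dk : is_derive x (1 : R) (fun x => k * x + c) k.
  have -> : (fun x => k * x + c) = k \*: id + cst c by apply/funext.
  by apply: is_derive_eq; rewrite addr0 /GRing.scale /= mulr1.
have := @is_derive1_comp _ clausen (fun x => k * x + c) x _ _ dc dk.
by rewrite (_ : - _ * k = - k * ln (2 * sin ((k * x + c) / 2))) // !mulNr mulrC.
Qed.

Lemma continuous_clausen_affine (k c x : R) : 0 <= k * x + c < 2 * pi ->
  {for x, continuous (fun x => clausen (k * x + c))}.
Proof.
move=> H; apply: (@continuous_comp _ _ _ (fun x => k * x + c) clausen).
  by apply: cvgD; [apply: cvgM => //; exact: cvg_cst|exact: cvg_cst].
exact: continuous_clausen.
Qed.

(** By $2\sin t=(2\sin\frac t2)(2\cos\frac t2)$ the difference of the two sides has derivative zero.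
    At 0 the two occurrences of [clausen pi] cancel, so the identity holds before that value is
    known. *)
Lemma clausen_duplication x : 0 <= x < pi ->
  clausen (2 * x) = 2 * clausen x - clausen (pi - x) + clausen (pi + x).
Proof.
have p2 := @pi_ge2 R; move=> /andP[x0 xpi].
pose f x := clausen (2 * x + 0) - 2 * clausen (1 * x + 0) + clausen (-1 * x + pi) -
  clausen (1 * x + pi).
suff : f 0 = f x.
  rewrite /f !(mulr0, add0r, addr0, mul1r, mulN1r, oppr0) clausen0 mulr0 => E.
  move: E; rewrite (addrC pi x) (addrC pi (- x)).
  move: (clausen (2 * x)) (clausen x) (clausen (- x + pi)) (clausen (x + pi)) (clausen pi).
  by move=> *; lra.
apply: (derive0_itv x0) => t /andP[t0 tx].
  have d1 : is_derive t (1 : R) (fun x => clausen (2 * x + 0)) (- 2 * ln (2 * sin ((2 * t + 0) / 2))).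
    by apply: is_derive_clausen_affine; lra.
  have d2 : is_derive t (1 : R) (fun x => clausen (1 * x + 0)) (- 1 * ln (2 * sin ((1 * t + 0) / 2))).
    by apply: is_derive_clausen_affine; lra.
  have d3 : is_derive t (1 : R) (fun x => clausen (-1 * x + pi)) (- -1 * ln (2 * sin ((-1 * t + pi) / 2))).
    by apply: is_derive_clausen_affine; lra.
  have d4 : is_derive t (1 : R) (fun x => clausen (1 * x + pi)) (- 1 * ln (2 * sin ((1 * t + pi) / 2))).
    by apply: is_derive_clausen_affine; lra.
  have := is_deriveB (is_deriveD (is_deriveB d1 (is_deriveZ 2 d2)) d3) d4.
  set e := (X in is_derive _ _ _ X); suff -> : e = 0 by [].
  rewrite /e /GRing.scale /= {e}.
  have -> : (2 * t + 0) / 2 = t / 2 + t / 2 by field.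
  have -> : (1 * t + 0) / 2 = t / 2 by field.
  have -> : (-1 * t + pi) / 2 = pi / 2 - t / 2 by move: (@pi R) => q; field.
  have -> : (1 * t + pi) / 2 = t / 2 + pi / 2 by move: (@pi R) => q; field.
  rewrite sinDpihalf sin_pihalfB sinD (mulrC (cos _)).
  have s0 : 0 < sin (t / 2) by rewrite sin_gt0_pi //; lra.
  have c0 : 0 < cos (t / 2) by rewrite cos_gt0_pihalf //; lra.
  have -> : 2 * (sin (t / 2) * cos (t / 2) + sin (t / 2) * cos (t / 2)) =
    (2 * sin (t / 2)) * (2 * cos (t / 2)) by ring.
  rewrite lnM ?posrE ?mulr_gt0 //; ring.
apply: cvgB; last by apply: continuous_clausen_affine; lra.
apply: cvgD; last by apply: continuous_clausen_affine; lra.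
apply: cvgB; first by apply: continuous_clausen_affine; lra.
by apply: cvgM; [exact: cvg_cst|apply: continuous_clausen_affine; lra].
Qed.

(** Since $\sin(\pi-\frac t2)=\sin\frac t2$, the sum of the two Clausen terms is constant on
    $(0,2\pi)$; the constant is read off at $\pi$. *)
Lemma clausen_reflection x : 0 < x < 2 * pi -> clausen (2 * pi - x) = 2 * clausen pi - clausen x.
Proof.
have p2 := @pi_ge2 R; move=> x0.
pose f x := clausen (-1 * x + 2 * pi) + clausen (1 * x + 0).
have H a b : 0 < a -> a <= b -> b < 2 * pi -> f a = f b.
  move=> a0 ab b2; apply: derive0_itv => // t /andP[t0 tx].
    have d3 : is_derive t (1 : R) (fun x => clausen (-1 * x + 2 * pi))
        (- -1 * ln (2 * sin ((-1 * t + 2 * pi) / 2))).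
      by apply: is_derive_clausen_affine; lra.
    have d4 : is_derive t (1 : R) (fun x => clausen (1 * x + 0))
        (- 1 * ln (2 * sin ((1 * t + 0) / 2))).
      by apply: is_derive_clausen_affine; lra.
    have := is_deriveD d3 d4.
    set e := (X in is_derive _ _ _ X); suff -> : e = 0 by [].
    rewrite /e {e}.
    have -> : (-1 * t + 2 * pi) / 2 = pi - t / 2 by move: (@pi R) => q; field.
    have -> : (1 * t + 0) / 2 = t / 2 by field.
    by rewrite sin_piB opprK mul1r mulN1r subrr.
  by apply: cvgD; apply: continuous_clausen_affine; lra.
have E : f pi = f x.
  by have [/H|/ltW/H] := leP x pi; [move=> <- //|move=> -> //]; lra.
move: E; rewrite /f !(mulN1r, mul1r, addr0).
have -> : - pi + 2 * pi = pi :> R by ring.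
by rewrite (addrC (- x)); lra.
Qed.

(** In duplication at $\pi-x$, rewritten by reflection, the terms in [clausen pi] drop out and [f]
    vanishes on $(0,\pi)$; its value at 0 is $-2$ times [clausen pi]. This is the classical
    $\int_0^\pi\ln(2\sin\frac u2)\,du=0$. *)
Lemma clausen_pi : clausen pi = 0.
Proof.
have p2 := @pi_ge2 R.
pose f x := 2 * clausen (1 * x + 0) - clausen (2 * x + 0) - 2 * clausen (-1 * x + pi).
have f0 x : 0 < x < pi -> f x = 0.
  move=> x0; have := @clausen_duplication (pi - x); rewrite /f.
  have -> : 2 * (pi - x) = 2 * pi - 2 * x by ring.
  have -> : pi - (pi - x) = x by ring.
  have -> : pi + (pi - x) = 2 * pi - x by ring.
  rewrite !clausen_reflection; [|lra|lra].
  move=> /(_ _); rewrite !(mulN1r, mul1r, addr0) (addrC (- x)) => H.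
  have {}H := H ltac:(lra); move: H.
  move: (clausen pi) (clausen x) (clausen (2 * x)) (clausen (pi - x)).
  by move=> *; lra.
have c1 : f x @[x --> 0^'+] --> f 0.
  apply: cvg_at_right_filter; apply: cvgB.
    apply: cvgB; last by apply: continuous_clausen_affine; lra.
    by apply: cvgM; [exact: cvg_cst|apply: continuous_clausen_affine; lra].
  by apply: cvgM; [exact: cvg_cst|apply: continuous_clausen_affine; lra].
have c2 : f x @[x --> 0^'+] --> (0 : R).
  apply: cvg_near_cst; near=> x; apply: f0; apply/andP; split; near: x.
    exact: nbhs_right_gt.
  by apply: nbhs_right_lt; lra.
have : f 0 = 0 by apply: cvg_unique c1 c2.
by rewrite /f !(mulr0, add0r, addr0) clausen0; lra.
Unshelve. all: by end_near. Qed.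

Lemma clausenN x : 0 < x < 2 * pi -> clausen (2 * pi - x) = - clausen x.
Proof. by move=> /clausen_reflection ->; rewrite clausen_pi mulr0 sub0r. Qed.

End Clausen.

(** * Entropy of the Poisson kernel *)

Section PoissonEntropy.
Context {R : realType}.
Local Notation mu := (@lebesgue_measure R).
Local Notation RT := (measurableTypeR R).
Implicit Types x : R.

Variables (s0 th : R).
Hypotheses (s0_gt0 : 0 < s0) (th0 : 0 < th) (thpi : th < pi).
Let a := s0 * cos th.
Let b := s0 * sin th.
Let sth : 0 < sin th. Proof. by rewrite sin_gt0_pi // th0. Qed.
Let b0 : 0 < b. Proof. exact: mulr_gt0. Qed.

(** Measured from the vertical, the direction of the boundary point $e^{\pi x}$ as seen from $a+ib$,
    a point of modulus [s0] and argument [th]. *)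
Definition tau_angle x : R := atan ((sx x - a) / b).

Lemma is_derive_tau x : is_derive x (1 : R) tau_angle (pi * pker a b x).
Proof.
have dsx := is_derive_sx x.
have dq : is_derive x (1 : R) (fun x => (sx x - a) / b) (pi * sx x / b).
  have -> : (fun x => (sx x - a) / b) = b^-1 \*: (@sx R - cst a).
    by apply/funext => t; rewrite mulrC.
  by apply: is_derive_eq; rewrite subr0 /GRing.scale /= mulrC.
have := @is_derive1_comp _ atan (fun x => (sx x - a) / b) x _ _ (is_derive1_atan _) dq.
set e := (X in is_derive _ _ _ X); suff -> : e = pi * pker a b x by [].
rewrite /e /pker; have d0 : 0 < (sx x - a) ^+ 2 + b ^+ 2.
  by rewrite ltr_wpDl ?sqr_ge0 // exprn_gt0.
have bn := lt0r_neq0 b0; move: (@pi R) => p; clear e dq dsx.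
by field; rewrite bn lt0r_neq0 //= addrC.
Qed.

Lemma tau_range x : - (pi / 2) < tau_angle x < pi / 2.
Proof. by rewrite /tau_angle atan_gtNpi2 atan_ltpi2. Qed.

Lemma cos_tau_gt0 x : 0 < cos (tau_angle x).
Proof. exact/cos_gt0_pihalf/tau_range. Qed.

Lemma cos_tau_sub x : cos (tau_angle x - th) = cos (tau_angle x) * sx x / s0.
Proof.
have c0 := cos_tau_gt0 x.
have t : sin (tau_angle x) = (sx x - a) / b * cos (tau_angle x).
  by rewrite -[(sx x - a) / b]atanK -/(tau_angle x) /tan divfK // lt0r_neq0.
rewrite cosB t /a /b; have := lt0r_neq0 sth; have := lt0r_neq0 s0_gt0.
by move: (cos _) (sin _) (cos _) => c s c' h1 h2; field; rewrite h1 h2.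
Qed.

Lemma sqr_cos_tau x : cos (tau_angle x) ^+ 2 = b ^+ 2 / ((sx x - a) ^+ 2 + b ^+ 2).
Proof.
have d0 : 0 < (sx x - a) ^+ 2 + b ^+ 2 by rewrite ltr_wpDl ?sqr_ge0 // exprn_gt0.
rewrite /tau_angle cos_atan exprVn sqr_sqrtr ?addr_ge0 ?sqr_ge0 //.
have bn := lt0r_neq0 b0.
by field; rewrite bn lt0r_neq0 //= addrC.
Qed.

(** One cosine comes from $\cos^2\tau=b^2/((e^{\pi x}-a)^2+b^2)$, the other absorbs [sx x] by
    [cos_tau_sub]. The logarithm of the kernel thus becomes a sum of two Clausen integrands. *)
Lemma pker_tau x : pker a b x = cos (tau_angle x) * cos (tau_angle x - th) / sin th.
Proof.
rewrite cos_tau_sub mulrA mulrA -expr2 sqr_cos_tau /pker.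
have d0 : 0 < (sx x - a) ^+ 2 + b ^+ 2 by rewrite ltr_wpDl ?sqr_ge0 // exprn_gt0.
move: d0; have -> : b = s0 * sin th by []; move: a (sx x) (sin th) sth => a' s st st0 d0.
by field; rewrite !lt0r_neq0 // mulr_gt0.
Qed.

Lemma cos_tau_sub_gt0 x : 0 < cos (tau_angle x - th).
Proof.
by rewrite cos_tau_sub divr_gt0 // mulr_gt0 ?cos_tau_gt0 ?sx_gt0.
Qed.

Lemma tau_gt x : th - pi / 2 < tau_angle x.
Proof.
have /andP[t1 t2] := tau_range x; rewrite ltNge; apply/negP => H.
have := cos_tau_sub_gt0 x.
rewrite -[cos _]opprK -cosDpi oppr_gt0 ltNge => /negP; apply.
have h0 := th0; have h1 := thpi.
by apply: cos_ge0_pihalf; apply/andP; split; have := @pi_gt0 R; lra.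
Qed.

(** The integration takes place in the angle, where $P\,dx=d\tau/\pi$; the two logarithms of cosines
    from [pker_tau] integrate to Clausen functions. The parameter [k] adds a multiple of the density
    and is chosen later to give the integrand a sign. *)
Definition entropy_primitive (k x : R) : R := pi^-1 *
  (clausen (2 * (tau_angle x - th + pi / 2)) / 2 - clausen (2 * (pi / 2 - tau_angle x)) / 2 +
   tau_angle x * k).

Lemma is_derive_entropy k x : is_derive x (1 : R) (entropy_primitive k)
  (pker a b x * (k - ln (4 * sin th) - ln (pker a b x))).
Proof.
have p0 := @pi_gt0 R; have h0 := th0; have h1 := thpi; have dt := is_derive_tau x.
have /andP[t1 t2] := tau_range x; have t3 := tau_gt x.
have c0 := cos_tau_gt0 x; have c1 := cos_tau_sub_gt0 x.
pose g (k' c : R) := fun x => clausen (k' * tau_angle x + c).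
have dg (k' c : R) : 0 < k' * tau_angle x + c < 2 * pi ->
    is_derive x (1 : R) (g k' c) (- k' * ln (2 * sin ((k' * tau_angle x + c) / 2)) *
      (pi * pker a b x)).
  move=> H; have d1 := is_derive_clausen_affine H.
  exact: (@is_derive1_comp _ (fun t => clausen (k' * t + c)) tau_angle x _ _ d1 dt).
have d1 : is_derive x (1 : R) (g 2 (pi - 2 * th))
    (- 2 * ln (2 * sin ((2 * tau_angle x + (pi - 2 * th)) / 2)) * (pi * pker a b x)).
  by apply: dg; lra.
have d2 : is_derive x (1 : R) (g (-2) pi)
    (- -2 * ln (2 * sin ((-2 * tau_angle x + pi) / 2)) * (pi * pker a b x)).
  by apply: dg; lra.
have -> : entropy_primitive k = pi^-1 \*: (2^-1 \*: g 2 (pi - 2 * th) - 2^-1 \*: g (-2) pi +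
    k \*: tau_angle).
  apply/funext => t; rewrite /entropy_primitive /g; congr (_ * (_ - _ + _)).
  - by rewrite mulrC; congr (_ * clausen _); field.
  - by rewrite mulrC; congr (_ * clausen _); field.
  - by rewrite mulrC.
apply: is_derive_eq; rewrite /GRing.scale /=.
have -> : (2 * tau_angle x + (pi - 2 * th)) / 2 = (tau_angle x - th) + pi / 2 by field.
have -> : (-2 * tau_angle x + pi) / 2 = pi / 2 - tau_angle x by field.
rewrite sinDpihalf sin_pihalfB.
have -> : ln (pker a b x) = ln (2 * cos (tau_angle x)) + ln (2 * cos (tau_angle x - th)) -
    ln (4 * sin th).
  rewrite -lnM ?posrE ?mulr_gt0 // -ln_div ?posrE ?mulr_gt0 // pker_tau; congr ln.
  have := lt0r_neq0 sth; move: (cos _) (cos _) (sin _) => c c' s s1.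
  by field.
move: (ln _) (ln _) (ln _) (pker a b x) (@pi R) p0 => l1 l2 l3 P q q0.
by field; exact: lt0r_neq0.
Qed.

Lemma tau_pinfty : tau_angle x @[x --> +oo] --> pi / 2.
Proof.
apply: (@cvg_comp _ _ _ (fun x => (sx x - a) / b) (@atan R) _ +oo%R); last first.
  exact: cvg_atan_pinfty.
apply/cvgryPge => A; near=> x; rewrite ler_pdivlMr // lerBrDr.
near: x; have /cvgryPge := @cvg_sx_pinfty R; exact.
Unshelve. all: by end_near. Qed.

Lemma tau_ninfty : tau_angle x @[x --> -oo] --> th - pi / 2.
Proof.
have -> : th - pi / 2 = atan ((0 - a) / b).
  rewrite sub0r /a /b mulNr atanN -[LHS]opprK opprB; congr (- _).
  have cn := lt0r_neq0 sth.
  have -> : s0 * cos th / (s0 * sin th) = tan (pi / 2 - th).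
    rewrite /tan sin_pihalfB cosB cos_pihalf sin_pihalf mul0r add0r mul1r.
    by field; rewrite cn lt0r_neq0.
  by rewrite tanK // in_itv /=; have h0 := th0; have h1 := thpi; lra.
apply: (@continuous_cvg _ _ _ _ _ _ (@atan R)); first exact: continuous_atan.
apply: cvgM; last exact: cvg_cst.
by apply: cvgB; [exact: cvg_sx_ninfty|exact: cvg_cst].
Qed.

Lemma entropy_primitive_cvg (F : set_system R) {FF : Filter F} k (t : R) :
  tau_angle x @[x --> F] --> t -> th - pi / 2 <= t <= pi / 2 ->
  entropy_primitive k x @[x --> F] --> pi^-1 *
    (clausen (2 * (t - th + pi / 2)) / 2 - clausen (2 * (pi / 2 - t)) / 2 + t * k).
Proof.
move=> H tt; have h0 := th0; have h1 := thpi; apply: cvgM; first exact: cvg_cst.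
apply: cvgD; last by apply: cvgM => //; exact: cvg_cst.
apply: cvgB; apply: cvgM; try exact: cvg_cst.
  apply: (@continuous_cvg _ _ _ _ _ _ clausen); first by apply: continuous_clausen; lra.
  apply: cvgM; first exact: cvg_cst.
  by apply: cvgD; [apply: cvgB => //; exact: cvg_cst|exact: cvg_cst].
apply: (@continuous_cvg _ _ _ _ _ _ clausen); first by apply: continuous_clausen; lra.
apply: cvgM; first exact: cvg_cst.
by apply: cvgB => //; exact: cvg_cst.
Qed.

Lemma integral_pker_angle : \int[mu]_x pker a b x = 1 - th / pi.
Proof.
rewrite (integral_pker _ b0).2; have := @pi_gt0 R => p0.
have -> : a / b = tan (pi / 2 - th).
  rewrite /tan sin_pihalfB cosB cos_pihalf sin_pihalf mul0r add0r mul1r /a /b.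
  by field; rewrite !lt0r_neq0.
rewrite tanK ?in_itv /=; last by have h0 := th0; have h1 := thpi; lra.
by move: (@pi R) p0 => q q0; field; exact: lt0r_neq0.
Qed.

Lemma pker_entropy :
  rint (setT : set RT) (fun x => pker a b x * ln (pker a b x)) /\
  \int[mu]_x (pker a b x * ln (pker a b x)) =
    - (pi^-1 * clausen (2 * (pi - th))) - (1 - th / pi) * ln (4 * sin th).
Proof.
have p0 := @pi_gt0 R; have h0 := th0; have h1 := thpi.
(* With this [k] the integrand is $P(\ln(1/\sin th)-\ln P)$, which is nonnegative because
   $P\le1/\sin th$, as [FTC_line] demands. *)
pose k := ln (4 * sin th) - ln (sin th).
pose u x := pker a b x * (k - ln (4 * sin th) - ln (pker a b x)).
have Pg x : 0 < pker a b x by exact: pker_gt0.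
have Ple x : pker a b x <= (sin th)^-1.
  rewrite pker_tau ler_pdivrMr // mulVf ?lt0r_neq0 //.
have u0 x : 0 <= u x.
  apply: mulr_ge0; first exact: ltW.
  have -> : k - ln (4 * sin th) = ln (sin th)^-1 by rewrite lnV ?posrE // /k; ring.
  by rewrite subr_ge0 ler_ln ?posrE ?invr_gt0.
have cu : continuous u.
  move=> x; have cP : {for x, continuous (pker a b)} by exact: continuous_pker.
  apply: cvgM => //; apply: cvgB; first exact: cvg_cst.
  by apply: (@continuous_comp _ _ _ (pker a b) (@ln R)) => //; exact: continuous_ln.
have r1 : th - pi / 2 <= th - pi / 2 <= pi / 2 by lra.
have r2 : th - pi / 2 <= (pi / 2 : R) <= pi / 2.
  by apply/andP; split; [case/andP: r1|exact: lexx].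
have [iu Iu] := FTC_line cu u0 (is_derive_entropy k)
  (entropy_primitive_cvg (k := k) tau_ninfty r1)
  (entropy_primitive_cvg (k := k) tau_pinfty r2).
have iP := (integral_pker a b0).1.
have E x : pker a b x * ln (pker a b x) = (k - ln (4 * sin th)) * pker a b x - u x.
  by rewrite /u; ring.
have ik := rintZ (k - ln (4 * sin th)) measurableT iP.
split; first by apply: rint_eq (rintB measurableT ik iu) => // x _; rewrite E.
under eq_Rint do rewrite E.
rewrite RintegralB // RintegralZl // Iu integral_pker_angle.
have -> : 2 * (pi / 2 - th + pi / 2) = 2 * (pi - th) by field.
have -> : 2 * (pi / 2 - pi / 2) = 0 :> R by ring.
have -> : 2 * (th - pi / 2 - th + pi / 2) = 0 by ring.
have -> : 2 * (pi / 2 - (th - pi / 2)) = 2 * (pi - th) by field.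
rewrite clausen0 /k; move: (clausen _) (ln _) (ln _) => c l l'.
by move: (@pi R) p0 => q q0; field; exact: lt0r_neq0.
Qed.

End PoissonEntropy.

(** * Imaginary part of the dilogarithm on the unit circle *)

Section Dilogarithm.
Context {R : realType}.
Local Notation mu := (@lebesgue_measure R).
Local Notation RT := (measurableTypeR R).
Implicit Types (t x : R) (w z : R[i]).

Lemma Arg_atan w : 0 < complex.Re w -> Arg w = atan (complex.Im w / complex.Re w).
Proof.
case: w => a b /= a0; set q := b / a.
have E : a / normc (a +i* b) = cos (atan q).
  have -> : normc (a +i* b) = a * Num.sqrt (1 + q ^+ 2).
    rewrite normcE2 /= -[a in RHS](gtr0_norm a0) -sqrtr_sqr -sqrtrM ?sqr_ge0 //.
    by congr Num.sqrt; rewrite /q; field; exact: lt0r_neq0.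
  have s0 : 0 < Num.sqrt (1 + q ^+ 2) by rewrite sqrtr_gt0 ltr_pwDl // sqr_ge0.
  rewrite cos_atan; move: (Num.sqrt _) s0 => r r0.
  by field; rewrite !lt0r_neq0.
have p0 := @pi_gt0 R.
have h1 := atan_gtNpi2 q; have h2 := atan_ltpi2 q.
rewrite /Arg /= E; case: leP => b0.
  rewrite cosK // in_itv /= -{1}(@atan0 R) le_atan ?divr_ge0 ?(ltW a0) //=; lra.
have q0 : atan q <= 0 by rewrite -(@atan0 R) le_atan // /q pmulr_lle0 ?invr_gt0 // ltW.
by rewrite cosKN ?opprK //; apply/andP; split; lra.
Qed.

Variable beta : R.
Hypotheses (b0 : 0 < beta) (b2 : beta < 2 * pi).

Lemma cos_lt1_itv : cos beta < 1.
Proof.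
have h0 := b0; have h2 := b2.
have s0 : 0 < sin (beta / 2) by apply: sin_half_gt0; rewrite h0.
have -> : cos beta = 1 - 2 * sin (beta / 2) ^+ 2.
  have {1}-> : beta = beta / 2 + beta / 2 by field.
  by rewrite cosD -!expr2 cos2sin2; ring.
by rewrite ltrBlDr ltrDl mulr_gt0 // exprn_gt0.
Qed.

Definition dilog_den t : R := 1 - t * cos beta.
(** Minus the argument of $1-te^{i\beta}$, whose real part is [dilog_den t]. *)
Definition dilog_angle t : R := atan (t * sin beta / dilog_den t).

Lemma dilog_den_gt0 t : 0 <= t <= 1 -> 0 < dilog_den t.
Proof.
rewrite /dilog_den; have := cos_lt1_itv; have := cos_geN1 beta; move: (cos beta) => c h1 h2 h.
nra.
Qed.

Lemma Im_Li2 : complex.Im (Li2 (expi beta)) =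
  - \int[mu]_(t in `[0, 1]) (- (dilog_angle t / t)).
Proof.
have zn : expi beta != 0.
  apply/eqP => /(congr1 (@normc R)) /eqP; rewrite normc0 normcE2 /= cos2Dsin2 sqrtr1.
  by rewrite oner_eq0.
rewrite /Li2 ImN /segment_integral.
have E t : `[0, 1]%classic t -> complex.Im (Log (1 - t%:C * expi beta) / (t%:C * expi beta) *
    expi beta) = - (dilog_angle t / t).
  move=> t01'; have {t01'}t01 : 0 <= t <= 1 by move: t01'; rewrite /= in_itv.
  (* At 0 both sides vanish, the inverse of 0 being 0. *)
  have [->|t0] := eqVneq t 0.
    by rewrite (_ : 0%:C = 0) // (mul0r (expi beta)) !invr0 !mulr0 mul0r oppr0.
  have tC : t%:C != 0 by rewrite fmorph_eq0.
  have -> (L : R[i]) : L / (t%:C * expi beta) * expi beta = L * (t^-1)%:C.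
    by rewrite fmorphV; field; rewrite zn tC.
  have d0 := dilog_den_gt0 t01.
  have Rw : complex.Re (1 - t%:C * expi beta) = dilog_den t.
    by rewrite ReB ReM /= mul0r subr0.
  have Iw : complex.Im (1 - t%:C * expi beta) = - (t * sin beta).
    by rewrite ImB ImM /= mul0r addr0 sub0r.
  rewrite ImM /= mulr0 add0r Arg_atan; last by rewrite Rw.
  by rewrite Rw Iw mulNr atanN mulNr.
by congr (- _); exact: (eq_Rint E).
Qed.

Lemma is_derive_dilog_angle t : 0 <= t <= 1 -> exists d, is_derive t (1 : R) dilog_angle d.
Proof.
move=> /dilog_den_gt0 d0; have dn := lt0r_neq0 d0.
have dD : is_derive t (1 : R) dilog_den (- cos beta).
  have -> : dilog_den = cst 1 - (cos beta \*: id).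
    by apply/funext => x; rewrite /dilog_den mulrC.
  by apply: is_derive_eq; rewrite /GRing.scale /= mulr1 sub0r.
have dV := is_deriveV dn dD.
have dq := is_deriveM (is_deriveZ (sin beta) (is_derive_id t (1 : R))) dV.
have := @is_derive1_comp _ atan _ t _ _ (is_derive1_atan _) dq.
set e := (X in is_derive _ _ _ X) => H; exists e.
have -> // : dilog_angle = atan \o (sin beta \*: id * fun y => (dilog_den y)^-1).
by apply/funext => x; rewrite /dilog_angle mulrC (mulrC _ (sin beta)) mulrC.
Qed.

Lemma continuous_dilog_angle t : 0 <= t <= 1 -> {for t, continuous dilog_angle}.
Proof.
move=> /is_derive_dilog_angle[d dA].
by apply/differentiable_continuous/derivable1_diffP; exact: ex_derive.
Qed.

(** The law of sines in the triangle with vertices $0$, $1$, $te^{i\beta}$: the angle at 1 is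
    [dilog_angle t], the angle at 0 is $\beta$. *)
Lemma sin_dilog_angle t : 0 <= t <= 1 -> sin (dilog_angle t) = t * sin (dilog_angle t + beta).
Proof.
move=> /dilog_den_gt0 d0.
have c0 : 0 < cos (dilog_angle t).
  by apply: cos_gt0_pihalf; rewrite atan_gtNpi2 atan_ltpi2.
have E : sin (dilog_angle t) = t * sin beta / dilog_den t * cos (dilog_angle t).
  by rewrite -[t * sin beta / dilog_den t]atanK -/(dilog_angle t) /tan divfK // lt0r_neq0.
have D1 := lt0r_neq0 d0; rewrite sinD E; apply: (mulIf D1).
have : dilog_den t = 1 - t * cos beta by [].
move: (dilog_den t) (cos (dilog_angle t)) (sin beta) (cos beta) D1 => D c s k D1 DE.
transitivity (t * s * c * (t * k + D)); last by field.
by rewrite DE; field; rewrite -DE.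
Qed.

Lemma dilog_angle_half : dilog_angle 1 = (pi - beta) / 2.
Proof.
have h0 := b0; have h2 := b2; have c1 := cos_lt1_itv.
have s0 : 0 < sin (beta / 2) by apply: sin_half_gt0; rewrite h0.
have p0 := @pi_gt0 R.
rewrite -[RHS]tanK; last by rewrite in_itv /=; lra.
congr atan; have -> : (pi - beta) / 2 = pi / 2 - beta / 2 by field.
rewrite /tan sin_pihalfB cosB cos_pihalf sin_pihalf mul0r add0r mul1r.
have -> : sin beta = 2 * sin (beta / 2) * cos (beta / 2).
  have {1}-> : beta = beta / 2 + beta / 2 by field.
  by rewrite sinD; ring.
have -> : dilog_den 1 = 2 * sin (beta / 2) ^+ 2.
  rewrite /dilog_den mul1r; have {1}-> : beta = beta / 2 + beta / 2 by field.
  by rewrite cosD -!expr2 cos2sin2; ring.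
by field; exact: lt0r_neq0.
Qed.

Section UpperHalf.
Hypothesis bpi : beta < pi.

Let sb : 0 < sin beta. Proof. by rewrite sin_gt0_pi // b0. Qed.

Lemma dilog_angle_range t : 0 < t <= 1 ->
  0 < dilog_angle t < pi / 2 /\ dilog_angle t + beta < pi.
Proof.
move=> /andP[t0 t1]; have t01 : 0 <= t <= 1 by rewrite ltW.
have h0 := b0; have h2 := bpi; have p0 := @pi_gt0 R.
have A0 : 0 < dilog_angle t.
  rewrite -(@atan0 R) lt_atan // divr_gt0 ?dilog_den_gt0 //; exact: mulr_gt0.
have A1 : dilog_angle t < pi / 2 by exact: atan_ltpi2.
split; first by rewrite A0.
rewrite ltNge; apply/negP => H.
have : 0 < sin (dilog_angle t) by apply: sin_gt0_pi; lra.
rewrite sin_dilog_angle // pmulr_rgt0 // ltNge => /negP; apply.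
have -> : dilog_angle t + beta = (dilog_angle t + beta - pi) + pi by ring.
by rewrite sinDpi oppr_le0; apply: sin_ge0_pi; lra.
Qed.

(** Integration by parts with $A$ for the angle: $\int A\,dt/t=A\ln t-\int\ln t\,dA$, where $\ln
    t=\ln(2\sin A)-\ln(2\sin(A+\beta))$ by [sin_dilog_angle], and both logarithms integrate to
    Clausen functions. *)
Definition dilog_primitive t : R := dilog_angle t * ln t +
  (clausen (2 * dilog_angle t + 0) / 2 - clausen (2 * dilog_angle t + 2 * beta) / 2).

Lemma is_derive_dilog t : 0 < t < 1 ->
  is_derive t (1 : R) dilog_primitive (dilog_angle t / t).
Proof.
move=> /andP[t0 t1]; have t01 : 0 <= t <= 1 by rewrite !ltW.
have h0 := b0; have h2 := bpi; have p0 := @pi_gt0 R.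
have [|/andP[A0 A1] A2] := @dilog_angle_range t; first by rewrite t0 ltW.
have [d dA] := is_derive_dilog_angle t01.
have dl := is_derive1_ln t0.
have dg (c : R) : 0 < 2 * dilog_angle t + c < 2 * pi ->
    is_derive t (1 : R) (fun x => clausen (2 * dilog_angle x + c))
      (- 2 * ln (2 * sin ((2 * dilog_angle t + c) / 2)) * d).
  move=> H; have d1 := is_derive_clausen_affine H.
  exact: (@is_derive1_comp _ (fun t => clausen (2 * t + c)) dilog_angle t _ _ d1 dA).
have H0 : 0 < 2 * dilog_angle t + 0 < 2 * pi by lra.
have H1 : 0 < 2 * dilog_angle t + 2 * beta < 2 * pi by lra.
have := is_deriveD (is_deriveM dA dl)
  (is_deriveB (is_deriveZ 2^-1 (dg _ H0)) (is_deriveZ 2^-1 (dg _ H1))).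
have -> : dilog_angle * (@ln R) + (2^-1 \*: (fun x => clausen (2 * dilog_angle x + 0)) -
    2^-1 \*: (fun x => clausen (2 * dilog_angle x + 2 * beta))) = dilog_primitive.
  by apply/funext => x; rewrite /dilog_primitive ![_ / 2]mulrC.
set e := (X in is_derive _ _ _ X); suff -> : e = dilog_angle t / t by [].
rewrite /e /GRing.scale /= {e}.
have -> : (2 * dilog_angle t + 0) / 2 = dilog_angle t by field.
have -> : (2 * dilog_angle t + 2 * beta) / 2 = dilog_angle t + beta by field.
have s1 : 0 < sin (dilog_angle t + beta) by apply: sin_gt0_pi; lra.
have -> : ln (2 * sin (dilog_angle t)) = ln t + ln (2 * sin (dilog_angle t + beta)).
  by rewrite -lnM ?posrE ?mulr_gt0 // sin_dilog_angle // mulrCA.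
by move: (ln _) (ln _) => l l'; field; exact: lt0r_neq0.
Qed.

Lemma continuous_clausen_dilog (c t : R) : 0 <= t <= 1 ->
  0 <= 2 * dilog_angle t + c < 2 * pi ->
  {for t, continuous (fun x => clausen (2 * dilog_angle x + c))}.
Proof.
move=> t01 H; have cA := continuous_dilog_angle t01.
exact: (@continuous_comp _ _ _ dilog_angle (fun x => clausen (2 * x + c)) t cA
  (continuous_clausen_affine H)).
Qed.

Lemma dilog_angle0 : dilog_angle 0 = 0.
Proof. by rewrite /dilog_angle mul0r mul0r atan0. Qed.

Lemma cvg_dilog_angle_ln : dilog_angle t * ln t @[t --> 0^'+] --> (0 : R).
Proof.
have cA : dilog_angle t @[t --> 0^'+] --> (0 : R).
  rewrite -[X in _ --> X]dilog_angle0; apply: cvg_at_right_filter.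
  by apply: continuous_dilog_angle; rewrite lexx ler01.
apply/cvgrPdist_le => e e0.
have e2 : 0 < e / 2 by rewrite divr_gt0.
have h2 : 0 < 2^-1 :> R by rewrite invr_gt0.
move/cvgrPdist_le : cA => /(_ _ h2) cA.
have /cvgrPdist_le/(_ _ e2) cl := @cvg_xlnx R.
near=> t; rewrite sub0r normrN normrM.
have t0 : 0 < t by near: t; exact: nbhs_right_gt.
have t1 : t <= 1 by near: t; exact: nbhs_right_le.
have [|/andP[A0 A1] A2] := @dilog_angle_range t; first by rewrite t0.
have Ah : dilog_angle t <= 2^-1.
  by apply: le_trans (ler_norm _) _; rewrite -normrN -sub0r; near: t; exact: cA.
have sA : dilog_angle t / 2 <= sin (dilog_angle t).
  by have := sin_sub_le (dilog_angle t); rewrite ler_norml => /andP[+ _]; nra.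
have st : sin (dilog_angle t) <= t.
  rewrite sin_dilog_angle ?(ltW t0) // ler_piMr ?(ltW t0) //; exact: sin_le1.
have At : dilog_angle t <= 2 * t by lra.
have : `|0 - t * ln t| <= e / 2 by near: t; exact: cl.
rewrite sub0r normrN normrM (gtr0_norm t0) (gtr0_norm A0) => H.
have := normr_ge0 (ln t); move: (`|ln t|) H => l H l0; nra.
Unshelve. all: by end_near. Qed.

(** The angle at $t=1$ is $(\pi-\beta)/2$, so this end contributes [clausen] at $\pi-\beta$ and
    $\pi+\beta$, and the end $t=0$ contributes it at $2\beta$. [clausen_duplication] combines the
    three. *)
Lemma dilog_integral : rint (`[0, 1] : set RT) (fun t => dilog_angle t / t) /\
  \int[mu]_(t in `[0, 1]) (dilog_angle t / t) = clausen beta.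
Proof.
have h0 := b0; have h2 := bpi; have p0 := @pi_gt0 R.
have A1 := dilog_angle_half.
have c0 : dilog_primitive t @[t --> 0^'+] --> - (clausen (2 * beta) / 2).
  have -> : - (clausen (2 * beta) / 2) = 0 + (clausen (2 * dilog_angle 0 + 0) / 2 -
      clausen (2 * dilog_angle 0 + 2 * beta) / 2).
    by rewrite dilog_angle0 mulr0 !add0r clausen0 mul0r sub0r.
  apply: cvgD; first exact: cvg_dilog_angle_ln.
  apply: cvg_at_right_filter; apply: cvgB; apply: cvgM; try exact: cvg_cst.
    by apply: continuous_clausen_dilog; rewrite ?dilog_angle0 ?lexx ?ler01 //; lra.
  by apply: continuous_clausen_dilog; rewrite ?dilog_angle0 ?lexx ?ler01 //; lra.
have c1 : dilog_primitive t @[t --> 1^'-] --> dilog_primitive 1.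
  have o01 : 0 <= (1 : R) <= 1 by rewrite lexx ler01.
  apply: cvg_at_left_filter; apply: cvgD.
    by apply: cvgM; [exact: continuous_dilog_angle|exact: continuous_ln].
  apply: cvgB; apply: cvgM; try exact: cvg_cst.
    by apply: continuous_clausen_dilog => //; rewrite A1; lra.
  by apply: continuous_clausen_dilog => //; rewrite A1; lra.
have [||i I] := FTC_oo ltr01 _ _ is_derive_dilog c0 c1.
- move=> t /andP[t0 t1]; apply: cvgM.
    by apply: continuous_dilog_angle; rewrite !ltW.
  by apply: cvgV; [exact: lt0r_neq0|exact: cvg_id].
- move=> t /andP[t0 t1]; have [|/andP[A0 _] _] := @dilog_angle_range t.
    by rewrite t0 ltW.
  by rewrite divr_ge0 // ltW.
split => //; rewrite I /dilog_primitive A1 ln1 mulr0 add0r.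
have := @clausen_duplication R beta.
have -> : 2 * ((pi - beta) / 2) + 0 = pi - beta by field.
have -> : 2 * ((pi - beta) / 2) + 2 * beta = pi + beta by field.
move=> ->; last by rewrite (ltW h0).
by move: (clausen _) (clausen _) (clausen _) => a b c; field.
Qed.

End UpperHalf.

End Dilogarithm.

(** Below $\pi$ this is [dilog_integral]. The substitution $\beta\mapsto2\pi-\beta$ reverses the
    sign of the sine and keeps the cosine, so both sides are odd under it, and both vanish at
    $\pi$. *)
Lemma Im_Li2_expi (R : realType) (beta : R) : 0 < beta < 2 * pi ->
  complex.Im (Li2 (expi beta)) = clausen beta.
Proof.
move=> /andP[b0 b2]; rewrite Im_Li2 //.
have [bpi|bpi|->] := ltgtP beta pi.
- have [i I] := dilog_integral b0 b2 bpi; rewrite -I.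
  under eq_Rint do rewrite -mulN1r.
  by rewrite RintegralZl // mulN1r opprK.
- have [[g0 g2] gpi] : (0 < 2 * pi - beta /\ 2 * pi - beta < 2 * pi) /\ 2 * pi - beta < pi by lra.
  have [i I] := dilog_integral g0 g2 gpi.
  have -> : clausen beta = - clausen (2 * pi - beta) by rewrite clausenN ?opprK ?b0.
  rewrite -I; congr (- _); apply: eq_Rint => t _; rewrite -mulNr -atanN.
  congr (atan _ / _); rewrite /dilog_den.
  have -> : cos (2 * pi - beta) = cos beta.
    by rewrite -cosN opprB -(cosD2pi (beta - 2 * pi)); congr cos; rewrite -mulr_natl; ring.
  have -> : sin (2 * pi - beta) = - sin beta.
    by rewrite -sinN -(sinD2pi (- beta)); congr sin; rewrite -mulr_natl; ring.
  by rewrite mulrN mulNr.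
rewrite clausen_pi; under eq_Rint do rewrite /dilog_angle sinpi mulr0 mul0r atan0 mul0r oppr0.
by rewrite Rintegral_cst // mul0r oppr0.
Qed.

(** * Extremal functions and the sharp constants *)

Section DecayingFunctions.
Context {R : realType}.
Local Notation mu := (@lebesgue_measure R).
Local Notation RT := (measurableTypeR R).
Implicit Types (x y : R) (h : R[i] -> R[i]) (f : R -> R[i]) (p q : \bar R).

Definition exponent p : Prop := p = 1%E \/ p = 2%:E \/ p = +oo%E.

Lemma weight_le1 x : weight x <= 1.
Proof. by have := weight_decay 0 x; rewrite expr0 mul1r fact0. Qed.

Lemma cLnorm1_ge f (B : R) : rint (setT : set RT) (fun x => normc (f x)) ->
  \int[mu]_x normc (f x) <= B -> (cLnorm 1%E f <= B%:E)%E.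
Proof.
move=> i1 H; rewrite cLnorm1E -lee_fin in H *; apply: le_trans H.
by rewrite fineK //; apply: integrable_fin_num.
Qed.

Lemma cLnorm2_ge f (B : R) : 0 <= B -> rint (setT : set RT) (fun x => normc (f x) ^+ 2) ->
  \int[mu]_x (normc (f x) ^+ 2) <= B ^+ 2 -> (cLnorm 2%:E f <= B%:E)%E.
Proof.
move=> B0 i1 H; rewrite cLnorm2E -lee_fin in H *.
have -> : B%:E = ((B ^+ 2)%:E `^ 2^-1)%E.
  by rewrite poweR_EFin powR12_sqrt ?sqr_ge0 // sqrtr_sqr ger0_norm.
apply: gt0_ler_poweR; rewrite ?invr_ge0 ?in_itv /= ?andbT ?leey ?lee_fin ?sqr_ge0 //.
  by rewrite integral_ge0 // => x _; rewrite lee_fin sqr_ge0.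
by apply: le_trans H; rewrite fineK //; apply: integrable_fin_num.
Qed.

Lemma cLnormy_ge f (B : R) : (forall x, normc (f x) <= B) -> (cLnorm +oo f <= B%:E)%E.
Proof.
move=> H; apply/cLnormyP; exists set0; split => // x /= nH.
by exfalso; apply: nH; exact: H.
Qed.

Lemma cLnorm0 p : exponent p -> cLnorm p (fun=> 0%R : R[i]) = 0%E.
Proof.
move=> Hp; have E : (fun x : R => (normc (0 : R[i]))%:E) = cst 0%E.
  by apply/funext => x; rewrite normc0.
by rewrite /cLnorm E Lnorm0 //; case: Hp => [->|[->|->]] //; rewrite eqe ?pnatr_eq0 ?oner_eq0.
Qed.

Lemma cLnorm_weight p (C : R) : exponent p -> 0 <= C -> exists2 K : R, 0 <= K &
  forall f, cmeasurable f -> (forall x, normc (f x) <= C * weight x) -> (cLnorm p f <= K%:E)%E.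
Proof.
move=> Hp C0; have iw := @rint_weight R.
have I0 : 0 <= \int[mu]_x @weight R x by apply: Rintegral_ge0 => x _; exact: weight_ge0.
have iC (c : R) := rintZ c measurableT iw.
case: Hp => [->|[->|->]].
- exists (C * \int[mu]_x weight x); first exact: mulr_ge0.
  move=> f mf fC; have i1 : rint (setT : set RT) (fun x => normc (f x)).
    apply: rint_le (iC C) => //; first exact: cmeas_normc mf.
    by move=> x _; rewrite ger0_norm ?normc_ge0 ?fC.
  apply: cLnorm1_ge => //; rewrite -RintegralZl //.
  by apply: ler_Rint.
- pose K := Num.sqrt (C ^+ 2 * \int[mu]_x weight x).
  exists K; first exact: sqrtr_ge0.
  move=> f mf fC; have H x : normc (f x) ^+ 2 <= C ^+ 2 * weight x.
    apply: (@le_trans _ _ ((C * weight x) ^+ 2)).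
      by rewrite ler_pXn2r ?nnegrE ?normc_ge0 //; exact: mulr_ge0 C0 (weight_ge0 x).
    rewrite exprMn; apply: ler_wpM2l; first exact: sqr_ge0.
    rewrite expr2; apply: ler_piMl; [exact: weight_ge0|exact: weight_le1].
  have i1 : rint (setT : set RT) (fun x => normc (f x) ^+ 2).
    apply: rint_le (iC (C ^+ 2)) => //.
      by apply: measurable_funX; exact: cmeas_normc mf.
    by move=> x _; rewrite ger0_norm ?sqr_ge0.
  apply: cLnorm2_ge => //; first exact: sqrtr_ge0.
  rewrite /K sqr_sqrtr ?mulr_ge0 ?sqr_ge0 // -RintegralZl //.
  by apply: ler_Rint.
exists C => // f mf fC; apply: cLnormy_ge => x; apply: le_trans (fC x) _.
by apply: ler_piMr => //; exact: weight_le1.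
Qed.

Variables (h : R[i] -> R[i]) (C : R).
Hypotheses (C0 : 0 <= C) (dh : forall x y, 0 <= y <= 1 -> cdiff h (x +i* y)).
Hypothesis hC : forall x y, 0 <= y <= 1 -> normc (h (x +i* y)) <= C * weight x.

Lemma cmeasurable_closed_line y : 0 <= y <= 1 -> cmeasurable (fun x => h (x +i* y)).
Proof. by move=> y01; apply: ccont_cmeas => x; apply: cdiff_ccont_h; exact: dh. Qed.

(** The whole of $h_y$ is put into the $L^p$ part for $y\le\frac12$ and into the $L^q$ part
    otherwise, so that the weight in front of it is at most 2. *)
Lemma decaying_Hspace p q : exponent p -> exponent q -> Hspace p q h.
Proof.
move=> Hp Hq; split.
  move=> [x y] /= /andP[y0 y1]; apply/derivable_cdiffP; apply: dh.
  by rewrite !ltW.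
have [Kp Kp0 HKp] := cLnorm_weight Hp C0; have [Kq Kq0 HKq] := cLnorm_weight Hq C0.
apply: (@le_lt_trans _ _ (2 * Kp + 2 * Kq)%:E); last exact: ltry.
apply: ub_ereal_sup => _ /= [y + <-]; rewrite in_itv /= => /andP[y0 y1].
have y01 : 0 <= y <= 1 by rewrite !ltW.
have m := cmeasurable_closed_line y01.
have m0 : cmeasurable (fun=> 0 : R[i]) by split; exact: measurable_cst.
have [yh|yh] := leP y 2^-1.
  have S : (sumnorm p q y (hline h y) <= ((1 - y)^-1)%:E * cLnorm p (hline h y) +
      (y^-1)%:E * cLnorm q (fun=> 0%R : R[i]))%E.
    apply: ereal_inf_lbound; exists (hline h y), (fun=> 0); split => // x; exact: addr0.
  apply: (le_trans S); rewrite cLnorm0 // mule0 adde0; apply: (@le_trans _ _ (2%:E * Kp%:E)%E).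
    apply: lee_pmul; rewrite ?cLnorm_ge0 ?lee_fin ?invr_ge0 ?subr_ge0 ?(ltW y1) //.
      by rewrite -[leRHS]invrK lef_pV2 ?posrE ?invr_gt0 ?subr_gt0 //; lra.
    by apply: HKp => // x; exact: hC.
  by rewrite -EFinM lee_fin lerDl mulr_ge0.
have S : (sumnorm p q y (hline h y) <= ((1 - y)^-1)%:E * cLnorm p (fun=> 0%R : R[i]) +
    (y^-1)%:E * cLnorm q (hline h y))%E.
  apply: ereal_inf_lbound; exists (fun=> 0), (hline h y); split => // x; exact: add0r.
apply: (le_trans S); rewrite cLnorm0 // mule0 add0e; apply: (@le_trans _ _ (2%:E * Kq%:E)%E).
  apply: lee_pmul; rewrite ?cLnorm_ge0 ?lee_fin ?invr_ge0 ?(ltW y0) //.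
    by rewrite -[leRHS]invrK lef_pV2 ?posrE ?invr_gt0 //; lra.
  by apply: HKq => // x; exact: hC.
by rewrite -EFinM lee_fin lerDr mulr_ge0.
Qed.

Lemma schwartz_bounded (phi : R -> R[i]) : schwartz phi -> cmeas (setT : set RT) phi /\
  exists2 B : R, 0 <= B & forall x, normc (phi x) <= B.
Proof.
move=> [[d1 b1] [d2 b2]]; split.
  split; apply: continuous_measurable_fun => x.
    by apply/differentiable_continuous/derivable1_diffP; exact: (d1 0%N x).
  by apply/differentiable_continuous/derivable1_diffP; exact: (d2 0%N x).
have [B1 H1] := b1 0%N 0%N; have [B2 H2] := b2 0%N 0%N.
have B10 : 0 <= B1 by apply: le_trans (H1 0); exact: normr_ge0.
have B20 : 0 <= B2 by apply: le_trans (H2 0); exact: normr_ge0.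
exists (B1 + B2); first exact: addr_ge0.
move=> x; apply: le_trans (ler_normc_ReIm _) _.
by apply: lerD; [have := H1 x|have := H2 x]; rewrite expr0 mul1r derive1n0.
Qed.

Lemma cvg_of_normc (F : set_system R) {FF : Filter F} (u : R -> R[i]) (l : R[i]) :
  normc (u y - l) @[y --> F] --> (0 : R) -> (u y : R[i]^o) @[y --> F] --> (l : R[i]^o).
Proof.
move=> /cvgrPdist_le H; apply/cvgrPdist_le => e e0.
have eE : e = (complex.Re e)%:C.
  by case: e e0 => a b; rewrite ltcE /= => /andP[/eqP -> _].
have {}H := H (complex.Re e); rewrite -ltcR -eE in H.
apply: filterS (H e0) => y; rewrite sub0r normrN ger0_norm ?normc_ge0 // => Hy.
by rewrite normr_normc eE lecR normcBC.
Qed.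

(** Dominated convergence with a multiple of [weight] as majorant; the pointwise limit is continuity
    of [h] up to the boundary line. *)
Lemma cvg_pairing_seq (phi : R -> R[i]) (j : R) (u : nat -> R) : schwartz phi ->
  0 <= j <= 1 -> (forall n, 0 <= u n <= 1) -> u n @[n --> \oo] --> j ->
  normc (pairing (hline h (u n)) phi - pairing (fun x => h (x +i* j)) phi) @[n --> \oo] --> (0 : R).
Proof.
move=> /schwartz_bounded[mphi [B B0 HB]] j01 u01 uj.
have iw := rintZ (C * B) measurableT (@rint_weight R).
have bd x y : 0 <= y <= 1 -> normc (h (x +i* y) * phi x) <= C * B * weight x.
  move=> y01; rewrite normcM mulrAC; apply: ler_pM; rewrite ?normc_ge0 //; exact: hC.
have mh y : 0 <= y <= 1 -> cmeas (setT : set RT) (fun x => h (x +i* y) * phi x).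
  by move=> y01; apply: cmeasM => //; exact: cmeasurable_closed_line.
have pw x : (setT : set RT) x -> forall e : R, 0 < e -> \forall n \near \oo,
    normc (h (x +i* u n) * phi x - h (x +i* j) * phi x) <= e.
  move=> _ e e0; have e1 : 0 < e / (B + 1) by rewrite divr_gt0 // ltr_wpDl.
  have [d d0 Hd] := cdiff_ccont_v (dh x j01) e1.
  move/cvgrPdist_lt : uj => /(_ _ d0); apply: filterS => n jn.
  rewrite -mulrBl normcM; apply: (@le_trans _ _ (e / (B + 1) * B)).
    apply: ler_pM; rewrite ?normc_ge0 //; apply: ltW; apply: Hd.
    by rewrite distrC.
  by rewrite mulrAC ler_pdivrMr ?ltr_wpDl // ler_pM2l // lerDl.
have [_ H] := cvg_cintegral measurableT (fun n => mh _ (u01 n)) (mh _ j01) pw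
  (fun n x _ => bd x _ (u01 n)) iw.
apply/cvgrPdist_le => e e0; apply: filterS (H e e0) => n.
by rewrite sub0r normrN ger0_norm ?normc_ge0.
Qed.

Lemma decaying_tempered0 : tempered_cvg (0^'+) (hline h) (fun x => h (x +i* 0)).
Proof.
move=> phi sphi; apply: cvg_of_normc; apply/cvg_at_rightP => u [u0 uc].
(* The first terms of the sequence may exceed 1. Clamping keeps all terms in the closed strip, where
   [dh] and [hC] hold, and leaves the tail unchanged. *)
pose v n := Num.min (u n) 1.
have v01 n : 0 <= v n <= 1 by rewrite /v le_min (ltW (u0 n)) ler01 ge_min lexx orbT.
have uv : \forall n \near \oo, v n = u n.
  move/cvgrPdist_lt : uc => /(_ 1 ltr01); apply: filterS => n.
  by rewrite sub0r normrN gtr0_norm // => /ltW un; rewrite /v min_l.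
have vc : v n @[n --> \oo] --> (0 : R).
  by apply: cvg_trans uc; apply: near_eq_cvg; apply: filterS uv => n ->.
have o01 : 0 <= (0 : R) <= 1 by rewrite lexx ler01.
have := cvg_pairing_seq sphi o01 v01 vc; apply: cvg_trans.
by apply: near_eq_cvg; apply: filterS uv => n ->.
Qed.

Lemma decaying_tempered1 : tempered_cvg (1^'-) (hline h) (fun x => h (x +i* 1)).
Proof.
move=> phi sphi; apply: cvg_of_normc; apply/cvg_at_leftP => u [u0 uc].
pose v n := Num.max (u n) 0.
have v01 n : 0 <= v n <= 1 by rewrite /v le_max lexx orbT ge_max (ltW (u0 n)) ler01.
have uv : \forall n \near \oo, v n = u n.
  move/cvgrPdist_lt : uc => /(_ 1 ltr01); apply: filterS => n.
  rewrite gtr0_norm ?subr_gt0 // => un; rewrite /v max_l //.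
  by move: un; rewrite ltrBlDr ltrDl => /ltW.
have vc : v n @[n --> \oo] --> (1 : R).
  by apply: cvg_trans uc; apply: near_eq_cvg; apply: filterS uv => n ->.
have o01 : 0 <= (1 : R) <= 1 by rewrite lexx ler01.
have := cvg_pairing_seq sphi o01 v01 vc; apply: cvg_trans.
by apply: near_eq_cvg; apply: filterS uv => n ->.
Qed.

Lemma decaying_boundary_values p q : exponent p -> exponent q ->
  boundary_values p q h (fun x => h (x +i* 0)) (fun x => h (x +i* 1)).
Proof.
move=> Hp Hq; have o0 : 0 <= (0 : R) <= 1 by rewrite lexx ler01.
have o1 : 0 <= (1 : R) <= 1 by rewrite lexx ler01.
have [Kp _ HKp] := cLnorm_weight Hp C0; have [Kq _ HKq] := cLnorm_weight Hq C0.
have m0 := cmeasurable_closed_line o0; have m1 := cmeasurable_closed_line o1.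
split; [split => //|split => //|exact: decaying_tempered0|exact: decaying_tempered1].
  by apply: le_lt_trans (HKp _ m0 _) (ltry _) => x; exact: hC.
by apply: le_lt_trans (HKq _ m1 _) (ltry _) => x; exact: hC.
Qed.

End DecayingFunctions.

(** * Profiles on the two lines and their harmonic averages *)

Section BoundaryProfile.
Context {R : realType}.
Local Notation mu := (@lebesgue_measure R).
Local Notation RT := (measurableTypeR R).
Implicit Types (x : R) (top side : bool).

Variable z0 : R[i].
Hypothesis z01 : 0 < complex.Im z0 < 1.
Local Notation alpha := (complex.Im z0).
Let w := wexp z0.
Let w0 : 0 < complex.Im w := Im_wexp_gt0 z01.
Local Notation P0 := (pker (complex.Re w) (complex.Im w)).
Local Notation P1 := (pker (- complex.Re w) (complex.Im w)).

Definition mass (a : R) top : R := if top then a else 1 - a.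

(** The value of $\int P\ln P$ for the harmonic density on the line [top], by [density_entropy]. It
    depends on the height only, since a horizontal translation of the point just translates the
    densities. *)
Definition entropy (a : R) top : R :=
  - (pi^-1 * clausen (2 * (pi * mass a top))) - mass a top * ln (4 * sin (pi * a)).

Lemma density_entropy top :
  [/\ rint (setT : set RT) (fun x => `|density w x top|),
      \int[mu]_x `|density w x top| = mass alpha top,
      rint (setT : set RT) (fun x => `|density w x top| * ln `|density w x top|) &
      \int[mu]_x (`|density w x top| * ln `|density w x top|) = entropy alpha top].
Proof.
have p0 := @pi_gt0 R; have s0 := sx_gt0 (complex.Re z0).
have /andP[a0 a1] := z01; have dE := density_abs z01.
(* The kernel on the upper line has $-a$ in place of $a$, which is the case of the supplementary
   angle. *)
pose th := if top then pi * (1 - alpha) else pi * alpha.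
have th0 : 0 < th by rewrite /th; case: (top); rewrite mulr_gt0 // subr_gt0.
have thpi : th < pi.
  by rewrite /th; case: (top); rewrite -[ltRHS]mulr1 ltr_pM2l // ltrBlDr ltrDl.
have sE : sin th = sin (pi * alpha).
  by rewrite /th; case: (top) => //; rewrite mulrBr mulr1 sin_piB.
have E x : `|density w x top| = pker (sx (complex.Re z0) * cos th) (sx (complex.Re z0) * sin th) x.
  rewrite dE sE Re_wexp Im_wexp /th; case: (top) => //.
  by rewrite mulrBr mulr1 cosB cospi sinpi mul0r addr0 mulN1r mulrN.
have mE : 1 - th / pi = mass alpha top.
  by rewrite /th /mass; case: (top); move: (@pi R) p0 => q q0; field; exact: lt0r_neq0.
have [i1 I1] := pker_entropy s0 th0 thpi; have I2 := integral_pker_angle s0 th0 thpi.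
have b0 : 0 < sx (complex.Re z0) * sin th by rewrite mulr_gt0 // sin_gt0_pi // th0.
split.
- by apply: rint_eq (integral_pker (sx (complex.Re z0) * cos th) b0).1 => // x _; rewrite E.
- by rewrite -mE -I2; apply: eq_Rint => x _; rewrite E.
- by apply: rint_eq i1 => // x _; rewrite E.
rewrite /entropy -mE -sE; have -> : pi * (1 - th / pi) = pi - th.
  by move: (@pi R) p0 => q q0; field; exact: lt0r_neq0.
by rewrite -I1; apply: eq_Rint => x _; rewrite E.
Qed.

(** Makes the signed density positive on the line [side], the one that carries the logarithmic part
    of [profile]. *)
Definition side_sign side : R := if side then -1 else 1.

Lemma side_sign_norm side : `|side_sign side| = 1.
Proof. by case: side; rewrite /side_sign ?normrN normr1. Qed.

Lemma profile_side k c c' side x top :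
  profile k c c' (side_sign side * density w x top) =
  if top == side then c + k * ln `|density w x top| else c'.
Proof.
have [g0 g1] : 0 < P0 x /\ 0 < P1 x by rewrite !pker_gt0.
rewrite /profile (density_abs z01) -/w /density /side_sign.
by case: side; case: top => /=; rewrite ?mulN1r ?mul1r ?opprK ?oppr_gt0 ?g0 ?g1 // ltNge ltW.
Qed.

(** The average of the profile against the harmonic measure ([integral_profile]), that is, the
    logarithm at [z0] of the modulus of the outer function with this boundary profile. *)
Definition side_value k c c' side : R :=
  c * mass alpha side + k * entropy alpha side + c' * mass alpha (~~ side).

Lemma rint_profile k c c' side top : rint (setT : set RT) (fun x =>
  `|density w x top| * profile k c c' (side_sign side * density w x top)).
Proof.
have [i1 _ i2 _] := density_entropy top.
have [E|E] := eqVneq top side.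
  apply: rint_eq (rintD measurableT (rintZ c measurableT i1) (rintZ k measurableT i2)) => // x _.
  by rewrite profile_side E eqxx; ring.
apply: rint_eq (rintZ c' measurableT i1) => // x _.
by rewrite profile_side (negbTE E) mulrC.
Qed.

Lemma integral_profile k c c' side :
  \int[mu]_x (P0 x * profile k c c' (side_sign side * density w x false)) +
  \int[mu]_x (P1 x * profile k c c' (side_sign side * density w x true)) =
  side_value k c c' side.
Proof.
have dE := density_abs z01.
have -> : \int[mu]_x (P0 x * profile k c c' (side_sign side * density w x false)) =
  \int[mu]_x (`|density w x false| * profile k c c' (side_sign side * density w x false)).
  by apply: eq_Rint => x _; rewrite dE.
have -> : \int[mu]_x (P1 x * profile k c c' (side_sign side * density w x true)) =
  \int[mu]_x (`|density w x true| * profile k c c' (side_sign side * density w x true)).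
  by apply: eq_Rint => x _; rewrite dE.
have I1 : \int[mu]_x (`|density w x side| * profile k c c' (side_sign side * density w x side)) =
    c * mass alpha side + k * entropy alpha side.
  have [i1 J1 i2 J2] := density_entropy side.
  rewrite -J1 -J2 -!RintegralZl // -RintegralD //.
  - by apply: eq_Rint => x _; rewrite profile_side eqxx; ring.
  - exact: rintZ.
  - exact: rintZ.
have I2 : \int[mu]_x (`|density w x (~~ side)| *
    profile k c c' (side_sign side * density w x (~~ side))) = c' * mass alpha (~~ side).
  have [i1 J1 _ _] := density_entropy (~~ side).
  rewrite -J1 -RintegralZl //; apply: eq_Rint => x _; rewrite profile_side.
  by case: (side) => /=; rewrite mulrC.
by rewrite /side_value -I1 -I2; case: (side) => //=; exact: addrC.
Qed.

End BoundaryProfile.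

Section Extremal.
Context {R : realType}.
Local Notation mu := (@lebesgue_measure R).
Local Notation RT := (measurableTypeR R).
Implicit Types (x y : R) (top side : bool).

Lemma expR_weight x : expR (- (pi * `|x|)) <= 2 * weight x.
Proof.
have s0 := sx_gt0 x; have h0 : 0 < 1 + sx x ^+ 2 by have := sqr_ge0 (sx x); lra.
rewrite /weight mulrA ler_pdivlMr //; case: (leP 0 x) => x0.
  have s1 : 1 <= sx x by rewrite -expR0 ler_expR mulr_ge0 // pi_ge0.
  rewrite (ger0_norm x0) expRN -/(sx x) mulrDr mulr1 expr2 mulKf ?gt_eqF //.
  suff : (sx x)^-1 <= sx x by lra.
  by apply: (@le_trans _ _ 1); rewrite // invf_le1.
have s1 : sx x <= 1 by rewrite -expR0 ler_expR mulr_ge0_le0 ?pi_ge0 // ltW.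
rewrite (ltr0_norm x0) mulrN opprK -/(sx x); nra.
Qed.

(** Completing the square gives $\pi|x|-ex^2\le\pi^2/(4e)$, so Gaussian decay is stronger than that
    of [weight]. *)
Lemma gauss_weight (e x : R) : 0 < e ->
  expR (- (e * x ^+ 2)) <= 2 * expR (pi ^+ 2 / (4 * e)) * weight x.
Proof.
move=> e0; apply: (@le_trans _ _ (expR (pi ^+ 2 / (4 * e)) * expR (- (pi * `|x|)))).
  rewrite -expRD ler_expR -[x ^+ 2]real_normK ?num_real //.
  rewrite -subr_ge0; set u := `|x|; move: (@pi R) => q.
  have -> : q ^+ 2 / (4 * e) - q * u - - (e * u ^+ 2) = (2 * e * u - q) ^+ 2 / (4 * e).
    by field; exact: lt0r_neq0.
  by rewrite divr_ge0 ?sqr_ge0 // mulr_ge0 // ltW.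
have -> : 2 * expR (pi ^+ 2 / (4 * e)) * weight x = expR (pi ^+ 2 / (4 * e)) * (2 * weight x).
  by ring.
by apply: ler_wpM2l; [exact: expR_ge0|exact: expR_weight].
Qed.

Definition extremal (e : R) (w : R[i]) (p : {poly R[i]}) (z : R[i]) : R[i] :=
  cexp ((- e)%:C * (z * z) + p.[zeta w z] - (3 * e)%:C).

Lemma normc_extremal e w p x y : normc (extremal e w p (x +i* y)) =
  expR (- e * (x ^+ 2 - y ^+ 2) + complex.Re p.[zeta w (x +i* y)] - 3 * e).
Proof.
rewrite /extremal normc_cexp; congr expR; rewrite ReB ReD ReM ReM /=.
by rewrite mul0r subr0 -!expr2.
Qed.

Variable w : R[i].
Hypothesis w0 : 0 < complex.Im w.

Lemma cdiff_extremal e p x y : 0 <= y <= 1 -> cdiff (extremal e w p) (x +i* y).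
Proof.
move=> y01; apply: cdiff_comp; last exact: cdiff_cexp.
apply: cdiffB; last exact: cdiff_cst.
apply: cdiffD; first by apply: cdiffM; [exact: cdiff_cst|apply: cdiffM; exact: cdiff_id].
by apply: cdiff_comp; [exact: cdiff_zeta|exact: cdiff_horner].
Qed.

Lemma extremal_weight (e : R) p : 0 < e -> exists2 C : R, 0 <= C &
  forall x y, 0 <= y <= 1 -> normc (extremal e w p (x +i* y)) <= C * weight x.
Proof.
move=> e0; have [K K0 HK] := horner_bounded p.
exists (expR K * (2 * expR (pi ^+ 2 / (4 * e)))).
  by rewrite !mulr_ge0 ?expR_ge0.
move=> x y y01; rewrite normc_extremal.
apply: (@le_trans _ _ (expR K * expR (- (e * x ^+ 2)))).
  rewrite -expRD ler_expR.
  have : complex.Re p.[zeta w (x +i* y)] <= K.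
    apply: le_trans (ler_norm _) _; apply: le_trans (ler_Re_normc _) _.
    by apply: HK; apply: normc_zeta_le1.
  move: (complex.Re _) => r rK; move/andP: y01 => [y0 y1].
  have y2 : y ^+ 2 <= 1 by rewrite expr_le1.
  by move: (x ^+ 2) (y ^+ 2) y2 => X Y y2; nra.
by rewrite -mulrA; apply: ler_wpM2l; [exact: expR_ge0|exact: gauss_weight].
Qed.

End Extremal.

Section ExtremalSequence.
Context {R : realType}.
Local Notation mu := (@lebesgue_measure R).
Local Notation RT := (measurableTypeR R).
Implicit Types (x y : R) (top side : bool).

Variables (alpha k c : R) (side : bool) (r : nat).
Hypotheses (a01 : 0 < alpha < 1) (k0 : 0 < k) (kr : k * r%:R = 1).
Hypothesis norm_c : expR (r%:R * c) * mass alpha side = 1.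
Let z0 : R[i] := 0 +i* alpha.
Let w := wexp z0.
Let z01 : 0 < complex.Im z0 < 1. Proof. exact: a01. Qed.
Let w0 : 0 < complex.Im w := Im_wexp_gt0 z01.

(* The damping factor [exp (- e z^2)] makes the outer functions integrable; the
   factor [exp (- 3 e)] then brings the boundary norms below 1. *)
Lemma extremal_exists (e : R) : 0 < e -> exists p : {poly R[i]},
  let h top x := extremal e w p (x +i* (if top then 1 else 0)) in
  [/\ rint (setT : set RT) (fun x => normc (h side x) ^+ r),
      \int[mu]_x (normc (h side x) ^+ r) <= 1,
      forall x, normc (h (~~ side) x) <= 1 &
      expR (side_value z0 k c 0 side - 4 * e) <= normc (extremal e w p z0)].
Proof.
move=> e0; have r1 : 1 <= r%:R :> R.
  by rewrite ler1n lt0n; apply/eqP => r0; move: kr; rewrite r0 mulr0 => /eqP; rewrite eq_sym oner_eq0.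
have vi := rint_profile z01 k c 0 side.
have [p [M [pB pv pn p0]]] := outer_sequence z01 k0 (side_sign_norm side) vi.
rewrite -/w integral_profile in p0; rewrite -/w in pB pv pn.
pose u n x := expR (r%:R * (complex.Re (p n).[zline w x side] - e * x ^+ 2)).
pose v x := expR (r%:R * (profile k c 0 (side_sign side * density w x side) - e * x ^+ 2)).
have mg : measurable_fun (setT : set RT) (fun x : R => e * x ^+ 2).
  by apply: measurable_funM => //; exact: measurable_funX.
have mun n : measurable_fun (setT : set RT) (u n).
  apply: measurableT_comp => //; apply: measurable_funM => //; apply: measurable_funB => //.
  by have [] := cmeas_horner_zline z01 (p n) side.
have uv x : u n x @[n --> \oo] --> v x.
  apply: (@continuous_cvg _ _ _ _ _ _ (@expR R)); first exact: continuous_expR.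
  apply: cvgM; first exact: cvg_cst.
  by apply: cvgB; [exact: pv|exact: cvg_cst].
pose B x := expR (r%:R * M) * (2 * expR (pi ^+ 2 / (4 * e)) * weight x).
have iB : rint (setT : set RT) B.
  by apply: rintZ => //; apply: rintZ => //; exact: rint_weight.
have uB n x : `|u n x| <= B x.
  rewrite ger0_norm ?expR_ge0 // /u mulrBr expRD.
  apply: ler_pM; rewrite ?expR_ge0 //.
    by rewrite ler_expR ler_wpM2l ?(le_trans ler01 r1) //; have /andP[] := pB n x side.
  apply: le_trans (gauss_weight x e0); rewrite ler_expR lerN2 ler_peMl //.
  by rewrite mulr_ge0 ?sqr_ge0 // ltW.
have mv : measurable_fun (setT : set RT) v.
  exact: (@measurable_fun_cvg _ _ _ _ u).
have [iv cv] := @rdct _ setT u v B measurableT mun mv (fun x _ => uv x) (fun n x _ => uB n x) iB.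
(* Because $kr=1$, the power $r$ of $\exp(c+k\ln P)$ is $e^{rc}P$, of integral 1 by [norm_c]; the
   Gaussian factor only decreases it. *)
have v1 : \int[mu]_x v x <= 1.
  have [i1 J1 _ _] := density_entropy z01 side.
  rewrite -norm_c -J1 -RintegralZl //; apply: ler_Rint => //; first exact: rintZ.
  move=> x _; rewrite /v profile_side // eqxx.
  have d0 : 0 < `|density w x side|.
    by rewrite normr_gt0; have := sdensity_neq0 z01 (side_sign_norm side) x side;
      rewrite mulf_eq0 negb_or => /andP[].
  rewrite -{2}[`|density w x side|]lnK ?posrE // -expRD ler_expR.
  rewrite mulrBr mulrDr mulrA (mulrC r%:R k) kr mul1r gerBl.
  by rewrite mulr_ge0 ?(le_trans ler01 r1) // mulr_ge0 ?sqr_ge0 // ltW.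
have d0 : 0 < expR (2 * e) - 1 by rewrite subr_gt0 expR_gt1 mulr_gt0.
have near1 : \forall n \near \oo, \int[mu]_x u n x <= expR (2 * e).
  move/cvgrPdist_le : cv => /(_ _ d0); apply: filterS => n.
  rewrite ler_norml => /andP[h1 _]; move: h1 v1.
  move: (\int[mu]_(x in setT) v x) (\int[mu]_(x in setT) u n x) => V U h1 h2; lra.
have near2 := pn e e0.
have near3 : \forall n \near \oo, side_value z0 k c 0 side - e <= complex.Re (p n).[0].
  move/cvgrPdist_le : p0 => /(_ _ e0); apply: filterS => n.
  rewrite ler_norml => /andP[h1 h2]; lra.
near \oo => n.
have h1 : \int[mu]_x u n x <= expR (2 * e) by near: n; exact: near1.
have h2 : forall x top, side_sign side * density w x top < 0 ->
    complex.Re (p n).[zline w x top] <= 0 + e by near: n; exact: near2.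
have h3 : side_value z0 k c 0 side - e <= complex.Re (p n).[0] by near: n; exact: near3.
exists (p n) => h.
have iu : rint (setT : set RT) (u n) by apply: rint_le iB => // x _; exact: uB.
(* On either line $e(3-y^2)\ge2e$, so [extremal] gains the factor $e^{-2e}$ that compensates the
   excess allowed in [near1]. *)
have hle x : normc (h side x) ^+ r <= expR (- (2 * e)) * u n x.
  rewrite /h normc_extremal -expRM_natl -expRD ler_expR -/(zline w x side).
  set y := if side then 1 else 0 : R.
  have y2 : y ^+ 2 <= 1 by rewrite /y; case: (side); rewrite ?expr1n ?expr0n.
  move: (complex.Re _) (x ^+ 2) (y ^+ 2) y2 => a X Y y2.
  have -> : r%:R * (- e * (X - Y) + a - 3 * e) =
    r%:R * (a - e * X) - r%:R * (e * (3 - Y)) by ring.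
  have : 2 * e <= r%:R * (e * (3 - Y)).
    have : 2 * e <= e * (3 - Y) by nra.
    by move=> q; apply: (le_trans q); apply: ler_peMl => //; apply: le_trans q; lra.
  by lra.
have mh top : measurable_fun (setT : set RT) (fun x => normc (h top x)).
  apply: cmeas_normc; apply: ccont_cmeas => x; apply: cdiff_ccont_h; apply: cdiff_extremal => //.
  by case: (top); rewrite lexx ler01.
have ih : rint (setT : set RT) (fun x => normc (h side x) ^+ r).
  apply: rint_le (rintZ (expR (- (2 * e))) measurableT iu) => //.
    exact: measurable_funX.
  by move=> x _; rewrite ger0_norm // exprn_ge0 // normc_ge0.
split => //.
- apply: (@le_trans _ _ (expR (- (2 * e)) * \int[mu]_x u n x)).
    rewrite -RintegralZl //; apply: ler_Rint => //; exact: rintZ.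
  by rewrite expRN mulrC ler_pdivrMr ?expR_gt0 // mul1r.
(* The exponent is at most $e+e-3e$: one [e] from $y^2\le1$, one from the uniform bound on the
   polynomial. *)
- move=> x; rewrite /h normc_extremal -/(zline w x (~~ side)) expR_le1.
  have : side_sign side * density w x (~~ side) < 0.
    have g := (pker_gt0 _ x w0).
    by rewrite /side_sign /density; case: (side) => /=; rewrite ?mulN1r ?mul1r oppr_lt0.
  move=> /h2; set y := if ~~ side then 1 else 0 : R.
  have y2 : y ^+ 2 <= 1 by rewrite /y; case: (side); rewrite ?expr1n ?expr0n.
  have := sqr_ge0 x; move: (complex.Re _) (x ^+ 2) (y ^+ 2) y2 => a X Y y2 X0 aX.
  have eX : 0 <= e * X by rewrite mulr_ge0 // ltW.
  have eY : e * Y <= e by rewrite ler_piMr // ltW.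
  lra.
rewrite /z0 normc_extremal ler_expR -/z0 (_ : zeta w z0 = 0); last first.
  by rewrite zetaE subrr mul0r.
(* At [z0] the term $e\alpha^2$ is nonnegative; what is lost is [e] by stopping at a finite rank and
   $3e$ by the normalisation. *)
rewrite expr0n /=; have := sqr_ge0 alpha; move: h3; move: (side_value _ _ _ _ _) => V.
by move: (complex.Re _) (alpha ^+ 2) => a A; nra.
Unshelve. all: by end_near. Qed.

End ExtremalSequence.

(** * Majorants for the two pairs of exponents *)

Section PointwiseBounds.
Context {R : realType}.
Local Notation mu := (@lebesgue_measure R).
Local Notation RT := (measurableTypeR R).
Implicit Types (x y : R) (top side : bool) (h : R[i] -> R[i]).

Section Majorant.
Variables (z0 : R[i]) (h : R[i] -> R[i]) (M : R) (f : bool -> R -> R[i]).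
Hypotheses (z01 : 0 < complex.Im z0 < 1) (hh : strip_holo h) (hM : weighted_bound h M).
Let w := wexp z0.
Hypothesis mf : forall top, cmeasurable (f top).
Hypotheses (tf0 : tempered_cvg (0^'+) (hline h) (f false))
  (tf1 : tempered_cvg (1^'-) (hline h) (f true)).

Lemma side_majorant side (k c c' : R) : 0 < k ->
  (let u x := `|density w x side| * expR (- (c + k * ln `|density w x side|)) *
     normc (f side x) in
   let v x := `|density w x (~~ side)| * expR (- c') * normc (f (~~ side) x) in
   [/\ rint (setT : set RT) u, rint (setT : set RT) v &
       \int[mu]_x u x + \int[mu]_x v x <= 1]) ->
  normc (h z0) <= expR (side_value z0 k c c' side).
Proof.
move=> k0 [iu iv H]; have s1 := @side_sign_norm R side.
pose g top x := `|density w x top| * expR (- profile k c c' (side_sign side * density w x top)) *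
  normc (f top x).
have gs x : g side x = `|density w x side| * expR (- (c + k * ln `|density w x side|)) *
    normc (f side x) by rewrite /g profile_side // eqxx.
have gn x : g (~~ side) x = `|density w x (~~ side)| * expR (- c') * normc (f (~~ side) x).
  by rewrite /g profile_side //; case: (side).
have ig top : rint (setT : set RT) (g top).
  have [->|nts] := eqVneq top side; first by apply: rint_eq iu => // x _; rewrite gs.
  have -> : top = ~~ side by case: (top) (side) nts => [] [].
  by apply: rint_eq iv => // x _; rewrite gn.
have Ig : \int[mu]_x g false x + \int[mu]_x g true x <= 1.
  apply: le_trans H; rewrite le_eqVlt; apply/orP; left; apply/eqP.
  rewrite -(eq_Rint (fun x _ => gs x)) -(eq_Rint (fun x _ => gn x)).
  by case: (side) => //=; exact: addrC.
have ip := rint_profile z01 k c c' side.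
have e0 x : `|density w x false| = pker (complex.Re w) (complex.Im w) x.
  by rewrite (density_abs z01).
have e1 x : `|density w x true| = pker (- complex.Re w) (complex.Im w) x.
  by rewrite (density_abs z01).
have e2 x : - side_sign side * pker (- complex.Re w) (complex.Im w) x =
    side_sign side * density w x true by rewrite /density mulNr mulrN.
have := @harmonic_majorant R z0 h M (f false) (f true) z01 hh hM k c c' (side_sign side) k0 s1.
rewrite -/w => HM; rewrite -integral_profile //.
have E1 : \int[mu]_x (pker (- complex.Re w) (complex.Im w) x *
    profile k c c' (- side_sign side * pker (- complex.Re w) (complex.Im w) x)) =
  \int[mu]_x (pker (- complex.Re w) (complex.Im w) x *
    profile k c c' (side_sign side * density w x true)).
  by apply: eq_Rint => x _; rewrite e2.
have H0 : rint (setT : set RT) (fun x => pker (complex.Re w) (complex.Im w) x *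
    profile k c c' (side_sign side * pker (complex.Re w) (complex.Im w) x)).
  by apply: rint_eq (ip false) => // x _; rewrite -/w e0.
have H1 : rint (setT : set RT) (fun x => pker (- complex.Re w) (complex.Im w) x *
    profile k c c' (- side_sign side * pker (- complex.Re w) (complex.Im w) x)).
  by apply: rint_eq (ip true) => // x _; rewrite -/w e1 e2.
have g0 x : g false x = pker (complex.Re w) (complex.Im w) x *
    expR (- profile k c c' (side_sign side * pker (complex.Re w) (complex.Im w) x)) *
    normc (f false x) by rewrite /g e0.
have g1 x : g true x = pker (- complex.Re w) (complex.Im w) x *
    expR (- profile k c c' (- side_sign side * pker (- complex.Re w) (complex.Im w) x)) *
    normc (f true x) by rewrite /g e1 e2.
have G0 := rint_eq (fun x _ => g0 x) measurableT (ig false).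
have G1 := rint_eq (fun x _ => g1 x) measurableT (ig true).
rewrite (eq_Rint (fun x _ => g0 x)) (eq_Rint (fun x _ => g1 x)) in Ig.
apply: (le_trans (HM H0 H1 (mf false) (mf true) tf0 tf1 G0 G1 Ig)).
by rewrite -/w -E1 ler_expR.
Qed.

Lemma density_gt0 x top : 0 < `|density w x top|.
Proof.
by rewrite (density_abs z01) -/w; case: (top); rewrite pker_gt0 // Im_wexp_gt0.
Qed.

Lemma density_sup_integral top (B : R) : 0 < B -> (cLnorm +oo (f top) <= B%:E)%E ->
  let v x := `|density w x top| * expR (- ln B) * normc (f top x) in
  rint (setT : set RT) v /\ \int[mu]_x v x <= mass (complex.Im z0) top.
Proof.
move=> B0 fB; have [id Id _ _] := density_entropy z01 top.
have [i1 I1] := ae_rint_mul (ltW B0) (mf top) (elimT (cLnormyP _ _) fB) id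
  (fun x => normr_ge0 _).
have E x : `|density w x top| * expR (- ln B) * normc (f top x) =
    B^-1 * (`|density w x top| * normc (f top x)).
  by rewrite expRN lnK ?posrE // mulrCA mulrA mulrAC.
split; first by apply: rint_eq (rintZ B^-1 measurableT i1) => // x _; rewrite E.
rewrite (eq_Rint (fun x _ => E x)) RintegralZl // -Id -ler_pdivlMl ?invr_gt0 // invrK.
exact: I1.
Qed.

(** The density cancels on the $L^1$ line: $P\exp(-(c+\ln P))=e^{-c}=(1-\alpha)/A$. The constants
    make the two boundary integrals at most the masses $1-\alpha$ and $\alpha$. *)
Lemma majorant_1y (A B : R) : 0 < A -> 0 < B ->
  (cLnorm 1%E (f false) <= A%:E)%E -> (cLnorm +oo (f true) <= B%:E)%E ->
  normc (h z0) <= expR (side_value z0 1 (ln A - ln (1 - complex.Im z0)) (ln B) false).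
Proof.
move=> A0 B0 fA fB; have /andP[a0 a1] := z01.
apply: side_majorant => //.
have [iv Iv] := density_sup_integral B0 fB.
have [i1 I1] := cLnorm1_le (mf false) fA.
set c := ln A - _; have cE : expR (- c) = (1 - complex.Im z0) / A.
  by rewrite /c opprB expRD expRN !lnK ?posrE // subr_gt0.
have E x : `|density w x false| * expR (- (c + 1 * ln `|density w x false|)) *
    normc (f false x) = expR (- c) * normc (f false x).
  rewrite mul1r opprD expRD expRN (expRN (ln _)) lnK ?posrE ?density_gt0 //.
  by have := lt0r_neq0 (density_gt0 x false) => d0; field; rewrite d0 gt_eqF ?expR_gt0.
split => //=.
  by apply: rint_eq (rintZ (expR (- c)) measurableT i1) => // x _; rewrite E.
rewrite (eq_Rint (fun x _ => E x)) RintegralZl //.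
apply: (@le_trans _ _ ((1 - complex.Im z0) + complex.Im z0)); last by rewrite subrK.
apply: lerD => //; rewrite cE -mulrA ler_piMr ?subr_ge0 ?(ltW a1) //.
by rewrite mulrC ler_pdivrMr // mul1r.
Qed.

(** On the $L^2$ line $\sqrt P\,e^{-c}|f|\le\frac12(e^{-2c}|f|^2+P)$, and $e^{-2c}=\alpha/B^2$ makes
    each of the two halves contribute at most $\alpha/2$. The other line contributes at most its
    mass $1-\alpha$. *)
Lemma majorant_y2 (A B : R) : 0 < A -> 0 < B ->
  (cLnorm +oo (f false) <= A%:E)%E -> (cLnorm 2%:E (f true) <= B%:E)%E ->
  normc (h z0) <= expR (side_value z0 2^-1 (ln B - ln (complex.Im z0) / 2) (ln A) true).
Proof.
move=> A0 B0 fA fB; have /andP[a0 a1] := z01.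
apply: side_majorant; first by rewrite invr_gt0.
have [iv Iv] := density_sup_integral A0 fA.
have [i1 I1] := cLnorm2_le (mf true) fB.
have [id Id _ _] := density_entropy z01 true.
set c := ln B - _; have cE : expR (- c) ^+ 2 = complex.Im z0 / B ^+ 2.
  rewrite -expRM_natl /c.
  have -> : 2 * - (ln B - ln (complex.Im z0) / 2) = ln (complex.Im z0) - 2 * ln B by field.
  by rewrite expRD expRN expRM_natl !lnK ?posrE.
clearbody c.
pose u x := `|density w x true| * expR (- (c + 2^-1 * ln `|density w x true|)) * normc (f true x).
pose v x := 2^-1 * (expR (- c) ^+ 2 * normc (f true x) ^+ 2 + `|density w x true|).
have u0 x : 0 <= u x by rewrite /u !mulr_ge0 ?expR_ge0 ?normc_ge0.
have uv x : u x <= v x.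
  pose q := expR (2^-1 * ln `|density w x true|).
  have qE : `|density w x true| = q ^+ 2.
    by rewrite -expRM_natl mulrA divff ?mul1r ?lnK ?posrE ?density_gt0 // pnatr_eq0.
  have q0 : 0 < q by exact: expR_gt0.
  have -> : u x = q * expR (- c) * normc (f true x).
    rewrite /u opprD expRD (expRN (_ * _)) -/q qE; move: (expR (- c)) => t.
    by field; exact: lt0r_neq0.
  rewrite /v qE; have := sqr_ge0 (expR (- c) * normc (f true x) - q).
  by move: (expR (- c)) (normc _) => t m; nra.
have iV : rint (setT : set RT) v.
  by apply: rintZ => //; apply: rintD => //; exact: rintZ.
have iu : rint (setT : set RT) u.
  apply: rint_le iV => //; last by move=> x _; rewrite ger0_norm.
  apply: measurable_funM; last exact: cmeas_normc (mf true).
  have md := rint_measurable id.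
  apply: (@eq_measurable_fun _ _ _ _ _
    (fun x => expR (- c) * (`|density w x true| `^ 2^-1))).
    move=> x _; rewrite opprD expRD /powR gt_eqF ?density_gt0 //.
    have dE : `|density w x true| = expR (2^-1 * ln `|density w x true|) ^+ 2.
      by rewrite -expRM_natl mulrA divff ?mul1r ?lnK ?posrE ?density_gt0 // pnatr_eq0.
    rewrite {2}dE (expRN (_ * _)).
    move: (expR (- c)) (expR (2^-1 * _)) (expR_gt0 (2^-1 * ln `|density w x true|)) => t q q0.
    by field; exact: lt0r_neq0.
  by apply: measurable_funM => //; exact: (measurableT_comp (measurable_powR _) md).
have Iu : \int[mu]_x u x <= complex.Im z0.
  apply: (@le_trans _ _ (\int[mu]_x v x)); first exact: ler_Rint.
  have i2 := rintZ (expR (- c) ^+ 2) measurableT i1.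
  rewrite RintegralZl //; last exact: rintD.
  rewrite RintegralD // Id RintegralZl // cE.
  have H : complex.Im z0 / B ^+ 2 * \int[mu]_x normc (f true x) ^+ 2 <= complex.Im z0.
    by rewrite mulrAC ler_pdivrMr ?exprn_gt0 // ler_pM2l.
  by move: H; move: (_ * \int[mu]_x _) => q; rewrite /mass; lra.
split => //; apply: le_trans (lerD Iu Iv) _.
by rewrite /mass addrC subrK.
Qed.

End Majorant.

End PointwiseBounds.

(** * From pointwise bounds to the supremum *)

Section Constants.
Context {R : realType}.
Local Notation mu := (@lebesgue_measure R).
Local Notation RT := (measurableTypeR R).
Implicit Types (x y : R) (h : R[i] -> R[i]) (f : R -> R[i]) (p q : \bar R).

(** By continuity the modulus exceeds any smaller number on a whole interval, which is not a null
    set. *)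
Lemma cLnormy_point f x : ccont f x -> ((normc (f x))%:E <= cLnorm +oo f)%E.
Proof.
move=> cf; rewrite leNgt; apply/negP.
have := cLnorm_ge0 +oo%E f; case E : (cLnorm +oo f) => [B| |] // B0.
rewrite lte_fin => Bf.
have : (cLnorm +oo f <= B%:E)%E by rewrite E.
move/cLnormyP => [N [mN N0 sN]].
have e0 : 0 < normc (f x) - B by rewrite subr_gt0.
have [d d0 Hd] := cf _ e0.
have sub : (`]x - d, x + d[ : set RT) `<=` N.
  move=> t /=; rewrite in_itv /= => /andP[t1 t2]; apply: sN => /= Bt.
  have := Hd t; rewrite ltr_distl t1 t2 => /(_ isT).
  have := lerB_normc (f x) (f t); rewrite normcBC; lra.
have : (mu (`](x - d)%R, (x + d)%R[ : set RT) <= mu N)%E.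
  by apply: le_measure => //; rewrite inE.
rewrite N0 lebesgue_measure_itv /= lte_fin.
have -> : x - d < x + d by lra.
by rewrite -EFinD lee_fin; lra.
Qed.

Lemma eq0_of_exp (n K a : R) : 0 <= n -> 0 < a -> (forall t, n <= expR (a * t + K)) -> n = 0.
Proof.
move=> n0 a0 H; apply/eqP; rewrite eq_le n0 andbT leNgt; apply/negP => n1.
have := H ((ln n - 1 - K) / a); rewrite mulrC divfK ?gt_eqF // subrK.
rewrite expRD lnK ?posrE // -{1}[n]mulr1 ler_pM2l // leNgt => /negP; apply.
by rewrite expR_lt1; lra.
Qed.

Variables (p q : \bar R) (C : R -> R) (alpha : R).
Hypotheses (Hp : exponent p) (Hq : exponent q) (a01 : 0 < alpha < 1).

Hypothesis majorant : forall h (f0 f1 : R -> R[i]) (A B : R) z,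
  Hspace p q h -> boundary_values p q h f0 f1 -> 0 < A -> 0 < B ->
  (cLnorm p f0 <= A%:E)%E -> (cLnorm q f1 <= B%:E)%E -> strip z ->
  normc (h z) <= expR ((1 - complex.Im z) * ln A + complex.Im z * ln B + C (complex.Im z)).

Hypothesis extremal_family : forall e : R, 0 < e -> exists h (f0 f1 : R -> R[i]),
  [/\ Hspace p q h, boundary_values p q h f0 f1, (cLnorm p f0 <= 1)%E,
      (cLnorm q f1 <= 1)%E & expR (C alpha - e) <= normc (h (0 +i* alpha))].

(** If one norm vanished, [majorant] would apply with $e^t$ in place of that norm for every [t], and
    $t\to-\infty$ would force [h z = 0] ([eq0_of_exp]). With both norms positive and finite, the
    quotient in [Hconst] is an ordinary one. *)
Lemma boundary_norms h f0 f1 : Hspace p q h -> (exists2 z, strip z & h z != 0) ->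
  boundary_values p q h f0 f1 -> exists N0 N1 : R,
  [/\ 0 < N0, 0 < N1, cLnorm p f0 = N0%:E & cLnorm q f1 = N1%:E].
Proof.
move=> Hh [z sz hz] bv; have [[_ n0] [_ n1] _ _] := bv.
have g0 := cLnorm_ge0 p f0; have g1 := cLnorm_ge0 q f1.
have [N0 E0] : exists N0 : R, cLnorm p f0 = N0%:E.
  by move: n0 g0; case: (cLnorm p f0) => // N0 _ _; exists N0.
have [N1 E1] : exists N1 : R, cLnorm q f1 = N1%:E.
  by move: n1 g1; case: (cLnorm q f1) => // N1 _ _; exists N1.
have /andP[z0 z1] : 0 < complex.Im z < 1 by exact: sz.
have hn : normc (h z) != 0 by rewrite normc_eq0.
rewrite E0 lee_fin in g0; rewrite E1 lee_fin in g1.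
exists N0, N1; split => //; rewrite lt_neqAle ?g0 ?g1 andbT eq_sym; apply/eqP => N00.
  have m1 : 0 < N1 + 1 by lra.
  case/eqP: hn; apply: (@eq0_of_exp _ (complex.Im z * ln (N1 + 1) + C (complex.Im z))
    (1 - complex.Im z)); rewrite ?normc_ge0 ?subr_gt0 // => t.
  have := majorant Hh bv (expR_gt0 t) m1 _ _ sz; rewrite expRK addrA; apply.
    by rewrite E0 N00 lee_fin expR_ge0.
  by rewrite E1 lee_fin; lra.
have m1 : 0 < N0 + 1 by lra.
case/eqP: hn; apply: (@eq0_of_exp _ ((1 - complex.Im z) * ln (N0 + 1) + C (complex.Im z))
  (complex.Im z)); rewrite ?normc_ge0 // => t.
have := majorant Hh bv m1 (expR_gt0 t) _ _ sz; rewrite expRK.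
rewrite -addrA (addrCA (_ * t)); apply.
  by rewrite E0 lee_fin; lra.
by rewrite E1 N00 lee_fin expR_ge0.
Qed.

Lemma denominatorE (N0 N1 : R) : 0 < N0 -> 0 < N1 ->
  (N0%:E `^ (1 - alpha) * N1%:E `^ alpha)%E =
  (expR ((1 - alpha) * ln N0 + alpha * ln N1))%:E.
Proof. by move=> n0 n1; rewrite !poweR_EFin /powR !gt_eqF // -EFinM expRD. Qed.

(** The upper bound is [majorant] at all points of height [alpha], with the norms themselves as [A]
    and [B]. For the lower bound the boundary norms are at most 1, hence so is the denominator, and
    the single point $i\alpha$ bounds the numerator from below. *)
Lemma Hconst_eq : Hconst p q alpha = (expR (C alpha))%:E.
Proof.
have /andP[a0 a1] := a01.
have up h f0 f1 (N0 N1 : R) : Hspace p q h -> boundary_values p q h f0 f1 -> 0 < N0 -> 0 < N1 ->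
    cLnorm p f0 = N0%:E -> cLnorm q f1 = N1%:E ->
    (cLnorm +oo (hline h alpha) <=
      (expR ((1 - alpha) * ln N0 + alpha * ln N1 + C alpha))%:E)%E.
  move=> Hh bv n0 n1 E0 E1; apply: cLnormy_ge => x.
  have := majorant (z := x +i* alpha) Hh bv n0 n1; apply => //.
    by rewrite E0.
  by rewrite E1.
apply/eqP; rewrite eq_le; apply/andP; split.
  apply: ub_ereal_sup => _ [h [f0 [f1 [Hh hz bv ->]]]].
  have [N0 [N1 [n0 n1 E0 E1]]] := boundary_norms Hh hz bv.
  have := up _ _ _ _ _ Hh bv n0 n1 E0 E1; rewrite E0 E1 denominatorE //.
  set D := (1 - alpha) * _ + _; rewrite expRD EFinM => H.
  by rewrite inver gt_eqF ?expR_gt0 // lee_pdivrMr ?expR_gt0 // muleC.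
apply/lee_subgt0Pr => e e0.
(* By $e^{-u}\ge1-u$, this error in the exponent costs at most [e] in the exponential. *)
have ee : 0 < e / (expR (C alpha)) by rewrite divr_gt0 // expR_gt0.
have [h [f0 [f1 [Hh bv l0 l1 Hx]]]] := extremal_family ee.
have nz : exists2 z, strip z & h z != 0.
  exists (0 +i* alpha); first exact: a01.
  by rewrite -normc_gt0 (lt_le_trans _ Hx) // expR_gt0.
have [N0 [N1 [n0 n1 E0 E1]]] := boundary_norms Hh nz bv.
apply: (@le_trans _ _ (cLnorm +oo (hline h alpha) /
   (cLnorm p f0 `^ (1 - alpha) * cLnorm q f1 `^ alpha))%E); last first.
  by apply: ereal_sup_ubound; exists h, f0, f1.
rewrite E0 E1 denominatorE // inver gt_eqF ?expR_gt0 // lee_pdivlMr ?expR_gt0 //.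
have cl : ccont (hline h alpha) 0.
  apply: (@cdiff_ccont_h _ h); apply: (Hspace_strip_holo Hh); exact: a01.
apply: le_trans (cLnormy_point cl).
rewrite -EFinB -EFinM lee_fin; apply: le_trans Hx.
rewrite E0 lee_fin in l0; rewrite E1 lee_fin in l1.
have d1 : expR ((1 - alpha) * ln N0 + alpha * ln N1) <= 1.
  have f1' := ln_le0 l0; have h2' := ln_le0 l1; rewrite expR_le1; nra.
have key : expR (C alpha) - e <= expR (C alpha - e / expR (C alpha)).
  rewrite expRD; have := expR_ge1Dx (- (e / expR (C alpha))) => H.
  have := ler_wpM2l (expR_ge0 (C alpha)) H; apply: le_trans.
  by rewrite mulrDr mulr1 mulrN mulrCA divff ?gt_eqF ?expR_gt0 // mulr1.
have [neg|pos] := leP (expR (C alpha) - e) 0.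
  apply: (@le_trans _ _ 0); last exact: expR_ge0.
  by rewrite mulr_le0_ge0 // expR_ge0.
by apply: le_trans key; rewrite ler_piMr // ltW.
Qed.

End Constants.

Section SharpConstants.
Context {R : realType}.
Local Notation mu := (@lebesgue_measure R).
Local Notation RT := (measurableTypeR R).
Variable alpha : R.
Hypothesis a01 : 0 < alpha < 1.

Lemma extremal_in_class (p q : \bar R) (e : R) (g : {poly R[i]}) : 0 < e ->
  exponent p -> exponent q ->
  let h := extremal e (wexp (0 +i* alpha)) g in
  [/\ Hspace p q h, boundary_values p q h (fun x => h (x +i* 0)) (fun x => h (x +i* 1)) &
      cmeasurable (fun x => h (x +i* 0)) /\ cmeasurable (fun x => h (x +i* 1))].
Proof.
move=> e0 Hp Hq h; have w0 : 0 < complex.Im (wexp (0 +i* alpha)) by exact: Im_wexp_gt0.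
have [C C0 HC] := extremal_weight w0 g e0.
have dh x y : 0 <= y <= 1 -> cdiff h (x +i* y) by exact: cdiff_extremal.
split; [exact: decaying_Hspace C0 dh HC _ _ Hp Hq|exact: decaying_boundary_values C0 dh HC _ _ Hp Hq|].
by split; apply: (cmeasurable_closed_line dh); rewrite lexx ler01.
Qed.

(** The [side_value] for unit boundary norms with the logarithm on the lower line: [k = 1],
    [c = - ln (1 - a)], and 0 on the upper line. *)
Definition log_const_1y (a : R) : R := entropy a false - (1 - a) * ln (1 - a).
(** The same with the logarithm on the upper line, of mass [a]: [k] is one half and [c] is
    [- ln a / 2]. *)
Definition log_const_y2 (a : R) : R := (entropy a true - a * ln a) / 2.

Lemma Hconst_1y : Hconst 1%E +oo%E alpha = (expR (log_const_1y alpha))%:E.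
Proof.
have /andP[a0 a1] := a01.
have p1 : exponent (1%E : \bar R) by left.
have py : exponent (+oo%E : \bar R) by right; right.
apply: Hconst_eq => //.
  move=> h f0 f1 A B z Hh [[m0 _] [m1 _] t0 t1] A0 B0 fA fB sz.
  have [M hM] := Hspace_weighted_bound p1 py Hh.
  pose f (top : bool) := if top then f1 else f0.
  have mf top : cmeasurable (f top) by case: top.
  have := majorant_1y (f := f) sz (Hspace_strip_holo Hh) hM mf t0 t1 A0 B0 fA fB.
  congr (_ <= expR _); rewrite /side_value /mass /log_const_1y; ring.
move=> e e0; have e4 : 0 < e / 4 by rewrite divr_gt0.
have kr : 1 * 1%:R = 1 :> R by rewrite mulr1.
have nc : expR (1%:R * - ln (1 - alpha)) * mass alpha false = 1.
  by rewrite mul1r expRN lnK ?posrE ?subr_gt0 // mulVf // gt_eqF // subr_gt0.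
have [g [i1 I1 B1 L]] := extremal_exists a01 ltr01 kr nc e4.
have [Hs bv [m0 m1]] := extremal_in_class g e4 p1 py.
eexists; eexists; eexists; split; [exact: Hs|exact: bv| | |].
- apply: cLnorm1_ge; first by apply: rint_eq i1 => // x _; rewrite expr1.
  by apply: le_trans I1; rewrite le_eqVlt; apply/orP; left; apply/eqP; apply: eq_Rint => x _; rewrite expr1.
- exact: cLnormy_ge B1.
apply: le_trans L; rewrite ler_expR /side_value /mass /log_const_1y /=.
by rewrite le_eqVlt; apply/orP; left; apply/eqP; field.
Qed.

Lemma Hconst_y2 : Hconst +oo%E 2%:E alpha = (expR (log_const_y2 alpha))%:E.
Proof.
have /andP[a0 a1] := a01.
have p2 : exponent (2%:E : \bar R) by right; left.
have py : exponent (+oo%E : \bar R) by right; right.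
apply: Hconst_eq => //.
  move=> h f0 f1 A B z Hh [[m0 _] [m1 _] t0 t1] A0 B0 fA fB sz.
  have [M hM] := Hspace_weighted_bound py p2 Hh.
  pose f (top : bool) := if top then f1 else f0.
  have mf top : cmeasurable (f top) by case: top.
  have := majorant_y2 (f := f) sz (Hspace_strip_holo Hh) hM mf t0 t1 A0 B0 fA fB.
  by congr (_ <= expR _); rewrite /side_value /mass /log_const_y2 /=; field.
move=> e e0; have e4 : 0 < e / 4 by rewrite divr_gt0.
have k0 : 0 < 2^-1 :> R by rewrite invr_gt0.
have kr : 2^-1 * 2%:R = 1 :> R by rewrite mulVf // pnatr_eq0.
have nc : expR (2%:R * - (ln alpha / 2)) * mass alpha true = 1.
  have -> : 2%:R * - (ln alpha / 2) = - ln alpha by field.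
  by rewrite expRN lnK ?posrE // mulVf // gt_eqF.
have [g [i1 I1 B1 L]] := extremal_exists a01 k0 kr nc e4.
have [Hs bv [m0 m1]] := extremal_in_class g e4 py p2.
eexists; eexists; eexists; split; [exact: Hs|exact: bv| | |].
- exact: cLnormy_ge B1.
- by apply: cLnorm2_ge => //; rewrite expr1n.
apply: le_trans L; rewrite ler_expR /side_value /mass /log_const_y2 /=.
by rewrite le_eqVlt; apply/orP; left; apply/eqP; field.
Qed.

Lemma Im_Li2_clausen : complex.Im (Li2 (expi (2 * pi * alpha))) = clausen (2 * pi * alpha).
Proof.
have /andP[a0 a1] := a01; have p0 := @pi_gt0 R; apply: Im_Li2_expi.
by rewrite !mulr_gt0 //= -[ltRHS]mulr1 ltr_pM2l // mulr_gt0.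
Qed.

Lemma clausen_complement :
  clausen (2 * (pi * (1 - alpha))) = - clausen (2 * pi * alpha).
Proof.
have /andP[a0 a1] := a01; have p0 := @pi_gt0 R.
rewrite -clausenN; first by congr clausen; ring.
by rewrite !mulr_gt0 //= -[ltRHS]mulr1 ltr_pM2l // mulr_gt0.
Qed.

Lemma sin_pi_alpha_gt0 : 0 < sin (pi * alpha).
Proof.
have /andP[a0 a1] := a01; have p0 := @pi_gt0 R.
by rewrite sin_gt0_pi // mulr_gt0 //= -[ltRHS]mulr1 ltr_pM2l.
Qed.

Lemma log_const_1yE : log_const_1y alpha =
  - (1 - alpha) * ln (4 * (1 - alpha) * sin (pi * alpha))
  + pi^-1 * complex.Im (Li2 (expi (2 * pi * alpha))).
Proof.
have /andP[a0 a1] := a01; have s0 := sin_pi_alpha_gt0.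
rewrite /log_const_1y /entropy /mass clausen_complement Im_Li2_clausen.
have -> : 4 * (1 - alpha) * sin (pi * alpha) = (1 - alpha) * (4 * sin (pi * alpha)) by ring.
have -> : ln ((1 - alpha) * (4 * sin (pi * alpha))) = ln (1 - alpha) + ln (4 * sin (pi * alpha)).
  by apply: lnM; rewrite posrE; [rewrite subr_gt0|rewrite mulr_gt0].
ring.
Qed.

Lemma exp_log_const_y2 : expR (log_const_y2 alpha) =
  ((4 * alpha * sin (pi * alpha)) `^ (alpha / 2))^-1
     * expR ((2 * pi)^-1 * CI2 (2 * pi * (1 - alpha))).
Proof.
have /andP[a0 a1] := a01; have s0 := sin_pi_alpha_gt0; have p0 := @pi_gt0 R.
have P : 0 < 4 * alpha * sin (pi * alpha) by rewrite !mulr_gt0.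
rewrite CI2E; last by rewrite !mulr_ge0 ?subr_ge0 // ltW.
rewrite -(mulrA 2 pi (1 - alpha)) clausen_complement /powR gt_eqF // -expRN -expRD; congr expR.
have -> : 4 * alpha * sin (pi * alpha) = alpha * (4 * sin (pi * alpha)) by ring.
have -> : ln (alpha * (4 * sin (pi * alpha))) = ln alpha + ln (4 * sin (pi * alpha)).
  by rewrite lnM ?posrE ?mulr_gt0.
rewrite /log_const_y2 /entropy /mass (mulrA 2 pi alpha).
move: (clausen _) (ln alpha) (ln _) => c l l'.
by move: (@pi R) p0 => q q0; field; exact: lt0r_neq0.
Qed.

End SharpConstants.

Theorem mainTheorem3 (R : realType) (alpha : R) (h0 : 0 < alpha) (h1 : alpha < 1) :
  lne (Hconst 1%E +oo%E alpha) =
    (- (1 - alpha) * ln (4 * (1 - alpha) * sin (pi * alpha))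
     + pi^-1 * complex.Im (Li2 (expi (2 * pi * alpha))))%:E
  /\
  Hconst +oo%E 2%:E alpha =
    (((4 * alpha * sin (pi * alpha)) `^ (alpha / 2))^-1
     * expR ((2 * pi)^-1 * CI2 (2 * pi * (1 - alpha))))%:E.
Proof.
have a01 : 0 < alpha < 1 by rewrite h0.
split; last by rewrite Hconst_y2 // exp_log_const_y2.
by rewrite Hconst_1y // lne_EFin ?expR_gt0 // expRK log_const_1yE.
Qed.
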